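(* Let $n\ge2$ be an integer, $\alpha>0$, $\tau=2\pi/n$, and identify $\mathbb{R}^2$ with $\mathbb{C}$, with complex unit $J$. Let $$\Lambda=\{y\in H^1_{2\pi}(\mathbb{R},\mathbb{C}): y(t)\ne y(t+h\tau)\ \text{for all } t\in\mathbb{R},\ h=1,\dots,n-1\}$$ and, for $\omega>0$ and $y\in\Lambda$, $$\mathcal{A}(y)=\frac12\int_0^{2\pi}|\dot y(t)+J\omega y(t)|^2\,dt+\frac12\sum_{h=1}^{n-1}\int_0^{2\pi}\frac{dt}{|y(t)-y(t+h\tau)|^\alpha}.$$ Let $k$ be a positive integer and let $\tilde k=\gcd(k,n)$, with $\tilde k>1$ and $\tilde k\neq n$. Then there exists $\epsilon=\epsilon(\alpha,n,k)>0$ such that, if $\omega\in(k-\epsilon,k+\epsilon)\setminus\{k\}$, the minimum of $\mathcal{A}$ on $\Lambda$ is attained on a planar $2\pi$-periodic orbit with winding number $k$ (about the center of mass, up to orientation) which is not a relative equilibrium motion.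
   Context: $H^1_{2\pi}(\mathbb{R},\mathbb{C})$ is the space of $2\pi$-periodic functions that are locally in the Sobolev class $H^1$. $\mathcal{A}$ is the Lagrangian action of $n$ equal unit masses $y_i(t)=y(t+i\tau)$, $i=0,\dots,n-1$, in a frame rotating with angular velocity $\omega$ (orbits in the inertial frame and in the rotating frame are related by $x(t)=e^{J\omega t}y(t)$). The center of mass is that of the $n$ bodies $y_i$. The winding number is taken in absolute value, i.e. without regard to the sense in which the curve $t\mapsto y(t)$, $t\in[0,2\pi]$, is traversed. A central configuration is a configuration (with center of mass at the origin) in which the acceleration vector of every particle, under the attraction given by the pair potential $-1/|q_i-q_j|^\alpha$, is $\ddot q_i=-cq_i$ with a common $c>0$. A relative equilibrium motion is a rigid and uniform rotation of a central configuration around its center of mass. *)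

(* Defs.v *)
From HB Require Import structures.
From mathcomp Require Import all_boot all_order all_algebra.
From mathcomp Require Import all_classical all_reals all_analysis.
From mathcomp Require Export complex.

Set Implicit Arguments.
Unset Strict Implicit.
Unset Printing Implicit Defensive.

Import Order.TTheory GRing.Theory Num.Theory.
Import numFieldNormedType.Exports.

Local Open Scope classical_set_scope.
Local Open Scope ring_scope.
Local Open Scope complex_scope.

Section choreographies.
Context {R : realType}.
Implicit Types (y v : R -> R[i]) (alpha omega : R) (n : nat).

Definition cabs (z : R[i]) : R := ComplexField.Normc.normc z.

Definition expi (x : R) : R[i] := cos x +i* sin x.

(* f is locally absolutely continuous (the indefinite integral of g), with
   derivative g locally square integrable. *)
Definition H1_deriv (f g : R -> R) : Prop :=
  [/\ measurable_fun setT g,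
      forall a b, (@lebesgue_measure R).-integrable `[a, b]
        (fun t => ((g t) ^+ 2)%:E) &
      forall a b, a <= b ->
        f b - f a = \int[@lebesgue_measure R]_(t in `[a, b]) g t].

Definition H1_cderiv y v : Prop :=
  H1_deriv (fun t => complex.Re (y t)) (fun t => complex.Re (v t)) /\
  H1_deriv (fun t => complex.Im (y t)) (fun t => complex.Im (v t)).

(* Elements of H^1 are identified with their continuous representatives. *)
Definition H1_2pi : set (R -> R[i]) :=
  [set y | (forall t, y (t + 2 * pi) = y t) /\ exists v, H1_cderiv y v].

(* A choice of weak derivative; it is determined up to a null set for y in
   H1_2pi, and is 0 for y without weak derivative. *)
Definition wderiv y : R -> R[i] := xget (fun=> 0) [set v | H1_cderiv y v].

Definition tau n : R := 2 * pi / n%:R.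

Definition Lambda n : set (R -> R[i]) :=
  [set y | H1_2pi y /\
    forall t h, (1 <= h < n)%N -> y t != y (t + h%:R * tau n)].

Definition period_integral (f : R -> R) : \bar R :=
  (\int[@lebesgue_measure R]_(t in `[0%R, (2 * pi)%R]) (f t)%:E)%E.

Definition kinetic omega y : \bar R :=
  period_integral (fun t => cabs (wderiv y t + (0 +i* omega) * y t) ^+ 2).

Definition potential n alpha y : \bar R :=
  (\sum_(1 <= h < n)
     period_integral (fun t => (cabs (y t - y (t + h%:R * tau n)) `^ alpha)^-1)%R)%E.

Definition action n alpha omega y : \bar R :=
  ((2^-1)%:E * kinetic omega y + (2^-1)%:E * potential n alpha y)%E.

Definition center_of_mass n (q : 'I_n -> R[i]) : R[i] :=
  n%:R^-1 * \sum_i q i.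

Definition bodies n y (i : 'I_n) (t : R) : R[i] := y (t + i%:R * tau n).

(* Motion of the bodies in the inertial frame. *)
Definition inertial n omega y (i : 'I_n) (t : R) : R[i] :=
  expi (omega * t) * bodies y i t.

(* The closed curve g on [0, 2 pi] avoids the origin, and w is the number of
   turns of a continuous determination of its argument. *)
Definition winding_number (g : R -> R[i]) (w : int) : Prop :=
  exists theta : R -> R,
    [/\ {within `[0, 2 * pi], continuous theta},
        forall t, 0 <= t <= 2 * pi ->
          g t != 0 /\ g t = (cabs (g t))%:C * expi (theta t) &
        theta (2 * pi) - theta 0 = 2 * pi * w%:~R].

(* Unit masses: minus the gradient in q_i of
   - \sum_(j != i) 1 / |q_i - q_j|^alpha. *)
Definition acceleration n alpha (q : 'I_n -> R[i]) (i : 'I_n) : R[i] :=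
  - \sum_(j | j != i)
      (alpha / cabs (q i - q j) `^ (alpha + 2))%:C * (q i - q j).

Definition central_configuration n alpha (q : 'I_n -> R[i]) : Prop :=
  [/\ injective q,
      center_of_mass q = 0 &
      exists2 c : R, 0 < c &
        forall i, acceleration alpha q i = - (c%:C * q i)].

(* x i t is the position at time t, in the inertial frame, of body i. The
   angular velocity theta is arbitrary. *)
Definition relative_equilibrium n alpha (x : 'I_n -> R -> R[i]) : Prop :=
  exists (q : 'I_n -> R[i]) (theta : R),
    central_configuration alpha q /\
    forall i t, x i t = expi (theta * t) * q i.

End choreographies.

(* Main.v *)
Require Import Defs.
From HB Require Import structures.
From mathcomp Require Import all_boot all_order all_algebra.
From mathcomp Require Import all_classical all_reals all_analysis measurable_realfun.
From mathcomp Require Import zify ring lra.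

Set Implicit Arguments.
Unset Strict Implicit.
Unset Printing Implicit Defensive.

Import Order.TTheory GRing.Theory Num.Theory.
Import numFieldNormedType.Exports.

Local Open Scope classical_set_scope.
Local Open Scope ring_scope.

(** The proof compares the action with a limit problem. Pass to the frame
rotating with angular velocity -k: for u(t) = e^(ikt) y(t) the kinetic term is
the integral of |u' + i delta u|^2 with delta = omega - k, and the distance
from y(t) to y(t + h tau) becomes |u(t) - zeta_h u(t + h tau)| with
zeta_h = e^(-ik h tau). Here zeta_h = 1 exactly when n divides k h. As
gcd(k, n) > 1 there are such h in [1, n) ([cluster_exists]), and as
gcd(k, n) <> n the index h = 1 is not one of them. So the bodies split into
clusters: bodies of the same cluster feel only the shape of u, while bodies of
different clusters are far apart when u is close to a large constant.

When delta is 0 a large constant can be added to u for free, which makes the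
interaction between clusters disappear. What remains is the problem of
minimising half the integral of |u'|^2 plus half the potential of the shifts h
with n | k h. It has an exact lower bound, [limit_action]: by the sharp
inequality
  int |u(t + s) - u(t)|^2 dt <= 4 sin^2(s / 2) int |u'|^2
([shift_gap_le]) and the tangent lines of x^(-alpha) at the distances realised
by a circle of radius r, the coefficient of int |u'|^2 cancels for one choice
of r ([exists_radius], [act_lower]). For delta small but not 0, three further
terms remain in this lower bound: the potential of the shift h = 1, the mean
deviation of the distances inside the clusters from those on the circle, and
delta^2 int |u|^2. On the other side a circle of radius r centred at the
distance |delta|^(-1/2) from the origin has action below limit_action + eta
once delta is small ([test_orbit]).

Therefore every loop with action at most limit_action + eta ([sublevel_bounds]) has
bounded oscillation |u(t) - u(0)| <= B; by the potential of h = 1 it has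
|u(0)| > 2 B; its distances are bounded below, since a near collision between
clusters is excluded by |u(0)| being large and one inside a cluster would last,
by the Hoelder estimate, long enough to be seen in the mean deviation; and it
is bounded because delta^2 int |u|^2 is, which is where omega <> k enters.
A minimiser exists by [direct_method].

Once the minimiser has these properties, y minus the centre of mass is
e^(-ikt) (u(0) + W(t)) with |W| <= 2 B < |u(0)|, since the average of the
zeta_i is 0; so it turns k times around the origin ([winding_loop]). Were it a
relative equilibrium, u(t) would be e^(i lambda t) u(0): for lambda <> 0 it
reaches -u(0), contradicting the oscillation bound, and for lambda = 0 it is
constant, so that the bodies of a cluster collide
([not_relative_equilibrium]). *)

(** * Integrals over compact intervals *)

Section Integral.
Context {R : realType}.
Implicit Types (f g h : R -> R) (a b c : R).
Notation mu := (@lebesgue_measure R).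

Definition L1 a b f := mu.-integrable `[a, b] (EFin \o f).
Definition I a b f : R := \int[mu]_(t in `[a, b]) f t.

Lemma measurable_cc a b : measurable (`[a, b] : set (measurableTypeR R)).
Proof. exact: measurable_itv. Qed.
Hint Resolve measurable_cc : core.

Lemma L1_sub a b c d f : a <= c -> d <= b -> L1 a b f -> L1 c d f.
Proof.
move=> ac db; apply: integrableS => //.
by apply: subset_itv; rewrite bnd_simp.
Qed.

Lemma L1_cont a b f : {within `[a, b], continuous f} -> L1 a b f.
Proof.
move=> cf; apply: continuous_compact_integrable => //.
exact: segment_compact.
Qed.

Lemma L1_continuous a b f : continuous f -> L1 a b f.
Proof. by move=> cf; apply: L1_cont; exact: continuous_subspaceT. Qed.

Lemma L1D a b f g : L1 a b f -> L1 a b g -> L1 a b (fun t => f t + g t).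
Proof. by move=> If Ig; exact: (integrableD _ If Ig). Qed.

Lemma L1Z a b k f : L1 a b f -> L1 a b (fun t => k * f t).
Proof. by move=> If; exact: (integrableZl _ k If). Qed.

Lemma L1B a b f g : L1 a b f -> L1 a b g -> L1 a b (fun t => f t - g t).
Proof. by move=> If Ig; exact: (integrableB _ If Ig). Qed.

Lemma L1_norm a b f : L1 a b f -> L1 a b (fun t => `|f t|).
Proof. by move=> If; exact: (integrable_norm If). Qed.

Lemma L1_cst a b k : L1 a b (fun=> k).
Proof. apply: L1_continuous => x; exact: cvg_cst. Qed.

Lemma L1_meas a b f : L1 a b f -> measurable_fun `[a, b] f.
Proof. by move=> /integrableP[/measurable_EFinP]. Qed.

Lemma L1_le a b f g : measurable_fun `[a, b] f ->
  (forall t, a <= t <= b -> `|f t| <= g t) -> L1 a b g -> L1 a b f.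
Proof.
move=> mf fg Ig; apply: (le_integrable _ _ _ Ig) => //.
- exact/measurable_EFinP.
- move=> t /=; rewrite in_itv/= => tab; rewrite lee_fin.
  by rewrite (le_trans (fg _ tab))// ler_norm.
Qed.

Lemma eq_L1 a b f g : (forall t, a <= t <= b -> f t = g t) ->
  L1 a b f -> L1 a b g.
Proof.
move=> fg; apply: eq_integrable => // t; rewrite inE/= in_itv/= => tab.
by rewrite fg.
Qed.

Lemma I_eq a b f g : (forall t, a <= t <= b -> f t = g t) -> I a b f = I a b g.
Proof.
by move=> fg; apply: eq_Rintegral => t; rewrite inE/= in_itv/=; exact: fg.
Qed.

Lemma I_aa a f : I a a f = 0.
Proof. by rewrite /I set_itv1 Rintegral_set1. Qed.

Lemma ID a b f g : L1 a b f -> L1 a b g ->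
  I a b (fun t => f t + g t) = I a b f + I a b g.
Proof. exact: RintegralD. Qed.

Lemma IB a b f g : L1 a b f -> L1 a b g ->
  I a b (fun t => f t - g t) = I a b f - I a b g.
Proof. exact: RintegralB. Qed.

Lemma IZ a b k f : L1 a b f -> I a b (fun t => k * f t) = k * I a b f.
Proof. exact: RintegralZl. Qed.

Lemma I_cst a b k : a <= b -> I a b (fun=> k) = k * (b - a).
Proof.
move=> ab; rewrite /I Rintegral_cst//= lebesgue_measure_itv/=.
rewrite lte_fin; move: ab; rewrite le_eqVlt => /predU1P[->|->]//.
by rewrite ltxx/= subrr.
Qed.

Lemma I_le a b f g : L1 a b f -> L1 a b g ->
  (forall t, a <= t <= b -> f t <= g t) -> I a b f <= I a b g.
Proof.
move=> If Ig fg; apply: le_Rintegral => // t /=; rewrite in_itv/=; exact: fg.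
Qed.

Lemma I_ge0 a b f : (forall t, a <= t <= b -> 0 <= f t) -> 0 <= I a b f.
Proof. by move=> f0; apply: Rintegral_ge0 => t /=; rewrite in_itv/=; exact: f0. Qed.

Lemma I_norm a b f : L1 a b f -> `|I a b f| <= I a b (fun t => `|f t|).
Proof. exact: le_normr_Rintegral. Qed.

Lemma I_split a b c f : a <= c -> c <= b -> L1 a b f ->
  I a b f = I a c f + I c b f.
Proof.
move=> ac cb If; rewrite -[LHS](subrK (I a c f)) addrC; congr (_ + _).
rewrite /I (@Rintegral_itvB _ f (BLeft a) (BRight b) c)//.
by rewrite Rintegral_itv_obnd_cbnd//; apply: integrableS If => //;
  apply: subset_itv; rewrite bnd_simp.
Qed.

Lemma L1_cat a b c f : a <= c -> c <= b -> L1 a c f -> L1 c b f -> L1 a b f.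
Proof.
move=> ac cb If Jf; rewrite /L1.
have E : [set` `[a, b]] = [set` `[a, c]] `|` [set` `]c, b]] :> set R.
  apply/seteqP; split=> t /=; rewrite !in_itv/=.
    by case/andP=> at_ tb; case: (leP t c) => h; [left|right];
      rewrite ?at_ ?tb ?(ltW h).
  by case=> /andP[h1 h2]; rewrite ?h1 ?h2 ?(le_trans h2 cb) ?(le_trans ac (ltW h1)).
have Jf' : mu.-integrable `]c, b] (EFin \o f).
  by apply: integrableS Jf => //; apply: subset_itv; rewrite bnd_simp.
rewrite E; move: If Jf' => /integrableP[mf If] /integrableP[mf' If'].
have mff : measurable_fun ([set` `[a, c]] `|` [set` `]c, b]] : set (measurableTypeR R)) (EFin \o f).
  by apply/measurable_funU.
apply/integrableP; split=> //.
rewrite ge0_integral_setU//; first exact: lte_add_pinfty.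
- exact: measurableT_comp.
- apply/disj_setPS => t []/=; rewrite !in_itv/= => /andP[_ h] /andP[h' _].
  by move: (le_lt_trans h h'); rewrite ltxx.
Qed.

(** The right endpoint is a null set; the derivative of a periodic function is
prescribed only on [0, 2 pi), so endpoint values have to be ignored. *)
Lemma I_eq_co a b f g : (forall t, a <= t < b -> f t = g t) ->
  L1 a b f -> L1 a b g -> I a b f = I a b g.
Proof.
move=> fg If Ig; rewrite /I -!Rintegral_itv_bndo_bndc//.
- by apply: eq_Rintegral => t; rewrite inE/= in_itv/=; exact: fg.
- by apply: integrableS Ig => //; apply: subset_itv; rewrite bnd_simp.
- by apply: integrableS If => //; apply: subset_itv; rewrite bnd_simp.
Qed.

(** Lebesgue measure is determined by the half-open intervals, whose length a
translation preserves. *)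
Lemma lebesgue_translation c (A : set (measurableTypeR R)) : measurable A ->
  mu ((fun x => x + c) @^-1` A) = mu A.
Proof.
move=> mA; have mc : measurable_fun setT (fun x : measurableTypeR R => x + c : measurableTypeR R).
  by apply: measurable_funD.
rewrite -[LHS]/(pushforward mu (fun x : measurableTypeR R => x + c : measurableTypeR R) A).
apply/esym; have := @lebesgue_measure_unique R [the measure _ _ of pushforward mu (fun x : measurableTypeR R => x + c : measurableTypeR R)].
apply => // X /ocitvP[->|[x xab ->]].
  by rewrite !measure0.
have E : (fun t => t + c) @^-1` [set` `]x.1, x.2]] = [set` `]x.1 - c, x.2 - c]] :> set R.
  by apply/seteqP; split=> t /=; rewrite !in_itv/= ltrBlDr lerBrDr.
transitivity (mu `]x.1 - c, x.2 - c]); last by rewrite -E.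
rewrite !lebesgue_measure_itv/= !lte_fin ltrD2r; case: ifP => // _.
by rewrite -!EFinD; congr (_%:E); rewrite opprD addrACA subrr addr0.
Qed.

Lemma preimage_shift_cc a b c :
  (fun t => t + c) @^-1` [set` `[a + c, b + c]] = [set` `[a, b]] :> set R.
Proof. by apply/seteqP; split=> t /=; rewrite !in_itv/= !lerD2r. Qed.

Lemma measurable_shift c :
  measurable_fun setT (fun x : measurableTypeR R => x + c : measurableTypeR R).
Proof. exact: measurable_funD. Qed.

Lemma ge0_integral_shift a b c (F : R -> \bar R) : measurable_fun setT F ->
  (forall t, 0 <= F t)%E ->
  (\int[mu]_(t in `[(a + c)%R, (b + c)%R]) F t = \int[mu]_(t in `[a, b]) F (t + c)%R)%E.
Proof.
move=> mF F0.
pose phi := fun x : measurableTypeR R => x + c : measurableTypeR R.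
transitivity (\int[pushforward mu phi]_(t in `[(a + c)%R, (b + c)%R]) F t)%E.
  apply: eq_measure_integral; first exact: measurable_shift.
  by move=> mphi A mA _; apply/esym; exact: lebesgue_translation.
rewrite ge0_integral_pushforward//; first last.
- exact: measurable_funTS.
- exact: measurable_shift.
by rewrite preimage_shift_cc.
Qed.

(** Translation invariance of the measure gives the formula for nonnegative
functions; the general case is obtained from the positive and negative parts. *)
Lemma L1_I_shift a b c f : L1 (a + c) (b + c) f ->
  L1 a b (fun t => f (t + c)) /\ I (a + c) (b + c) f = I a b (fun t => f (t + c)).
Proof.
move=> If; pose D : set (measurableTypeR R) := [set` `[a + c, b + c]].
pose F : R -> \bar R := (EFin \o f) \_ D.
have mD : measurable D by exact: measurable_cc.
have mF : measurable_fun setT F.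
  by apply/(measurable_restrictT _ mD); case/integrableP: If.
have FE t : a <= t <= b -> F (t + c) = (f (t + c))%:E.
  by move=> tab; rewrite /F patchE mem_set//; rewrite /D/= in_itv/= !lerD2r.
have eqi G : (forall x, 0 <= G x)%E -> measurable_fun setT G ->
   (\int[mu]_(t in `[a, b]) G (F (t + c)%R) = \int[mu]_(t in `[(a + c)%R, (b + c)%R]) G (F t))%E.
  move=> G0 mG; rewrite (@ge0_integral_shift _ _ _ (fun t => G (F t)))//.
  exact: measurableT_comp.
have mFs : measurable_fun `[a, b] (fun t => F (t + c)).
  apply: measurable_funTS; apply: measurableT_comp => //; exact: measurable_shift.
have IF' : mu.-integrable `[a, b] (fun t => F (t + c)).
  apply/integrableP; split => //.
  rewrite (eqi abse)//; case/integrableP: If => _; apply: le_lt_trans.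
  rewrite le_eqVlt; apply/orP; left; apply/eqP/eq_integral => t tD.
  by rewrite /F patchE tD.
have IFs : L1 a b (fun t => f (t + c)).
  apply: eq_integrable IF' => // t; rewrite inE/= in_itv/=; exact: FE.
split=> //.
rewrite /I /Rintegral; congr fine.
transitivity (\int[mu]_(t in `[(a + c)%R, (b + c)%R]) F t)%E.
  by apply: eq_integral => t tD; rewrite /F patchE tD.
transitivity (\int[mu]_(t in `[a, b]) F (t + c)%R)%E; last first.
  by apply: eq_integral => t; rewrite inE/= in_itv/=; exact: FE.
rewrite integralE [RHS]integralE; congr (_ - _)%E.
- under eq_integral do rewrite funeposE.
  under [RHS]eq_integral do rewrite funeposE.
  apply/esym/(eqi (fun x => maxe x 0)%E) => [x|]; first by rewrite le_max lexx orbT.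
  exact: measurable_maxe.
- under eq_integral do rewrite funenegE.
  under [RHS]eq_integral do rewrite funenegE.
  apply/esym/(eqi (fun x => maxe (- x) 0)%E) => [x|]; first by rewrite le_max lexx orbT.
  by apply: measurable_maxe => //; exact: oppe_measurable.
Qed.
End Integral.

(** * Square integrable functions on an interval *)

Section Square_integrable.
Context {R : realType}.
Implicit Types (f g h : R -> R) (a b c : R).

Definition L2 a b g := measurable_fun `[a, b] g /\ L1 a b (fun t => g t ^+ 2).

Lemma L2_sub a b c d g : a <= c -> d <= b -> L2 a b g -> L2 c d g.
Proof.
move=> ac db [mg Ig]; split; last exact: L1_sub Ig.
by apply: measurable_funS mg => //; apply: subset_itv; rewrite bnd_simp.
Qed.

Lemma eq_L2 a b f g : (forall t, a <= t <= b -> f t = g t) ->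
  L2 a b f -> L2 a b g.
Proof.
move=> fg [mf If]; split; last by apply: eq_L1 If => t tab; rewrite fg.
by apply: eq_measurable_fun mf => t; rewrite inE/= in_itv/=; exact: fg.
Qed.

Lemma L2_M a b g h : L2 a b g -> L2 a b h -> L1 a b (fun t => g t * h t).
Proof.
move=> [mg Ig] [mh Ih].
apply: (@L1_le _ _ _ _ (fun t => g t ^+ 2 + h t ^+ 2)); last exact: L1D.
  exact: measurable_funM.
move=> t _; rewrite ler_norml; apply/andP; split.
  by rewrite -subr_ge0 opprK; have := sqr_ge0 (g t + h t); nra.
by rewrite -subr_ge0; have := sqr_ge0 (g t - h t); nra.
Qed.

Lemma L2_cont a b f : {within `[a, b], continuous f} -> L2 a b f.
Proof.
move=> cf; split; first by apply: L1_meas; exact: L1_cont.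
by apply: L1_cont => x; apply: (@continuousM _ (subspace `[a, b]) f f x); exact: cf.
Qed.

Lemma L2_continuous a b f : continuous f -> L2 a b f.
Proof. by move=> cf; apply: L2_cont; exact: continuous_subspaceT. Qed.

Lemma L2_cst a b k : L2 a b (fun=> k).
Proof. by apply: L2_continuous => x; exact: cvg_cst. Qed.

Lemma L2_L1 a b g : L2 a b g -> L1 a b g.
Proof.
move=> Lg; have := L2_M Lg (L2_cst a b 1).
by apply: eq_L1 => t _; rewrite mulr1.
Qed.

Lemma L2D a b g h : L2 a b g -> L2 a b h -> L2 a b (fun t => g t + h t).
Proof.
move=> Lg Lh; split; first by apply: measurable_funD; [case: Lg|case: Lh].
have := L1D (L1D (L2_M Lg Lg) (L2_M Lh Lh)) (L1Z 2 (L2_M Lg Lh)).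
by apply: eq_L1 => t _; ring.
Qed.

Lemma L2Z a b k g : L2 a b g -> L2 a b (fun t => k * g t).
Proof.
move=> [mg Ig]; split; first exact: measurable_funM.
by have := L1Z (k ^+ 2) Ig; apply: eq_L1 => t _; ring.
Qed.

Lemma L2N a b g : L2 a b g -> L2 a b (fun t => - g t).
Proof. by move=> /(L2Z (-1)); apply: eq_L2 => t _; rewrite mulN1r. Qed.

Lemma L2B a b g h : L2 a b g -> L2 a b h -> L2 a b (fun t => g t - h t).
Proof. by move=> Lg /L2N; exact: L2D. Qed.

Lemma L1_empty a b f : b < a -> L1 a b f.
Proof.
move=> ba; rewrite /L1 (_ : [set` `[a, b]] = set0).
  exact: integrable_set0.
by rewrite set_itv_ge// bnd_simp -ltNge.
Qed.

Lemma L2_Mcont a b f g : {within `[a, b], continuous f} -> L2 a b g ->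
  L2 a b (fun t => f t * g t).
Proof.
move=> cf [mg Ig]; have mfg : measurable_fun `[a, b] (fun t => f t * g t).
  by apply: measurable_funM => //; apply: L1_meas; exact: L1_cont.
split=> //; have [ab|ba] := leP a b; last exact: L1_empty.
have [c cab cmax] : exists2 c, c \in `[a, b] & forall t, t \in `[a, b] -> `|f t| <= `|f c|.
  apply: (@EVT_max _ (fun t => `|f t|)) => //.
  move=> x; apply: (@cvg_norm _ R^o); exact: cf.
apply: (@L1_le _ _ _ _ (fun t => `|f c| ^+ 2 * g t ^+ 2)); last exact: L1Z.
  exact: measurable_funM.
move=> t tab; rewrite ger0_norm ?sqr_ge0// exprMn ler_wpM2r ?sqr_ge0//.
rewrite -[f t ^+ 2]real_normK ?num_real// ler_pXn2r ?nnegrE//.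
by apply: cmax; rewrite in_itv.
Qed.

(** Cauchy-Schwarz, from the discriminant of the nonnegative quadratic form l
|-> int (l g + h)^2. *)
Lemma I_CS a b g h : L2 a b g -> L2 a b h ->
  I a b (fun t => g t * h t) ^+ 2 <=
  I a b (fun t => g t ^+ 2) * I a b (fun t => h t ^+ 2).
Proof.
move=> Lg Lh; set A := I a b (fun t => g t ^+ 2).
set B := I a b (fun t => g t * h t); set C := I a b (fun t => h t ^+ 2).
have key l : 0 <= l ^+ 2 * A + 2 * l * B + C.
  have -> : l ^+ 2 * A + 2 * l * B + C = I a b (fun t => (l * g t + h t) ^+ 2).
    have L1a := L1Z (l ^+ 2) Lg.2; have L1b := L1Z (2 * l) (L2_M Lg Lh).
    rewrite /A /B /C -!IZ//; [|exact: L2_M|by case: Lg].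
    rewrite -ID// -ID//; [|exact: L1D|by case: Lh].
    by apply: I_eq => t _; ring.
  by apply: I_ge0 => t _; exact: sqr_ge0.
have A0 : 0 <= A by apply: I_ge0 => t _; exact: sqr_ge0.
move: A0; rewrite le_eqVlt => /predU1P[A0|A0]; last first.
  have := key (- (B / A)); rewrite -(pmulr_rge0 _ A0).
  have -> : A * ((- (B / A)) ^+ 2 * A + 2 * - (B / A) * B + C) = A * C - B ^+ 2.
    by field; rewrite gt_eqF.
  by rewrite subr_ge0.
rewrite -A0 mul0r; have [->|B0] := eqVneq B 0; first by rewrite expr0n.
have := key (- ((C + 1) / (2 * B))); rewrite -A0.
have -> : (- ((C + 1) / (2 * B))) ^+ 2 * 0 + 2 * - ((C + 1) / (2 * B)) * B + C = -1.
  by field.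
by move=> N1; exfalso; lra.
Qed.

Lemma I_sq_le a b g : a <= b -> L2 a b g ->
  (I a b (fun t => `|g t|)) ^+ 2 <= (b - a) * I a b (fun t => g t ^+ 2).
Proof.
move=> ab Lg; have Ln : L2 a b (fun t => `|g t|).
  split; first by case: Lg => mg _; exact: measurableT_comp.
  by apply: eq_L1 Lg.2 => t _; rewrite real_normK ?num_real.
have := I_CS Ln (L2_cst a b 1).
under I_eq do rewrite mulr1.
under [X in _ <= X * _]I_eq do rewrite real_normK ?num_real//.
by under [X in _ <= _ * X]I_eq do rewrite expr1n; rewrite I_cst// mul1r mulrC.
Qed.

End Square_integrable.

(** * The Sobolev space H^1 of an interval *)

Section H1_interval.
Context {R : realType}.
Implicit Types (f g h : R -> R) (a b c : R).

(** f is in H^1(a, b) with derivative g; membership is expressed by the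
fundamental theorem of calculus, so that f is the continuous representative. *)
Definition H1on a b f g :=
  L2 a b g /\ forall x y, a <= x -> x <= y -> y <= b -> f y - f x = I x y g.

Lemma H1on_sub a b c d f g : a <= c -> d <= b -> H1on a b f g -> H1on c d f g.
Proof.
move=> ac db [Lg fg]; split; first exact: L2_sub Lg.
by move=> x y cx xy yd; apply: fg; rewrite ?(le_trans ac cx) ?(le_trans yd db).
Qed.

Lemma H1onD a b f g f' g' : H1on a b f f' -> H1on a b g g' ->
  H1on a b (fun t => f t + g t) (fun t => f' t + g' t).
Proof.
move=> [Lf ff] [Lg gg]; split; first exact: L2D.
move=> x y ax xy yb; rewrite ID; first 1 last.
- by apply: L2_L1; exact: L2_sub Lf.
- by apply: L2_L1; exact: L2_sub Lg.
by rewrite -ff// -gg//; ring.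
Qed.

Lemma H1onZ a b k f f' : H1on a b f f' ->
  H1on a b (fun t => k * f t) (fun t => k * f' t).
Proof.
move=> [Lf ff]; split; first exact: L2Z.
move=> x y ax xy yb; rewrite IZ; last by apply: L2_L1; exact: L2_sub Lf.
by rewrite -ff//; ring.
Qed.

Lemma H1on_cst a b k : H1on a b (fun=> k) (fun=> 0).
Proof.
split; first exact: L2_cst.
by move=> x y ax xy yb; rewrite I_cst// mul0r subrr.
Qed.

Lemma eq_H1on a b f f1 g g1 : (forall t, a <= t <= b -> f t = f1 t) ->
  (forall t, a <= t <= b -> g t = g1 t) -> H1on a b f g -> H1on a b f1 g1.
Proof.
move=> ff gg [Lg fg]; split; first exact: eq_L2 Lg.
move=> x y ax xy yb; rewrite -!ff ?ax ?yb ?(le_trans ax xy) ?(le_trans xy yb)// fg//.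
apply: I_eq => t /andP[xt ty]; apply: gg.
by rewrite (le_trans ax xt) (le_trans ty yb).
Qed.

Lemma H1onB a b f g f' g' : H1on a b f f' -> H1on a b g g' ->
  H1on a b (fun t => f t - g t) (fun t => f' t - g' t).
Proof.
move=> Hf /(H1onZ (-1)) Hg.
by apply: eq_H1on (H1onD Hf Hg) => t _; rewrite mulN1r.
Qed.

Lemma H1on_cont a b f g : H1on a b f g -> {within `[a, b], continuous f}.
Proof.
move=> [Lg fg]; have [ab|ba] := leP a b; last first.
  rewrite (_ : [set` `[a, b]] = set0); first exact: continuous_subspace0.
  by rewrite set_itv_ge// bnd_simp -ltNge.
have := @parameterized_integral_continuous R a b g ab (L2_L1 Lg).
move=> c; have {}c : {within `[a, b], continuous (fun x => f a + I a x g)}.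
  move=> x; apply: (@continuousD _ _ _ (cst (f a)) _ x); last exact: c.
  exact: cst_continuous.
move: c; apply: subspace_eq_continuous => x; rewrite inE/= in_itv/= => /andP[ax xb].
by rewrite /from_subspace -fg//; ring.
Qed.

Lemma H1on_hoelder a b f g x y : H1on a b f g -> a <= x -> x <= y -> y <= b ->
  (f y - f x) ^+ 2 <= (y - x) * I x y (fun t => g t ^+ 2).
Proof.
move=> [Lg fg] ax xy yb; rewrite fg//.
have Lg' : L2 x y g by exact: L2_sub Lg.
apply: le_trans (I_sq_le xy Lg').
rewrite -[_ ^+ 2]real_normK ?num_real// ler_pXn2r ?nnegrE//.
  exact: I_norm (L2_L1 Lg').
by apply: I_ge0.
Qed.

Lemma I_sub_le a b x y f : a <= x -> x <= y -> y <= b -> L1 a b f ->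
  (forall t, 0 <= f t) -> I x y f <= I a b f.
Proof.
move=> ax xy yb If f0.
rewrite (@I_split _ a b x)// ?(le_trans xy)// (@I_split _ x b y)//; last first.
  exact: L1_sub If.
by rewrite addrCA lerDl addr_ge0// I_ge0.
Qed.

(** Both increments of f and g are of order (b - a)^(1/2), which makes the
defect of the product formula of second order in b - a. *)
Lemma product_defect a b f g f' g' : a <= b -> H1on a b f f' -> H1on a b g g' ->
  `|f b * g b - f a * g a - I a b (fun t => f' t * g t + f t * g' t)| <=
  (b - a) * (I a b (fun t => f' t ^+ 2) + I a b (fun t => g' t ^+ 2)).
Proof.
move=> ab Hf Hg; have cf := H1on_cont Hf; have cg := H1on_cont Hg.
have Lf := Hf.1; have Lg := Hg.1.
have L1f := L2_L1 Lf; have L1g := L2_L1 Lg.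
set A := I a b (fun t => f' t ^+ 2); set B := I a b (fun t => g' t ^+ 2).
have A0 : 0 <= A by apply: I_ge0 => t _; exact: sqr_ge0.
have B0 : 0 <= B by apply: I_ge0 => t _; exact: sqr_ge0.
have L1fg : L1 a b (fun t => f' t * g t + f t * g' t).
  apply: L1D; first by apply: L2_M => //; exact: L2_cont.
  by apply: L2_M => //; exact: L2_cont.
have L1k : L1 a b (fun t => g b * f' t + f a * g' t) by apply: L1D; exact: L1Z.
have L1h : L1 a b (fun t => (g b - g t) * f' t + (f a - f t) * g' t).
  by apply: eq_L1 (L1B L1k L1fg) => t _; ring.
have -> : f b * g b - f a * g a - I a b (fun t => f' t * g t + f t * g' t) =
  I a b (fun t => (g b - g t) * f' t + (f a - f t) * g' t).
  have -> : f b * g b - f a * g a = (f b - f a) * g b + f a * (g b - g a) by ring.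
  rewrite Hf.2// Hg.2// [_ * g b]mulrC -!IZ// -ID//; try exact: L1Z.
  by rewrite -IB//; apply: I_eq => t _; ring.
set p := Num.sqrt ((b - a) * A); set q := Num.sqrt ((b - a) * B).
have p2 : p ^+ 2 = (b - a) * A by rewrite sqr_sqrtr// mulr_ge0// subr_ge0.
have q2 : q ^+ 2 = (b - a) * B by rewrite sqr_sqrtr// mulr_ge0// subr_ge0.
have p0 : 0 <= p by exact: sqrtr_ge0.
have q0 : 0 <= q by exact: sqrtr_ge0.
have fp : I a b (fun t => `|f' t|) <= p.
  rewrite -[X in X <= _]ger0_norm ?I_ge0// -sqrtr_sqr ler_wsqrtr//.
  exact: I_sq_le.
have gq : I a b (fun t => `|g' t|) <= q.
  rewrite -[X in X <= _]ger0_norm ?I_ge0// -sqrtr_sqr ler_wsqrtr//.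
  exact: I_sq_le.
apply: (le_trans (I_norm L1h)).
have : I a b (fun t => `|(g b - g t) * f' t + (f a - f t) * g' t|) <=
       I a b (fun t => q * `|f' t| + p * `|g' t|).
  apply: I_le; first exact: L1_norm.
    by apply: L1D; apply: L1Z; exact: L1_norm.
  move=> t /andP[at_ tb]; rewrite (le_trans (ler_normD _ _))// !normrM.
  apply: lerD; apply: ler_wpM2r => //.
    rewrite -[X in X <= _]sqrtr_sqr ler_wsqrtr//.
    rewrite (le_trans (H1on_hoelder Hg at_ tb (lexx b)))//.
    rewrite ler_pM ?subr_ge0 ?lerB// ?I_ge0// => [u _|]; first exact: sqr_ge0.
    by apply: I_sub_le => //; [exact: Lg.2|move=> u; exact: sqr_ge0].
  rewrite distrC -[X in X <= _]sqrtr_sqr ler_wsqrtr//.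
  rewrite (le_trans (H1on_hoelder Hf (lexx a) at_ tb))//.
  rewrite ler_pM ?subr_ge0 ?lerB// ?I_ge0// => [u _|]; first exact: sqr_ge0.
  by apply: I_sub_le => //; [exact: Lf.2|move=> u; exact: sqr_ge0].
move=> /le_trans; apply.
rewrite ID; [|by apply/L1Z/L1_norm..].
rewrite !IZ; [|exact: L1_norm..].
rewrite mulrDr -p2 -q2 (@le_trans _ _ (q * p + p * q))//.
  by apply: lerD; exact: ler_wpM2l.
by rewrite -subr_ge0; have := sqr_ge0 (p - q); nra.
Qed.

(** A second order defect loses a factor 1/2 each time the interval is halved,
because it is additive while its bound is not. *)
Lemma product_defect_dyadic m a b f g f' g' : a <= b ->
  H1on a b f f' -> H1on a b g g' ->
  `|f b * g b - f a * g a - I a b (fun t => f' t * g t + f t * g' t)| <=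
  2^-1 ^+ m * ((b - a) * (I a b (fun t => f' t ^+ 2) + I a b (fun t => g' t ^+ 2))).
Proof.
elim: m a b => [|m IHm] a b ab Hf Hg; first by rewrite expr0 mul1r; exact: product_defect.
pose c := (a + b) / 2.
have ac : a <= c by rewrite /c; lra.
have cb : c <= b by rewrite /c; lra.
have Hf1 := H1on_sub (lexx a) cb Hf; have Hf2 := H1on_sub ac (lexx b) Hf.
have Hg1 := H1on_sub (lexx a) cb Hg; have Hg2 := H1on_sub ac (lexx b) Hg.
have := lerD (IHm _ _ ac Hf1 Hg1) (IHm _ _ cb Hf2 Hg2).
have L1fg : L1 a b (fun t => f' t * g t + f t * g' t).
  have Lf := Hf.1; have Lg := Hg.1.
  by apply: L1D; apply: L2_M => //; apply: L2_cont; [exact: H1on_cont Hg|exact: H1on_cont Hf].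
rewrite (I_split ac cb L1fg) (I_split ac cb Hf.1.2) (I_split ac cb Hg.1.2).
move=> h; apply: le_trans (le_trans _ h) _.
  apply: le_trans (ler_normD _ _); rewrite le_eqVlt; apply/orP; left.
  by apply/eqP; congr `|_|; ring.
rewrite le_eqVlt; apply/orP; left; apply/eqP.
rewrite exprS (_ : c - a = 2^-1 * (b - a)); last by rewrite /c; field.
by rewrite (_ : b - c = 2^-1 * (b - a)); last (by rewrite /c; field); ring.
Qed.

(** The product rule: the defect is 0, being at most 2^(-m) times a constant for
every m. *)
Lemma H1onM a b f g f' g' : H1on a b f f' -> H1on a b g g' ->
  H1on a b (fun t => f t * g t) (fun t => f' t * g t + f t * g' t).
Proof.
move=> Hf Hg; split.
  apply: L2D; last by apply: L2_Mcont; [exact: H1on_cont Hf|case: Hg].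
  apply: (@eq_L2 _ _ _ (fun t => g t * f' t)); first by move=> t _; rewrite mulrC.
  by apply: L2_Mcont; [exact: H1on_cont Hg|case: Hf].
move=> x y ax xy yb.
have {}Hf := H1on_sub ax yb Hf; have {}Hg := H1on_sub ax yb Hg.
(* the integral formula holds because its defect tends to 0 with the mesh *)
apply/eqP; rewrite -subr_eq0 -normr_le0.
have h m := product_defect_dyadic m xy Hf Hg.
set E := _ * (_ + _) in h.
rewrite leNgt; apply/negP => d0.
set d := `|_| in d0 h.
have E0 : 0 <= E by rewrite /E mulr_ge0 ?subr_ge0// addr_ge0// I_ge0// => t _; exact: sqr_ge0.
have [m hm] : exists m, 2^-1 ^+ m * E < d.
  have : 2^-1 ^+ m * E @[m --> \oo] --> (0 * E : R).
    apply: cvgM; last exact: cvg_cst.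
    by apply: cvg_expr; rewrite ger0_norm ?invr_ge0// invf_lt1// ltr1n.
  rewrite mul0r => /cvgr_lt /(_ _ d0) [m _ /(_ m) hm]; exists m.
  by apply: hm => /=.
by have := le_lt_trans (h m) hm; rewrite ltxx.
Qed.

Lemma H1on_C1 a b F f : {within `[a, b], continuous f} ->
  (forall x, a <= x <= b -> is_derive x 1 F (f x)) -> H1on a b F f.
Proof.
move=> cf dF; split; first exact: L2_cont.
move=> x y ax; rewrite le_eqVlt => /predU1P[<- _|xy yb]; first by rewrite subrr I_aa.
have cF z : x <= z <= y -> {for z, continuous F}.
  move=> /andP[xz zy]; apply/differentiable_continuous/derivable1_diffP.
  by have [] := dF z; rewrite ?(le_trans ax xz) ?(le_trans zy yb).
rewrite /I /Rintegral (@continuous_FTC2 _ f F)//.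
- by apply: continuous_subspaceW cf; apply: subset_itv; rewrite bnd_simp.
- split.
  + move=> z; rewrite in_itv/= => /andP[xz zy].
    by have [] := dF z; rewrite ?(le_trans ax (ltW xz)) ?(le_trans (ltW zy) yb).
  + by apply: cvg_at_right_filter; apply: cF; rewrite lexx ltW.
  + by apply: cvg_at_left_filter; apply: cF; rewrite lexx ltW.
- move=> z; rewrite in_itv/= => /andP[xz zy]; rewrite derive1E.
  by case: (dF z _) => //; rewrite ?(le_trans ax (ltW xz)) ?(le_trans (ltW zy) yb).
Qed.

End H1_interval.

(** * Gluing, uniqueness of weak derivatives and periodicity *)

Section H1_global.
Context {R : realType}.
Implicit Types (f g h : R -> R) (a b c : R).
Notation mu := (@lebesgue_measure R).

Lemma H1_derivP f g :
  H1_deriv f g <-> measurable_fun setT g /\ forall a b, H1on a b f g.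
Proof.
split=> [[mg Lg fg]|[mg Hfg]].
  split=> // a b; split; last by move=> x y _ xy _; exact: fg.
  by split; [exact: measurable_funTS|exact: Lg].
split=> // a b; first by case: (Hfg a b) => -[].
by move=> ab; case: (Hfg a b) => _; apply.
Qed.

(** The indefinite integral of g1 - g2 vanishes identically, so g1 - g2 vanishes
at every Lebesgue point. *)
Lemma H1on_unique a b f g1 g2 : H1on a b f g1 -> H1on a b f g2 ->
  ae_eq mu [set` `]a, b[] g1 g2.
Proof.
move=> [L1g1 fg1] [L2g2 fg2].
pose D : set (measurableTypeR R) := [set` `[a, b]].
pose h := (fun t => g1 t - g2 t) \_ D.
have L1h : L1 a b (fun t => g1 t - g2 t) by apply: L1B; exact: L2_L1.
have Ih : mu.-integrable setT (EFin \o h).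
  rewrite -restrict_EFin; apply/integrable_restrict => //=.
    exact: measurable_cc.
  by rewrite setTI.
have lh : locally_integrable setT h.
  by apply: integrable_locally => //; exact: measurable_cc.
have /= := @FTC1 R h (BLeft a) (fun y => integrableS measurableT (measurable_cc a y) (@subsetT _ _) Ih) lh.
apply: filterS; first exact: (ae_filter_ringOfSetsType mu).
move=> x + /=; rewrite in_itv/= lte_fin => + /andP[ax xb].
move=> /(_ ax) [dF Fx].
have hx : h x = g1 x - g2 x by rewrite /h patchE mem_set// /D/= in_itv/= !ltW.
apply/eqP; rewrite -subr_eq0 -hx -Fx; apply/eqP.
pose F y := I a y h.
have F0 y : a < y < b -> F y = 0.
  move=> /andP[ay yb]; rewrite /F (@I_eq _ _ _ _ (fun t => g1 t - g2 t)).
    rewrite IB; [|by apply: L2_L1; apply: L2_sub; [exact: lexx|exact: (ltW yb)|]..].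
    by rewrite -(fg1 a y (lexx a) (ltW ay) (ltW yb)) -(fg2 a y (lexx a) (ltW ay) (ltW yb)) subrr.
  by move=> t /andP[at_ ty]; rewrite /h patchE mem_set// /D/= in_itv/= at_ (le_trans ty (ltW yb)).
rewrite derive1E -[fun x => _]/F.
rewrite (@near_eq_derive _ _ _ _ (cst 0)) ?derive_cst//.
near=> y; apply: F0; near: y.
have : x \in `]a, b[ by rewrite in_itv/= ax xb.
by move=> /near_in_itvoo; apply: filterS => y; rewrite in_itv.
Unshelve. all: by end_near. Qed.

Lemma I_ae_eq a b f g : L1 a b f -> L1 a b g ->
  ae_eq mu [set` `]a, b[] f g -> I a b f = I a b g.
Proof.
move=> If Ig fg.
have sub1 : [set` `]a, b[] `<=` ([set` `[a, b]] : set R) by apply: subset_itv; rewrite bnd_simp.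
have sub3 : [set` `[a, b[] `<=` ([set` `[a, b]] : set R) by apply: subset_itv; rewrite bnd_simp.
have E h : L1 a b h -> I a b h = \int[mu]_(t in `]a, b[) h t.
  move=> Lh; rewrite /I -Rintegral_itv_bndo_bndc; last exact: (integrableS (measurable_cc a b) (measurable_itv _) sub3 Lh).
  by rewrite -Rintegral_itv_obnd_cbnd//; exact: (integrableS (measurable_cc a b) (measurable_itv _) sub1 Lh).
rewrite !E// /Rintegral; congr fine; apply: ae_eq_integral => //.
- by apply/measurable_EFinP; apply: measurable_funS sub1 (L1_meas If).
- by apply/measurable_EFinP; apply: measurable_funS sub1 (L1_meas Ig).
- by apply: filterS fg => t h /h /= ->.
Qed.

Lemma H1on_cat a b c f g : a <= c -> c <= b ->
  H1on a c f g -> H1on c b f g -> H1on a b f g.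
Proof.
move=> ac cb [[mg Ig] fg] [[mg' Ig'] fg'].
have Lg : L2 a b g.
  split; last exact: L1_cat Ig Ig'.
  apply: (@measurable_funS _ _ _ _ ([set` `[a, c]] `|` [set` `[c, b]] : set R)).
  - by apply: measurableU; exact: measurable_cc.
  - move=> t /=; rewrite !in_itv/= => /andP[-> ->]; rewrite andbT.
    by case: (leP t c) => h; [left|right; rewrite ltW].
  - by apply/measurable_funU => //; exact: measurable_cc.
split=> // x y ax xy yb.
have [yc|cy] := leP y c; first exact: fg.
have [cx|xc] := leP c x; first exact: fg'.
have -> : f y - f x = (f c - f x) + (f y - f c) by ring.
rewrite (fg _ _ ax (ltW xc) (lexx c)) (fg' _ _ (lexx c) (ltW cy) yb).
rewrite -I_split ?ltW//.
by apply: L2_L1; exact: L2_sub Lg.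
Qed.

Lemma H1on_shift a b c f g : H1on a b f g ->
  H1on (a + c) (b + c) (fun t => f (t - c)) (fun t => g (t - c)).
Proof.
move=> [Lg fg].
have sh x y h : L1 x y h -> L1 (x + c) (y + c) (fun t => h (t - c)) /\
    I x y h = I (x + c) (y + c) (fun t => h (t - c)).
  move=> Lh; have : L1 (x + c - c) (y + c - c) h by rewrite !addrK.
  by move=> /L1_I_shift; rewrite !addrK.
have Lg' : L2 (a + c) (b + c) (fun t => g (t - c)).
  split; last exact: (sh _ _ _ Lg.2).1.
  by apply: L1_meas; apply: (sh _ _ _ _).1; exact: L2_L1.
split=> // x y ax xy yb.
have Lg1 : L1 (x - c) (y - c) g.
  by apply: L2_L1; apply: L2_sub Lg; rewrite ?lerBrDr ?lerBlDr.
have [_] := sh _ _ _ Lg1; rewrite !subrK => <-.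
by rewrite fg ?lerBrDr ?lerBlDr// subrK.
Qed.

(** The derivative may be altered at the right endpoint, as happens when
derivatives on adjacent periods are glued. *)
Lemma H1on_eq_co a b f f1 g g1 : (forall t, a <= t <= b -> f t = f1 t) ->
  (forall t, a <= t < b -> g t = g1 t) -> H1on a b f g -> H1on a b f1 g1.
Proof.
move=> ff gg Hf; apply: (eq_H1on ff (fun t _ => erefl)) => {f1 ff}.
have [mg Ig] := Hf.1.
have sub3 : [set` `[a, b[] `<=` ([set` `[a, b]] : set R) by apply: subset_itv; rewrite bnd_simp.
have mg1 : measurable_fun `[a, b] g1.
  apply: (@measurable_funS _ _ _ _ ([set` `[a, b[] `|` [set b] : set R)).
  - by apply: measurableU => //; exact: measurable_itv.
  - move=> t /=; rewrite !in_itv/= => /andP[-> tb] /=; rewrite lt_neqAle tb andbT.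
    by have [->|] := eqVneq t b; [right|left].
  - have [_ U] := measurable_funU g1 (measurable_itv (Interval (BLeft a) (BLeft b))) (@measurable_set1 R b).
    apply: U; split; last exact: measurable_fun_set1.
    have := measurable_funS (measurable_cc a b) sub3 mg.
    by apply: eq_measurable_fun => t; rewrite inE/= in_itv/=; exact: gg.
have Lg1 : L2 a b g1.
  split=> //; apply: (@L1_le _ _ _ _ (fun t => g t ^+ 2 + g1 b ^+ 2)).
  - exact: measurable_funM.
  - move=> t /andP[at_ tb]; rewrite ger0_norm ?sqr_ge0//.
    have [->|tnb] := eqVneq t b; first by rewrite lerDr sqr_ge0.
    by rewrite gg ?at_ ?lt_neqAle ?tnb// lerDl sqr_ge0.
  - by apply: L1D => //; exact: L1_cst.
split=> // x y ax xy yb; rewrite Hf.2//; apply: I_eq_co.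
- by move=> t /andP[xt ty]; apply: gg; rewrite (le_trans ax xt) (lt_le_trans ty yb).
- by apply: L2_L1; apply: L2_sub Hf.1.
- by apply: L2_L1; apply: L2_sub Lg1.
Qed.

Definition periodic2pi f := forall t, f (t + 2 * pi) = f t.

Lemma periodic_int f (m : int) t : periodic2pi f -> f (t + 2 * pi * m%:~R) = f t.
Proof.
move=> pf; have pn (n : nat) x : f (x + 2 * pi * n%:R) = f x.
  elim: n x => [|n IHn] x; first by rewrite mulr0 addr0.
  by rewrite -[n.+1%:R]natr1 mulrDr mulr1 addrA pf IHn.
case: m => n; first exact: pn.
rewrite NegzE -(pn n.+1 (t + _)); congr f.
by rewrite rmorphN/= mulrN -addrA addNr addr0.
Qed.

Definition mod2pi (t : R) : R := t - 2 * pi * (Num.floor (t / (2 * pi)))%:~R.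

Lemma pi2_gt0 : 0 < 2 * pi :> R. Proof. by rewrite mulr_gt0// pi_gt0. Qed.

Lemma mod2pi_itv t : 0 <= mod2pi t < 2 * pi.
Proof.
have p0 := pi2_gt0; have /andP[h1 h2] := floor_itv (t / (2 * pi)).
rewrite /mod2pi subr_ge0 ltrBlDr mulrC -ler_pdivlMr// h1/=.
by rewrite addrC -[X in _ < _ + X]mul1r -mulrDl -ltr_pdivrMr// -[1]/(1%:~R) -intrD.
Qed.

Lemma mod2pi_cell (m : int) t : 2 * pi * m%:~R <= t < 2 * pi * m%:~R + 2 * pi ->
  mod2pi t = t - 2 * pi * m%:~R.
Proof.
have p0 := pi2_gt0; move=> /andP[h1 h2]; rewrite /mod2pi (@floor_def _ _ m)//.
rewrite ler_pdivlMr// mulrC h1/= ltr_pdivrMr// intrD mulrDl mul1r.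
by rewrite [_ * (2 * pi)]mulrC.
Qed.

Lemma mod2piD t : mod2pi (t + 2 * pi) = mod2pi t.
Proof.
have /andP[h1 h2] := mod2pi_itv t; set m := Num.floor (t / (2 * pi)).
rewrite (@mod2pi_cell (m + 1)); first by rewrite /mod2pi -/m intrD; ring.
by move: h1 h2; rewrite /mod2pi -/m intrD => h1 h2; apply/andP; split; lra.
Qed.

Lemma periodic_mod f t : periodic2pi f -> f (mod2pi t) = f t.
Proof. by move=> /(periodic_int (Num.floor (t / (2 * pi))) (mod2pi t)) <-; rewrite subrK. Qed.

Lemma measurable_mod2pi :
  measurable_fun setT (mod2pi : measurableTypeR R -> measurableTypeR R).
Proof.
apply: measurable_funB => //; apply: nondecreasing_measurable => // x y xy.
rewrite ler_wpM2l ?(ltW pi2_gt0)// ler_int le_floor//.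
by rewrite ler_wpM2r// invr_ge0 ltW// pi2_gt0.
Qed.

(** A weak derivative of a periodic function need not be periodic, but its
restriction to one period extends periodically to another weak derivative; the
identity on each period [2 pi m, 2 pi (m + 1)] is a translate of the one on [0,
2 pi]. *)
Lemma periodic_derivative f g : periodic2pi f -> H1on 0 (2 * pi) f g ->
  exists G, [/\ periodic2pi G, H1_deriv f G & forall t, 0 <= t < 2 * pi -> G t = g t].
Proof.
move=> pf Hg; have p0 := pi2_gt0.
pose D : set (measurableTypeR R) := [set` `[0, 2 * pi]].
pose g0 : measurableTypeR R -> R := g \_ D.
pose G t := g0 (mod2pi t).
have mD : measurable D by exact: measurable_cc.
have mg0 : measurable_fun setT g0 by apply/(measurable_restrictT _ mD); case: Hg => -[].
have Gg t : 0 <= t < 2 * pi -> G t = g t.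
  move=> /andP[t0 t1]; rewrite /G (@mod2pi_cell 0); last by rewrite mulr0 t0 add0r t1.
  by rewrite mulr0 subr0 /g0 patchE mem_set// /D/= in_itv/= t0 ltW.
exists G; split=> //; first by move=> t; rewrite /G mod2piD.
have cell (m : int) : H1on (2 * pi * m%:~R) (2 * pi * m%:~R + 2 * pi) f G.
  have := H1on_shift (2 * pi * m%:~R) Hg; rewrite add0r [2 * pi + _]addrC.
  apply: H1on_eq_co => t.
    by rewrite -(periodic_int m (t - _) pf) subrK.
  move=> /andP[h1 h2]; rewrite /G (@mod2pi_cell m) ?h1// /g0 patchE mem_set// /D/= in_itv/=.
  by rewrite subr_ge0 h1 lerBlDl ltW.
have big (M : nat) : H1on (2 * pi * (- M%:Z)%:~R) (2 * pi * M%:Z%:~R) f G.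
  elim: M => [|M IHM].
    rewrite !mulr0; apply: H1on_sub (cell 0); rewrite mulr0// add0r; exact: ltW.
  have c1 := cell M%:Z; have c2 := cell (- M.+1%:Z).
  have e1 : 2 * pi * M.+1%:Z%:~R = 2 * pi * M%:Z%:~R + 2 * pi :> R.
    by rewrite -[M.+1]addn1 PoszD intrD mulrDr mulr1.
  have e2 : 2 * pi * (- M.+1%:Z)%:~R + 2 * pi = 2 * pi * (- M%:Z)%:~R :> R.
    by rewrite -[M.+1]addn1 PoszD opprD intrD mulrDr mulrN1 subrK.
  have s : 2 * pi * (- M%:Z)%:~R <= 2 * pi * M%:Z%:~R :> R.
    by rewrite ler_wpM2l ?(ltW p0)// ler_int; lia.
  rewrite e2 in c2; rewrite e1.
  apply: (@H1on_cat _ _ (2 * pi * M%:Z%:~R)).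
  - by rewrite (le_trans _ s)// -e2 lerDl ltW.
  - by rewrite lerDl ltW.
  - apply: (@H1on_cat _ _ (2 * pi * (- M%:Z)%:~R)) => //.
    by rewrite -e2 lerDl ltW.
  - exact: c1.
apply/H1_derivP; split; first by apply: measurableT_comp => //; exact: measurable_mod2pi.
move=> a b; pose M := (Num.truncn (`|a| + `|b|)).+1.
have hM : `|a| + `|b| <= 2 * pi * M%:R.
  have h : `|a| + `|b| < M%:R by rewrite truncnS_gt.
  rewrite (le_trans (ltW h))// ler_peMl//.
  by have := @pi_ge2 R; lra.
apply: H1on_sub (big M).
  rewrite mulrNz mulrN lerNl (le_trans _ hM)// (le_trans (ler_norm _))// normrN lerDl//.
by rewrite (le_trans _ hM)// (le_trans (ler_norm _))// lerDr.
Qed.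

Lemma I_periodic a F : periodic2pi F -> (forall a b, L1 a b F) ->
  0 <= a <= 2 * pi -> I a (a + 2 * pi) F = I 0 (2 * pi) F.
Proof.
move=> pF LF /andP[a0 a1]; have p0 := pi2_gt0.
rewrite (@I_split _ a _ (2 * pi))//; last by rewrite lerDr.
have := @L1_I_shift _ 0 a (2 * pi) F; rewrite add0r => /(_ (LF _ _)) [_ ->].
rewrite (@I_eq _ 0 a _ F) => [|t _]; last exact: pF.
by rewrite addrC -I_split.
Qed.

Lemma I_periodic_shift s F : periodic2pi F -> (forall a b, L1 a b F) ->
  0 <= s <= 2 * pi -> I 0 (2 * pi) (fun t => F (t + s)) = I 0 (2 * pi) F.
Proof.
move=> pF LF h; rewrite -(I_periodic pF LF h).
by have [_] := @L1_I_shift _ 0 (2 * pi) s F (LF _ _); rewrite add0r [2 * pi + s]addrC => ->.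
Qed.
End H1_global.

(** * Wirtinger's inequality *)

Section Wirtinger.
Context {R : realType}.
Implicit Types (f g h : R -> R) (a b c s t : R).

Lemma is_derive_affine f (df k c t : R) : is_derive (k * t + c) 1 f df ->
  is_derive t 1 (fun t => f (k * t + c)) (k * df).
Proof.
move=> dF.
have d : is_derive t 1 (fun x : R => k * x + c) k.
  have : is_derive t 1 ((k \*: (@id R)) + cst c) (k *: 1 + 0) by exact: is_deriveD.
  by move=> e; apply: is_derive_eq e _; rewrite addr0 /GRing.scale/= mulr1.
have := @is_derive1_comp _ f (fun x : R => k * x + c) t _ _ dF d.
by move=> e; apply: is_derive_eq e _; rewrite mulrC.
Qed.

Lemma within_continuous_is_derive a b f g :
  (forall x, a <= x <= b -> is_derive x 1 f (g x)) -> {within `[a, b], continuous f}.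
Proof.
move=> df; apply: continuous_in_subspaceT => x; rewrite inE/= in_itv/= => xab.
by apply/differentiable_continuous/derivable1_diffP; case: (df _ xab).
Qed.

(** The function p(t) = l tan(l (t - b - pi/2)) solves the Riccati equation p' =
l^2 + p^2, so that g^2 - l^2 f^2 + (p f^2)' = (g + p f)^2 >= 0, and p f^2
vanishes at both ends. The condition l < 1 keeps p finite on the closed
interval. *)
Lemma Dirichlet_lt b f g (l : R) : 0 < l < 1 -> H1on b (b + pi) f g ->
  f b = 0 -> f (b + pi) = 0 ->
  l ^+ 2 * I b (b + pi) (fun t => f t ^+ 2) <= I b (b + pi) (fun t => g t ^+ 2).
Proof.
move=> /andP[l0 l1] Hf fb fb'; have pi0 := @pi_gt0 R.
have bpi : b <= b + pi by rewrite lerDl ltW.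
pose c := - (l * (b + pi / 2)).
pose p t := l * tan (l * t + c).
pose p' t := l ^+ 2 + p t ^+ 2.
have cosm t : b <= t <= b + pi -> cos (l * t + c) != 0.
  move=> /andP[bt tb]; rewrite gt_eqF// cos_gt0_pihalf// -ltr_norml /c -mulrBr normrM gtr0_norm//.
  have : `|t - (b + pi / 2)| <= pi / 2 by rewrite ler_norml; apply/andP; split; lra.
  move=> h; rewrite (@lt_le_trans _ _ (1 * (pi / 2)))//; last by rewrite mul1r.
  by rewrite (@le_lt_trans _ _ (l * (pi / 2)))// ?ler_pM2l// ltr_pM2r// divr_gt0.
have dp t : b <= t <= b + pi -> is_derive t 1 p (p' t).
  move=> /cosm ct; have dt := is_derive_affine (is_derive_tan ct).
  have := @is_deriveZ _ _ _ _ l _ _ _ dt.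
  move=> h; apply: is_derive_eq h _.
  by rewrite /GRing.scale/= cos2_tan2// /p' /p; ring.
have cp : {within `[b, b + pi], continuous p} by exact: within_continuous_is_derive dp.
have cp' : {within `[b, b + pi], continuous p'}.
  by move=> x; apply: cvgD; [exact: cvg_cst|apply: cvgM; exact: cp].
have Hp := H1on_C1 cp' dp.
have Hff := H1onM Hf Hf; have Hpff := H1onM Hp Hff.
have := Hpff.2 _ _ (lexx b) bpi (lexx _).
rewrite fb fb' !mulr0 subrr => /esym I0.
have L1a := L1Z (l ^+ 2) (L2_cont (H1on_cont Hf)).2.
have L1b := Hf.1.2; have L1c := L2_L1 Hpff.1.
rewrite -subr_ge0.
have E : I b (b + pi) (fun t => g t ^+ 2) - l ^+ 2 * I b (b + pi) (fun t => f t ^+ 2) =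
         I b (b + pi) (fun t => (g t + p t * f t) ^+ 2).
  rewrite -[LHS]addr0 -I0 -IZ; last exact: (L2_cont (H1on_cont Hf)).2.
  rewrite -IB// -ID//; last exact: L1B.
  by apply: I_eq => t _; rewrite /p'; ring.
by rewrite E; apply: I_ge0 => t _; exact: sqr_ge0.
Qed.

(** The limit l -> 1 of the previous estimate, with an explicit l close to 1. *)
Lemma Dirichlet_wirtinger b f g : H1on b (b + pi) f g ->
  f b = 0 -> f (b + pi) = 0 ->
  I b (b + pi) (fun t => f t ^+ 2) <= I b (b + pi) (fun t => g t ^+ 2).
Proof.
move=> Hf fb fb'.
have h (l : R) := @Dirichlet_lt _ _ _ l ^~ Hf; move: h.
set X := I _ _ _; set Y := I _ _ _ => h.
have X0 : 0 <= X by apply: I_ge0 => t _; exact: sqr_ge0.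
rewrite leNgt; apply/negP => YX.
have Y0 : 0 <= Y by apply: I_ge0 => t _; exact: sqr_ge0.
have Xp : 0 < X by exact: le_lt_trans YX.
pose e := (X - Y) / (4 * X).
have e0 : 0 < e by rewrite divr_gt0 ?subr_gt0 ?mulr_gt0.
have e1 : e < 1 by rewrite ltr_pdivrMr ?mulr_gt0//; lra.
have := h (1 - e); rewrite subr_gt0 e1/= gtrBl e0 => /(_ erefl fb fb') hh.
have eX : e * X = (X - Y) / 4 by rewrite /e; field; rewrite gt_eqF.
have : 0 <= e ^+ 2 * X by rewrite mulr_ge0// sqr_ge0.
by move: hh; rewrite (_ : (1 - e) ^+ 2 * X = X - 2 * (e * X) + e ^+ 2 * X); [rewrite eX; lra|ring].
Qed.

(** By the intermediate value theorem f(t0) = f(t0 + pi) for some t0. With a =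
f(t0), the function f - a vanishes at t0, t0 + pi and t0 + 2 pi, and the
Dirichlet inequality applies to both half periods. *)
Lemma wirtinger f g : periodic2pi f -> periodic2pi g -> H1_deriv f g ->
  exists a, I 0 (2 * pi) (fun t => (f t - a) ^+ 2) <= I 0 (2 * pi) (fun t => g t ^+ 2).
Proof.
move=> pf pg Hf; have [mg Hon] := (H1_derivP _ _).1 Hf.
have pi0 := @pi_gt0 R.
have pi2 : pi + pi = 2 * pi :> R by ring.
have [t0 /[!in_itv]/= /andP[t00 t01] ft0] : exists2 t0, t0 \in `[0, pi] & f t0 - f (t0 + pi) = 0.
  apply: (@IVT _ (fun t => f t - f (t + pi))) => //; first exact: ltW.
    have := H1on_shift (- pi) (Hon pi (pi + pi)); rewrite subrr addrK => Hs.
    apply: (@H1on_cont _ _ _ _ (fun t => g t - g (t - - pi))).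
    apply: eq_H1on (H1onB (Hon 0 pi) Hs) => // t _.
    by rewrite opprK.
  rewrite add0r -[f 0]pf add0r pi2.
  rewrite ge_min le_max !subr_ge0 !subr_le0.
  by have [h|h] := orP (le_total (f pi) (f (2 * pi))); rewrite h ?orbT.
exists (f t0); pose F t := f t - f t0.
have HF a b : H1on a b F g.
  by apply: eq_H1on (H1onB (Hon a b) (H1on_cst a b (f t0))) => // t _; rewrite subr0.
have pF : periodic2pi (fun t => F t ^+ 2) by move=> t; rewrite /F pf.
have pG : periodic2pi (fun t => g t ^+ 2) by move=> t; rewrite pg.
have LF a b : L1 a b (fun t => F t ^+ 2) by case: (L2_cont (H1on_cont (HF a b))).
have LG a b : L1 a b (fun t => g t ^+ 2) by case: (HF a b) => -[].
have t0i : 0 <= t0 <= 2 * pi by rewrite t00/=; lra.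
rewrite -(I_periodic pF LF t0i) -(I_periodic pG LG t0i).
have h1 : t0 <= t0 + pi by rewrite lerDl ltW.
have h2 : t0 + pi <= t0 + 2 * pi by rewrite lerD2l -pi2 lerDl ltW.
rewrite (I_split h1 h2 (LF _ _)) (I_split h1 h2 (LG _ _)).
have F1 : F t0 = 0 by rewrite /F subrr.
have F2 : F (t0 + pi) = 0 by apply/eqP; rewrite -oppr_eq0 /F opprB ft0.
have F3 : F (t0 + pi + pi) = 0 by rewrite -addrA pi2 /F pf subrr.
rewrite (_ : t0 + 2 * pi = t0 + pi + pi); last by rewrite -addrA pi2.
by apply: lerD; apply: Dirichlet_wirtinger.
Qed.

End Wirtinger.

(** * The sharp estimate of the mean square of a shift *)

Section Shift.
Context {R : realType}.
Implicit Types (f g h : R -> R) (a b c s t : R).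

Lemma H1_continuous f g : H1_deriv f g -> continuous f.
Proof.
move=> /H1_derivP [_ Hon] x.
have h : x - 1 < x + 1 by lra.
apply: (@within_continuous_continuous R R R^o _ _ f x h (H1on_cont (Hon (x - 1) (x + 1)))).
by rewrite in_itv/=; apply/andP; split; lra.
Qed.

Lemma continuous_shift f s : continuous f -> continuous (fun t => f (t + s)).
Proof.
move=> cf x; apply: (@continuous_comp _ _ _ (fun t => t + s) f); last exact: cf.
by apply: cvgD; [exact: cvg_id|exact: cvg_cst].
Qed.

Arguments continuous_shift {f} s _ _.

Lemma continuous_sqr f : continuous f -> continuous (fun t => f t ^+ 2).
Proof. by move=> cf x; apply: cvgM; exact: cf. Qed.

Definition shift_gap f s := I 0 (2 * pi) (fun t => (f (t + s) - f t) ^+ 2).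

Lemma continuous_gap f s : continuous f -> continuous (fun t => f (t + s) - f t).
Proof. by move=> cf x; apply: cvgB; [exact: continuous_shift|exact: cf]. Qed.

Arguments continuous_gap {f} s _ _.

Lemma periodic_gap f s : periodic2pi f -> periodic2pi (fun t => f (t + s) - f t).
Proof. by move=> pf t; rewrite pf addrAC pf. Qed.

Arguments periodic_gap {f} s _ _.

(** Let F(t) = f(t + s) - f(t) and let Q be the integral of (F(t + s) - F(t))^2.
The parallelogram identity gives D(2 s) + Q = 4 D(s) for D = shift_gap f, and
summation by parts gives D(s) = - int (F(t + s) - F(t)) (f(t + s) - a) dt; the
second bound is then Cauchy-Schwarz. *)
Lemma shift_gap_double f a (E s : R) : continuous f -> periodic2pi f ->
  0 <= s <= 2 * pi -> I 0 (2 * pi) (fun t => (f t - a) ^+ 2) <= E ->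
  shift_gap f (s + s) <= 4 * shift_gap f s /\
  shift_gap f s ^+ 2 <= (4 * shift_gap f s - shift_gap f (s + s)) * E.
Proof.
move=> cf pf sp fE; pose F t := f (t + s) - f t.
have cF : continuous F by exact: continuous_gap.
have pF : periodic2pi F by exact: periodic_gap.
have cFs := continuous_shift s cF.
pose Q := I 0 (2 * pi) (fun t => (F (t + s) - F t) ^+ 2).
have cfa : continuous (fun t => f t - a) by move=> x; apply: cvgB; [exact: cf|exact: cvg_cst].
have LFF (h1 h2 : R -> R) u v : continuous h1 -> continuous h2 -> L1 u v (fun t => h1 t * h2 t).
  by move=> c1 c2; apply: L1_continuous => x; apply: cvgM; [exact: c1|exact: c2].
have e1 : shift_gap f (s + s) + Q = 4 * shift_gap f s.
  have e : I 0 (2 * pi) (fun t => F (t + s) ^+ 2) = shift_gap f s.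
    apply: (@I_periodic_shift _ s (fun t => F t ^+ 2)) => //.
      by move=> t; rewrite pF.
    by move=> u v; apply: L1_continuous; exact: continuous_sqr.
  have L1a : L1 0 (2 * pi) (fun t => F (t + s) ^+ 2) by apply: L1_continuous; exact: continuous_sqr.
  have L1b : L1 0 (2 * pi) (fun t => F t ^+ 2) by apply: L1_continuous; exact: continuous_sqr.
  transitivity (I 0 (2 * pi) (fun t => 2 * F (t + s) ^+ 2 + 2 * F t ^+ 2)); last first.
    rewrite ID ?IZ// ?e; [|exact: L1Z..].
    by rewrite -[I _ _ _]/(shift_gap f s); ring.
  rewrite /shift_gap /Q -ID; [|apply: L1_continuous; apply: continuous_sqr..]; last 2 first.
  - exact: continuous_gap.
  - exact: continuous_gap.
  by apply: I_eq => t _; rewrite /F addrA; ring.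
have e2 : shift_gap f s = - I 0 (2 * pi) (fun t => (F (t + s) - F t) * (f (t + s) - a)).
  have e : I 0 (2 * pi) (fun t => F (t + s) * (f (t + s) - a)) =
           I 0 (2 * pi) (fun t => F t * (f t - a)).
    apply: (@I_periodic_shift _ s (fun t => F t * (f t - a))) => //.
      by move=> t; rewrite pF pf.
    by move=> u v; exact: LFF.
  rewrite (@I_eq _ _ _ (fun t => (F (t + s) - F t) * (f (t + s) - a))
     (fun t => F (t + s) * (f (t + s) - a) - F t * (f (t + s) - a))) => [|t _]; last by ring.
  have cfas := continuous_shift s cfa.
  rewrite IB; [|exact: (LFF _ _ _ _ cFs cfas)|exact: (LFF _ _ _ _ cF cfas)].
  rewrite e opprB -IB; [|exact: (LFF _ _ _ _ cF cfas)|exact: (LFF _ _ _ _ cF cfa)].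
  by apply: I_eq => t _; rewrite /F; ring.
rewrite -e1; split; first by rewrite lerDl; apply: I_ge0 => t _; exact: sqr_ge0.
rewrite [X in _ <= X * _]addrC addKr {1}e2 sqrrN.
have := @I_CS _ 0 (2 * pi) (fun t => F (t + s) - F t) (fun t => f (t + s) - a)
  (L2_continuous _ _ (continuous_gap s cF)) (L2_continuous _ _ (continuous_shift s cfa)).
move=> /le_trans; apply; apply: ler_wpM2l; first by apply: I_ge0 => t _; exact: sqr_ge0.
apply: le_trans fE; rewrite (@I_periodic_shift _ s (fun t => (f t - a) ^+ 2))//.
  by move=> t; rewrite pf.
by move=> u v; apply: L1_continuous; exact: continuous_sqr.
Qed.

(** Hoelder on each [t, t + s]: integrating J(t + s) - J(t), where J is the
primitive of g^2, over a period gives s times the integral of g^2. *)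
Lemma shift_gap_crude f g s : periodic2pi f -> periodic2pi g -> H1_deriv f g ->
  0 <= s <= 2 * pi -> shift_gap f s <= s ^+ 2 * I 0 (2 * pi) (fun t => g t ^+ 2).
Proof.
move=> pf pg Hf /andP[s0 s1]; have p0 := @pi2_gt0 R.
have [mg Hon] := (H1_derivP _ _).1 Hf.
pose J t := I 0 t (fun u => g u ^+ 2).
have Lg a b : L1 a b (fun u => g u ^+ 2) by case: (Hon a b) => -[].
have JJ t u : 0 <= t -> t <= u -> J u - J t = I t u (fun u => g u ^+ 2).
  by move=> t0 tu; rewrite /J (I_split t0 tu (Lg _ _)) addrC addKr.
have cJ b : 0 <= b -> {within `[0, b], continuous J}.
  by move=> b0; apply: parameterized_integral_continuous => //; exact: Lg.
have LJ a b : 0 <= a -> L1 a b J.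
  move=> a0; have [b0|b0] := leP 0 b; last by apply: L1_empty; exact: lt_le_trans b0 _.
  by apply: (L1_sub a0 (lexx b)); apply: L1_cont; exact: cJ.
have LJs : L1 0 (2 * pi) (fun t => J (t + s)).
  by have [] := @L1_I_shift _ 0 (2 * pi) s J (LJ _ _ _); rewrite ?add0r.
apply: (@le_trans _ _ (I 0 (2 * pi) (fun t => s * (J (t + s) - J t)))).
  apply: I_le.
  - by apply: L1_continuous; apply/continuous_sqr/continuous_gap; exact: H1_continuous Hf.
  - by apply: L1Z; apply: L1B => //; exact: LJ.
  - move=> t /andP[t0 t1]; rewrite JJ ?lerDl//.
    have ts : t <= t + s by rewrite lerDl.
    by have := H1on_hoelder (Hon t (t + s)) (lexx t) ts (lexx _); rewrite [t + s - t]addrC addKr.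
rewrite IZ; last by apply: L1B => //; exact: LJ.
rewrite expr2 -mulrA ler_wpM2l// IB//; last exact: LJ.
have := (@L1_I_shift _ 0 (2 * pi) s J); rewrite add0r => /(_ (LJ _ _ s0)) [_ <-].
rewrite (@I_split _ s (2 * pi + s) (2 * pi))//; [|by rewrite lerDl|exact: LJ].
rewrite (@I_split _ 0 (2 * pi) s)//; last exact: LJ.
have := (@L1_I_shift _ 0 s (2 * pi) J); rewrite add0r => /(_ (LJ _ _ (ltW p0))) [L2s].
rewrite [s + 2 * pi]addrC => ->.
have -> (A B C : R) : A + B - (C + A) = B - C by ring.
rewrite -(IB L2s (LJ _ _ (lexx _))).
rewrite (@I_eq _ _ _ _ (fun=> I 0 (2 * pi) (fun t => g t ^+ 2))); first by rewrite I_cst// subr0 mulrC.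
move=> t /andP[t0 t1]; rewrite JJ// ?lerDl ?(ltW p0)//.
by rewrite I_periodic// ?t0 ?(le_trans t1)// => u; rewrite pg.
Qed.

(** The slack k > 1 turns the tangent sin x ~ x at 0 into an inequality near 0;
it lets the crude estimate start the doubling induction below. *)
Lemma sin_ge_lin (k : R) : 1 < k -> exists2 s0, 0 < s0 &
  forall s, 0 <= s <= s0 -> s <= 2 * sin (k * s / 2).
Proof.
move=> k1; have k0 : 0 < k by exact: lt_trans k1.
have ki : k^-1 < 1 by rewrite invf_lt1.
have [d d0 hd] : exists2 d : R, 0 < d & forall x, 0 <= x <= d -> k^-1 < cos x.
  have : cos x @[x --> (0 : R)] --> cos 0 by exact: continuous_cos.
  rewrite cos0 => /cvgr_gt /(_ _ ki) /nbhs_ballP[e /= e0 he].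
  exists (e / 2); first by rewrite divr_gt0.
  move=> x /andP[x0 xe]; apply: he; rewrite /ball/= sub0r normrN ger0_norm//.
  by rewrite (le_lt_trans xe)// ltr_pdivrMr// ltr_pMr// ltr1n.
exists (2 * d / k); first by rewrite divr_gt0// mulr_gt0.
move=> s /andP[]; rewrite le_eqVlt => /predU1P[<-|s0 ss0].
  by rewrite mulr0 mul0r sin0 mulr0.
set x := k * s / 2; have x0 : 0 < x by rewrite /x divr_gt0// mulr_gt0.
have xd : x <= d.
  rewrite /x ler_pdivrMr// [d * 2]mulrC [k * s]mulrC -ler_pdivlMr//.
have [c /[!in_itv]/= /andP[c0 cx]] := @MVT R sin cos 0 x x0
   (fun y _ => is_derive_sin y) (continuous_subspaceT (@continuous_sin R)).
rewrite sin0 !subr0 => ->.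
have : k^-1 < cos c by apply: hd; rewrite ltW//= (le_trans (ltW cx)).
have -> : s = 2 * (k^-1 * x) by rewrite /x; field; rewrite gt_eqF.
by move=> h; rewrite ler_pM2l// ler_pM2r// ltW.
Qed.

(** The sharp form of the Wirtinger inequality for differences. By
shift_gap_double, D(s) <= x E implies D(2 s) <= (4 x - x^2) E, and x = 4
sin^2(th) is sent to 4 sin^2(2 th). So an estimate with 4 sin^2(k s / 2) for
small s and some k > 1 propagates to all s with k s <= pi; then k tends to 1.
The value s = pi needs one more doubling, and s > pi is reduced to 2 pi - s. *)
Lemma shift_gap_le f g s : periodic2pi f -> periodic2pi g -> H1_deriv f g ->
  0 <= s <= 2 * pi ->
  shift_gap f s <= 4 * sin (s / 2) ^+ 2 * I 0 (2 * pi) (fun t => g t ^+ 2).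
Proof.
move=> pf pg Hf; have p0 := @pi2_gt0 R; have pi0 := @pi_gt0 R.
have cf := H1_continuous Hf.
set E := I _ _ _; have E0 : 0 <= E by apply: I_ge0 => t _; exact: sqr_ge0.
have [a fa] := wirtinger pf pg Hf; rewrite -/E in fa.
have dbl u (hu : 0 <= u <= 2 * pi) := shift_gap_double cf pf hu fa.
have D0 u : 0 <= shift_gap f u by apply: I_ge0 => t _; exact: sqr_ge0.
have step u x : 0 <= u <= 2 * pi -> 0 <= x <= 2 -> shift_gap f u <= x * E ->
    shift_gap f (u + u) <= (4 * x - x ^+ 2) * E.
  move=> hu /andP[x0 x2] hx; have [d4 d2] := dbl u hu.
  move: E0 hx d2; rewrite le_eqVlt => /predU1P[<-|Ep] hx d2.
    by move: hx; rewrite !mulr0 => h1; rewrite (le_trans d4)// pmulr_rle0.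
  set d := shift_gap f u in hx d2 *; set d' := shift_gap f (u + u) in d2 *.
  have h1 : d' * E <= (4 * x - x ^+ 2) * E * E.
    have h2 : 0 <= (x * E - d) * (4 * E - d - x * E).
      by rewrite mulr_ge0 ?subr_ge0//; nra.
    nra.
  by rewrite -(ler_pM2r Ep).
(* estimate with an extra factor k > 1, by doubling from the crude estimate *)
have main k u : 1 < k -> 0 <= u -> k * u <= pi -> shift_gap f u <= 4 * sin (k * u / 2) ^+ 2 * E.
  move=> k1; have k0 : 0 < k by exact: lt_trans k1.
  have [s0 s0p hs0] := sin_ge_lin k1.
  have ind (m : nat) : forall v, 0 <= v -> v <= 2 ^+ m * s0 -> k * v <= pi ->
      shift_gap f v <= 4 * sin (k * v / 2) ^+ 2 * E.
    elim: m => [|m IHm] v v0.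
      rewrite expr0 mul1r => vs kv.
      have v2 : v <= 2 * pi.
        have : v <= k * v by rewrite ler_peMl// ltW.
        lra.
      rewrite (le_trans (shift_gap_crude pf pg Hf _)) ?v0//.
      rewrite ler_wpM2r//.
      have -> : 4 * sin (k * v / 2) ^+ 2 = (2 * sin (k * v / 2)) ^+ 2 by ring.
      have := hs0 v; rewrite v0 vs => /(_ erefl) h.
      by rewrite ler_pXn2r ?nnegrE// (le_trans v0).
    move=> vm kv; pose w := v / 2.
    have w0 : 0 <= w by rewrite divr_ge0.
    have ww : v = w + w by rewrite /w; field.
    have wm : w <= 2 ^+ m * s0 by move: vm; rewrite exprS -mulrA; lra.
    have kw : k * w <= pi by move: kv; rewrite ww; lra.
    have hw := IHm w w0 wm kw.
    have kv2 : k * v / 2 = (k * w / 2) *+ 2 by rewrite ww mulr2n; field.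
    set th := k * w / 2 in hw kv2.
    rewrite kv2 sin_mulr2n {1}ww.
    have s2 : sin th ^+ 2 <= 1 / 2.
      have c2 : 0 <= cos (th *+ 2).
        by apply: cos_ge0_pihalf; rewrite -kv2; apply/andP; split; nra.
      by move: c2; rewrite cos_mulr2n cos2sin2; lra.
    have w2 : w <= 2 * pi.
      have : w <= k * w by rewrite ler_peMl// ltW.
      by move: kw; lra.
    have := step w (4 * sin th ^+ 2); rewrite w0 w2 => /(_ erefl _ hw).
    have -> : 0 <= 4 * sin th ^+ 2 <= 2 by rewrite mulr_ge0 ?sqr_ge0//=; lra.
    move=> /(_ erefl) /le_trans; apply; apply: ler_wpM2r => //.
    have -> : 4 * (cos th * sin th *+ 2) ^+ 2 = 16 * cos th ^+ 2 * sin th ^+ 2.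
      by rewrite mulr2n; ring.
    by rewrite cos2sin2 le_eqVlt; apply/orP; left; apply/eqP; ring.
  move=> u0 ku.
  have [m um] : exists m : nat, u <= 2 ^+ m * s0.
    exists (Num.truncn (u / s0)).+1; rewrite -ler_pdivrMr// (le_trans (ltW (truncnS_gt _)))//.
    by rewrite -natrX ler_nat ltnW// ltn_expl.
  exact: ind um ku.
(* k tends to 1 if u < pi; for u = pi and d = D(pi / 2), the doubling estimate
   d^2 <= (4 d - D(pi)) E gives D(pi) E <= 4 d E - d^2 <= 4 E^2 *)
have half u : 0 <= u <= pi -> shift_gap f u <= 4 * sin (u / 2) ^+ 2 * E.
  move=> /andP[u0]; rewrite le_eqVlt => /predU1P[->|upi]; last first.
    rewrite leNgt; apply/negP => hlt.
    have cv : 4 * sin (k * u / 2) ^+ 2 * E @[k --> (1:R)] --> 4 * sin (1 * u / 2) ^+ 2 * E.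
      apply: cvgM; last exact: cvg_cst.
      apply: cvgM; first exact: cvg_cst.
      have cs : sin (k * u / 2) @[k --> (1:R)] --> sin (1 * u / 2).
        apply: (@continuous_comp _ _ _ (fun k : R => k * u / 2) sin); last exact: continuous_sin.
        by apply: cvgM; [apply: cvgM; [exact: cvg_id|exact: cvg_cst]|exact: cvg_cst].
      by apply: cvgM.
    move: hlt; rewrite -[u in sin (u / 2)]mul1r => hlt.
    move/cvgr_lt: cv => /(_ _ hlt) /nbhs_ballP[e /= e0 he].
    pose k := 1 + Num.min (e / 2) ((pi - u) / (u + 1)).
    have q0 : 0 < (pi - u) / (u + 1) by rewrite divr_gt0 ?subr_gt0//; lra.
    have m0 : 0 < Num.min (e / 2) ((pi - u) / (u + 1)) by rewrite lt_min divr_gt0.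
    have k1 : 1 < k by rewrite /k ltrDl.
    have ku : k * u <= pi.
      have : Num.min (e / 2) ((pi - u) / (u + 1)) * (u + 1) <= pi - u.
        by rewrite -ler_pdivlMr ?ge_min ?lexx ?orbT//; lra.
      by rewrite /k; lra.
    have := le_lt_trans (main k u k1 u0 ku) (he k _).
    rewrite ltxx => h; apply: notF; apply: h.
    rewrite /ball/= /k opprD addNKr normrN gtr0_norm//.
    by rewrite (@le_lt_trans _ _ (e / 2)) ?ge_min ?lexx// ltr_pdivrMr// ltr_pMr// ltr1n.
  rewrite sin_pihalf expr1n mulr1.
  have pp : pi = pi / 2 + pi / 2 :> R by field.
  have hp : 0 <= (pi : R) / 2 <= 2 * pi by apply/andP; split; lra.
  have [d4 d2] := dbl (pi / 2) hp; rewrite -pp in d4 d2.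
  move: E0 d2; rewrite le_eqVlt => /predU1P[E00|Ep] d2.
    have := shift_gap_crude pf pg Hf hp; rewrite -/E -E00 !mulr0 => h.
    by rewrite (le_trans d4)// pmulr_rle0.
  set d := shift_gap f (pi / 2) in d2; set d' := shift_gap f pi in d2 *.
  rewrite -(ler_pM2r Ep); have := sqr_ge0 (d - 2 * E); nra.
move=> /andP[s0 s1]; have [spi|pis] := leP s pi; first by apply: half; rewrite s0.
have -> : shift_gap f s = shift_gap f (2 * pi - s).
  rewrite /shift_gap -(@I_periodic_shift _ (2 * pi - s) (fun t => (f (t + s) - f t) ^+ 2)); first last.
  - by apply/andP; split; lra.
  - by move=> u v; apply: L1_continuous; exact/continuous_sqr/continuous_gap.
  - by move=> t; rewrite (periodic_gap s pf).
  apply: I_eq => t _; rewrite -addrA subrK pf -sqrrN opprB //.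
rewrite (le_trans (half _ _))//; first by apply/andP; split; lra.
have -> : (2 * pi - s) / 2 = pi - s / 2 by field.
by rewrite sinB sinpi cospi mul0r sub0r mulN1r opprK.
Qed.
End Shift.
Arguments continuous_shift {R f} s _ _.
Arguments continuous_gap {R f} s _ _.
Arguments periodic_gap {R f} s _ _.

(** * Completeness of L^2 *)

Section L2_completeness.
Context {R : realType}.
Implicit Types (f h : R -> R) (a b c t : R).
Notation mu := (@lebesgue_measure R).

Lemma EFin_I a b f : L1 a b f -> (\int[mu]_(t in `[a, b]) (f t)%:E)%E = (I a b f)%:E.
Proof. by move=> Lf; rewrite /I /Rintegral fineK//; exact: integrable_fin_num. Qed.

Lemma limn_einf_le (u : (\bar R)^nat) (c : \bar R) : (forall n, u n <= c)%E -> (limn_einf u <= c)%E.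
Proof.
move=> uc; rewrite limn_einf_lim; apply: lime_le; first exact: is_cvg_einfs.
apply: nearW => n; apply: le_trans (uc n).
by apply: ereal_inf_lbound; exists n => /=.
Qed.

(** By monotone convergence the sum of the d p has a finite integral, so it is
finite almost everywhere. *)
Lemma ae_fin_limit a b (d : nat -> R -> R) (C : R) : a <= b ->
  (forall p, L1 a b (d p)) -> (forall p t, 0 <= d p t) ->
  (forall n, \sum_(0 <= p < n) I a b (d p) <= C) ->
  {ae mu, forall t, [set` `[a, b]] t -> exists M : R, forall n, \sum_(0 <= p < n) d p t <= M}.
Proof.
move=> ab Ld d0 dC.
pose u n t := \sum_(0 <= p < n) d p t.
have Lu n : L1 a b (u n).
  elim: n => [|n IHn]; first by apply: eq_L1 (L1_cst a b 0) => t _; rewrite /u big_geq.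
  by apply: eq_L1 (L1D IHn (Ld n)) => t _; rewrite /u big_nat_recr.
have Iu n : I a b (u n) = \sum_(0 <= p < n) I a b (d p).
  elim: n => [|n IHn].
    by rewrite big_geq// (@I_eq _ _ _ _ (fun=> 0)) ?I_cst ?mul0r// => t _; rewrite /u big_geq.
  by rewrite big_nat_recr//= -IHn -ID//; apply: I_eq => t _; rewrite /u big_nat_recr.
have ndu t : {homo (fun n => (u n t)%:E) : m n / (m <= n)%N >-> (m <= n)%E}.
  move=> m n mn; rewrite lee_fin /u (big_cat_nat (leq0n m) mn)/= lerDl.
  by apply: sumr_ge0.
have cu t : cvgn (fun n => (u n t)%:E) by exact: ereal_nondecreasing_is_cvgn (ndu t).
pose F t := limn_esup (fun n => (u n t)%:E).
have mu_ n : measurable_fun [set` `[a, b]] (fun t => (u n t)%:E).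
  by apply/measurable_EFinP; exact: L1_meas (Lu n).
have mF : measurable_fun [set` `[a, b]] F by apply: measurable_fun_limn_esup.
have uF n t : ((u n t)%:E <= F t)%E.
  rewrite /F is_cvg_limn_esupE//; apply: lime_ge => //.
  by exists n => // m /= nm; exact: ndu.
have u0 n t : 0 <= u n t by apply: sumr_ge0.
have F0 t : (0 <= F t)%E by apply: le_trans (uF 0 t); rewrite lee_fin.
have IF : (\int[mu]_(t in `[a, b]) F t <= C%:E)%E.
  have := @fatou _ _ _ mu [set` `[a, b]] (measurable_cc a b) (fun n t => (u n t)%:E) mu_ (fun n t _ => u0 n t).
  under eq_integral do rewrite is_cvg_limn_einfE// -is_cvg_limn_esupE// -/(F _).
  move=> /le_trans; apply; apply: limn_einf_le => n.
  by rewrite EFin_I// lee_fin Iu.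
have iF : mu.-integrable `[a, b] F.
  apply/integrableP; split => //.
  apply: le_lt_trans (ltry C); under eq_integral do rewrite gee0_abs//.
  exact: IF.
have := integrable_ae (measurable_cc a b) iF; apply: filterS.
move=> t /= h tab; exists (fine (F t)) => n.
by rewrite -lee_fin fineK ?h//; exact: uF.
Qed.

(** Riesz-Fischer for a sequence that is Cauchy at a geometric rate: the
increments are summable almost everywhere, so the functions converge there, and
Fatou's lemma transfers the L^2 bounds to the limit. *)
Lemma L2_complete a b (g : nat -> R -> R) (C : R) : a <= b ->
  (forall p, L2 a b (g p)) ->
  (forall p q, (p <= q)%N -> I a b (fun t => (g q t - g p t) ^+ 2) <= C * 4^-1 ^+ p) ->
  exists2 G, L2 a b G & forall p, I a b (fun t => (G t - g p t) ^+ 2) <= C * 4^-1 ^+ p.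
Proof.
move=> ab Lg gC.
have C0 : 0 <= C.
  have := gC 0%N 0%N (leqnn _); rewrite expr0 mulr1; apply: le_trans.
  by apply: I_ge0 => t _; exact: sqr_ge0.
pose d (p : nat) (t : R) : R := `|g p.+1 t - g p t|.
have LB p q : L2 a b (fun t => g q t - g p t) by exact: L2B.
have Ld p : L1 a b (d p) by apply: L1_norm; apply: L2_L1.
have Id p : I a b (d p) <= Num.sqrt ((b - a) * C) * 2^-1 ^+ p.
  have I0 : 0 <= I a b (d p) by apply: I_ge0 => t _; exact: normr_ge0.
  rewrite -(ger0_norm I0) -sqrtr_sqr.
  have -> : Num.sqrt ((b - a) * C) * 2^-1 ^+ p = Num.sqrt ((b - a) * C * 4^-1 ^+ p).
    rewrite [RHS]sqrtrM ?mulr_ge0 ?subr_ge0//; congr (_ * _).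
    have -> : 4^-1 ^+ p = (2^-1 ^+ p) ^+ 2 :> R.
      by rewrite -exprM mulnC exprM; congr (_ ^+ _); field.
    by rewrite sqrtr_sqr ger0_norm// exprn_ge0// invr_ge0.
  rewrite ler_wsqrtr// (le_trans (I_sq_le ab (LB p p.+1)))// -mulrA ler_wpM2l ?subr_ge0//.
  exact: gC.
have Sd n : \sum_(0 <= p < n) I a b (d p) <= 2 * Num.sqrt ((b - a) * C).
  have h : \sum_(0 <= p < n) I a b (d p) <= Num.sqrt ((b - a) * C) * (2 - 2 * 2^-1 ^+ n).
    elim: n => [|n IHn]; first by rewrite big_geq// expr0 mulr1 subrr mulr0.
    rewrite big_nat_recr//= (le_trans (lerD IHn (Id n)))// -mulrDr ler_wpM2l ?sqrtr_ge0//.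
    by rewrite exprS; lra.
  rewrite (le_trans h)// [X in _ <= X]mulrC ler_wpM2l ?sqrtr_ge0//.
  by rewrite gerBl mulr_ge0// exprn_ge0// invr_ge0.
have aeM := ae_fin_limit ab Ld (fun p t => normr_ge0 _) Sd.
have cvg_g : {ae mu, forall t, [set` `[a, b]] t -> cvgn (fun p => g p t)}.
  apply: filterS aeM; first exact: (ae_filter_ringOfSetsType mu).
  move=> t /= /[apply] -[M hM].
  pose w p := g p.+1 t - g p t.
  have cn : cvgn [normed series w].
    apply: nondecreasing_is_cvgn.
      by apply: nondecreasing_series => n _ _ /=; exact: normr_ge0.
    by exists M => _ [n _ <-]; exact: hM.
  have /cvg_ex[l hl] := @normed_cvg R R^o w cn.
  apply/cvg_ex; exists (g 0%N t + l).
  have -> : (fun p => g p t) = (fun p => g 0%N t + series w p).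
    apply/funext => p; rewrite /series/= telescope_sumr// addrC subrK//.
  by apply: cvgD; [exact: cvg_cst|exact: hl].
(* the upper limit is measurable, and is the limit wherever one exists *)
pose G t := fine (limn_esup (fun p => (g p t)%:E)).
have mG : measurable_fun `[a, b] G.
  apply: (@measurableT_comp _ _ _ _ _ _ fine).
    exact: fine_measurable.
  apply: measurable_fun_limn_esup => p; apply/measurable_EFinP; by case: (Lg p).
have Gcvg t : cvgn (fun p => g p t) -> g p t @[p --> \oo] --> G t.
  move=> /cvg_ex[l hl].
  have he : (g p t)%:E @[p --> \oo] --> l%:E by apply: cvg_EFin; [exact: nearW|exact: hl].
  by rewrite /G (cvg_limn_einf_sup he).2.
have key p : (\int[mu]_(t in `[a, b]) ((G t - g p t) ^+ 2)%:E <= (C * 4^-1 ^+ p)%:E)%E.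
  pose f q t := ((g (q + p)%N t - g p t) ^+ 2)%:E.
  have mf q : measurable_fun [set` `[a, b]] (f q).
    by apply/measurable_EFinP; apply: L1_meas; case: (LB p (q + p)%N).
  have f0 q t : [set` `[a, b]] t -> (0 <= f q t)%E by move=> _; rewrite lee_fin sqr_ge0.
  have := @fatou _ _ _ mu [set` `[a, b]] (measurable_cc a b) f mf f0.
  have E : (\int[mu]_(t in `[a, b]) ((G t - g p t) ^+ 2)%:E =
            \int[mu]_(t in `[a, b]) limn_einf (f^~ t))%E.
    apply: ge0_ae_eq_integral => //.
    - apply/measurable_EFinP; apply: measurable_funX; apply: measurable_funB => //.
      by case: (Lg p).
    - rewrite (_ : (fun t => limn_einf (f^~ t)) = (fun t => - limn_esup (fun q => - f q t))%E).
        apply: (@measurableT_comp _ _ _ _ _ _ (fun x : \bar R => - x)%E); first exact: oppe_measurable.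
        apply: measurable_fun_limn_esup => q.
        by apply: (@measurableT_comp _ _ _ _ _ _ (fun x : \bar R => - x)%E); [exact: oppe_measurable|exact: mf].
      by [].
    - by move=> t _; rewrite lee_fin sqr_ge0.
    - move=> t _; rewrite limn_einf_lim; apply: lime_ge; first exact: is_cvg_einfs.
      apply: nearW => n; apply: le_ereal_inf_tmp => _ [m /= _ <-].
      by rewrite lee_fin sqr_ge0.
    - apply: filterS cvg_g; first exact: (ae_filter_ringOfSetsType mu).
      move=> t /= /[apply] ct.
      have : f q t @[q --> \oo] --> ((G t - g p t) ^+ 2)%:E.
        apply: cvg_EFin; first exact: nearW.
        rewrite (_ : fine \o _ = fun q => (g (q + p)%N t - g p t) ^+ 2)//.
        apply: cvgM; (apply: cvgB; last exact: cvg_cst);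
          by rewrite (cvg_shiftn p (fun q => g q t)); exact: Gcvg.
      by move=> /cvg_limn_einf_sup [].
  rewrite E => /le_trans; apply; apply: limn_einf_le => q.
  rewrite EFin_I ?lee_fin; last by case: (LB p (q + p)%N).
  by apply: gC; rewrite leq_addl.
have LG2 p : L1 a b (fun t => (G t - g p t) ^+ 2).
  apply/integrableP; split.
    apply/measurable_EFinP; apply: measurable_funX; apply: measurable_funB => //.
    by case: (Lg p).
  apply: le_lt_trans (ltry (C * 4^-1 ^+ p)); apply: le_trans (key p).
  rewrite le_eqVlt; apply/orP; left; apply/eqP; apply: eq_integral => t _.
  by rewrite gee0_abs// lee_fin sqr_ge0.
exists G => [|p].
  have LGg : L2 a b (fun t => G t - g 0%N t).
    by split=> //; apply: measurable_funB => //; case: (Lg 0%N).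
  by apply: eq_L2 (L2D LGg (Lg 0%N)) => t _; rewrite subrK.
by rewrite -lee_fin -EFin_I.
Qed.
End L2_completeness.

(** * Uniform cluster points of equicontinuous sequences *)

Section Equicontinuous.
Context {R : realType}.

(** Tychonoff's theorem for [-M, M]^J. The cluster point is tested on finite
families of indices, which is what neighbourhoods in the product topology
control. *)
Lemma pointwise_cluster (J : eqType) (F : nat -> J -> R) (M : R) :
  (forall p i, `|F p i| <= M) ->
  exists f : J -> R, forall (T : finType) (idx : T -> J) (e : R) (N : nat), 0 < e ->
    exists2 p, (N <= p)%N & forall i, `|F p (idx i) - f (idx i)| < e.
Proof.
move=> FM.
have := @tychonoff J (fun=> R) (fun=> [set` `[- M, M]]) (fun=> @segment_compact R _ _).
move=> /(_ (F @ \oo) _) [|f [_ clf]].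
  by exists 0%N => // p _ i /=; rewrite in_itv/= -ler_norml.
exists f => T idx e N e0.
pose W := [set g : prod_topology (fun=> R : topologicalType) | forall i : T, `|g (idx i) - f (idx i)| < e].
have nW : nbhs (f : prod_topology (fun=> R : topologicalType)) W.
  have FF : Filter (nbhs (f : prod_topology (fun=> R : topologicalType))) by exact: nbhs_filter.
  apply: (@filter_forall _ T (fun i => [set g : prod_topology (fun=> R : topologicalType) |
    `|g (idx i) - f (idx i)| < e]) _ FF) => i.
  have : nbhs (f (idx i)) (ball (f (idx i)) e) by exact: nbhsx_ballx.
  have := @proj_continuous J (fun=> R : topologicalType) (idx i) f (ball (f (idx i)) e).
  move=> /[apply] h; apply: (@filterS _ _ FF _ _ _ h) => g.
  by rewrite /= /ball/= distrC.
have AN : (F @ \oo) [set F p | p in [set p | (N <= p)%N]].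
  by exists N => // p /= Np; exists p.
by have [_ [[p /= Np <-] Wp]] := clf _ _ AN nW; exists p.
Qed.

(** The Ascoli argument: a pointwise cluster point inherits the Hoelder
estimate, and closeness on a fine grid then implies closeness everywhere. The
boolean index carries the real and imaginary parts, which have to be
approximated along the same sequence. *)
Lemma uniform_cluster (F : nat -> bool * R -> R) (M E L : R) : 0 < L ->
  (forall p i, `|F p i| <= M) ->
  (forall p b s t, 0 <= s -> s <= t -> t <= L ->
     (F p (b, t) - F p (b, s)) ^+ 2 <= (t - s) * E) ->
  exists f : bool * R -> R, forall (e : R) (N : nat), 0 < e ->
    exists2 p, (N <= p)%N &
    forall b t, 0 <= t <= L -> `|F p (b, t) - f (b, t)| <= e.
Proof.
move=> L0 FM FE; have [f hf] := pointwise_cluster FM.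
have E0 : 0 <= E.
  have := FE 0%N true 0 L (lexx 0) (ltW L0) (lexx L); rewrite subr0 => h.
  by rewrite -(pmulr_rge0 _ L0) (le_trans _ h)// sqr_ge0.
exists f => e N e0.
have fE b s t : 0 <= s -> s <= t -> t <= L -> `|f (b, t) - f (b, s)| <= Num.sqrt ((t - s) * E).
  move=> s0 st tL; apply/ler_addgt0Pr => x x0.
  have x2 : 0 < x / 2 by rewrite divr_gt0.
  have [p _ hp] := hf bool (fun c => (b, if c then t else s)) (x / 2) 0%N x2.
  have h1 := hp true; have h2 := hp false; rewrite /= in h1 h2.
  have h3 : `|F p (b, t) - F p (b, s)| <= Num.sqrt ((t - s) * E).
    by rewrite -sqrtr_sqr ler_wsqrtr// FE.
  move: h1 h2 h3; rewrite ltr_norml => /andP[h1 h1'].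
  rewrite ltr_norml => /andP[h2 h2']; rewrite !ler_norml => /andP[h3 h3'].
  by apply/andP; split; lra.
pose J := (Num.truncn (L * E / (e / 4) ^+ 2)).+1.
have J0 : 0 < J%:R :> R by rewrite ltr0n.
have JE : Num.sqrt (L / J%:R * E) <= e / 4.
  have e4 : 0 < e / 4 by rewrite divr_gt0.
  rewrite -[X in _ <= X]ger0_norm ?(ltW e4)// -sqrtr_sqr ler_wsqrtr//.
  rewrite mulrAC ler_pdivrMr// [X in _ <= X]mulrC -ler_pdivrMr ?exprn_gt0//.
  by rewrite ltW// truncnS_gt.
have e4 : 0 < e / 4 by rewrite divr_gt0.
pose grid (j : nat) : R := L * j%:R / J%:R.
have [p Np hp] := hf (bool * 'I_J.+1)%type (fun i => (i.1, grid i.2)) (e / 4) N e4.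
exists p => // b t /andP[t0 tL].
pose j := Num.truncn (t * J%:R / L).
have jt : j%:R <= t * J%:R / L < j.+1%:R.
  by rewrite truncn_itv// divr_ge0 ?mulr_ge0// ltW.
have jJ : (j < J.+1)%N.
  rewrite ltnS -(ler_nat R); case/andP: jt => jt _; rewrite (le_trans jt)//.
  by rewrite ler_pdivrMr// mulrC ler_pM2l.
have := hp (b, Ordinal jJ) => /= hj.
have gt : grid j <= t.
  rewrite /grid ler_pdivrMr// mulrC -ler_pdivlMr//; by case/andP: jt.
have tg : t - grid j <= L / J%:R.
  case/andP: jt => _; rewrite ltr_pdivrMr// => h.
  rewrite -(ler_pM2r J0) mulrBl /grid !divfK ?gt_eqF//.
  by move: h; rewrite -[j.+1%:R]natr1; lra.
have g0 : 0 <= grid j by rewrite /grid divr_ge0 ?mulr_ge0// ltW.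
have sq : Num.sqrt ((t - grid j) * E) <= e / 4.
  by rewrite (le_trans _ JE)// ler_wsqrtr// ler_wpM2r.
have h1 := le_trans (fE b _ _ g0 gt tL) sq.
have h2 : `|F p (b, t) - F p (b, grid j)| <= e / 4.
  by rewrite -sqrtr_sqr (le_trans _ sq)// ler_wsqrtr// FE.
move: hj h1 h2; rewrite ltr_norml => /andP[a1 a1'].
rewrite !ler_norml => /andP[a2 a2'] /andP[a3 a3'].
by apply/andP; split; lra.
Qed.
End Equicontinuous.

(** * The action as a real number *)

Section Action.
Context {R : realType}.
Implicit Types (y v : R -> R[i]) (z w : R[i]) (alpha omega s t x rho : R).
Notation Re := complex.Re.
Notation Im := complex.Im.

Lemma ReD z w : Re (z + w) = Re z + Re w. Proof. by case: z; case: w. Qed.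
Lemma ImD z w : Im (z + w) = Im z + Im w. Proof. by case: z; case: w. Qed.
Lemma ReN z : Re (- z) = - Re z. Proof. by case: z. Qed.
Lemma ImN z : Im (- z) = - Im z. Proof. by case: z. Qed.
Lemma ReB z w : Re (z - w) = Re z - Re w. Proof. by case: z; case: w. Qed.
Lemma ImB z w : Im (z - w) = Im z - Im w. Proof. by case: z; case: w. Qed.
Lemma ReM z w : Re (z * w) = Re z * Re w - Im z * Im w. Proof. by case: z; case: w. Qed.
Lemma ImM z w : Im (z * w) = Re z * Im w + Im z * Re w. Proof. by case: z; case: w. Qed.

Lemma complex_ext z w : Re z = Re w -> Im z = Im w -> z = w.
Proof. by case: z => a b; case: w => c d /= -> ->. Qed.

Lemma cabsE z : cabs z = Num.sqrt (Re z ^+ 2 + Im z ^+ 2).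
Proof. by case: z. Qed.

Lemma cabs_sqr z : cabs z ^+ 2 = Re z ^+ 2 + Im z ^+ 2.
Proof. by rewrite cabsE sqr_sqrtr// addr_ge0 ?sqr_ge0. Qed.

Lemma cabs_ge0 z : 0 <= cabs z.
Proof. by rewrite cabsE sqrtr_ge0. Qed.

Lemma cabsD z w : cabs (z + w) <= cabs z + cabs w.
Proof. exact: le_normcD. Qed.

Lemma cabsM z w : cabs (z * w) = cabs z * cabs w.
Proof. exact: ComplexField.Normc.normcM. Qed.

Lemma cabsN z : cabs (- z) = cabs z.
Proof. by rewrite !cabsE ReN ImN !sqrrN. Qed.

Lemma cabsC z w : cabs (z - w) = cabs (w - z).
Proof. by rewrite -cabsN opprB. Qed.

Lemma cabs_eq0 z : cabs z = 0 -> z = 0.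
Proof. exact: ComplexField.Normc.eq0_normc. Qed.

Lemma cabs0 : cabs (0 : R[i]) = 0.
Proof. by rewrite cabsE/= expr0n/= addr0 sqrtr0. Qed.

Lemma cabs_real x : cabs x%:C%C = `|x|.
Proof. by rewrite cabsE/= expr0n/= addr0 sqrtr_sqr. Qed.

Lemma cabs_gt0 z : (0 < cabs z) = (z != 0).
Proof.
rewrite lt_neqAle cabs_ge0 andbT eq_sym; congr (~~ _).
by apply/eqP/eqP => [/cabs_eq0|->]; last exact: cabs0.
Qed.

Lemma cabsB_ge z w : cabs z - cabs w <= cabs (z + w).
Proof. by rewrite lerBlDr -[in cabs w]cabsN -[z in X in X <= _](addrK w) cabsD. Qed.

Lemma Re_cabs z : `|Re z| <= cabs z.
Proof. by rewrite -sqrtr_sqr cabsE ler_wsqrtr// lerDl sqr_ge0. Qed.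

Lemma Im_cabs z : `|Im z| <= cabs z.
Proof. by rewrite -sqrtr_sqr cabsE ler_wsqrtr// lerDr sqr_ge0. Qed.

Lemma cabs_le z : cabs z <= `|Re z| + `|Im z|.
Proof.
rewrite -[X in _ <= X]ger0_norm ?addr_ge0// -sqrtr_sqr cabsE ler_wsqrtr//.
rewrite sqrrD !real_normK ?num_real// -addrA addrCA addrC -addrA lerD2l.
by rewrite lerDl mulrn_wge0// mulr_ge0.
Qed.

Definition ipow alpha x : R := (x `^ alpha)^-1.

Lemma ipowE alpha x : 0 < x -> ipow alpha x = expR (- (alpha * ln x)).
Proof. by move=> x0; rewrite /ipow /powR gt_eqF// expRN. Qed.

Lemma ipow_ge0 alpha x : 0 <= ipow alpha x.
Proof. by rewrite invr_ge0 powR_ge0. Qed.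

Lemma ipow_gt0 alpha x : 0 < x -> 0 < ipow alpha x.
Proof. by move=> x0; rewrite ipowE// expR_gt0. Qed.

Lemma ipow_le alpha x x' : 0 < alpha -> 0 < x -> x <= x' -> ipow alpha x' <= ipow alpha x.
Proof.
move=> a0 x0 xx'; have x'0 : 0 < x' by exact: lt_le_trans xx'.
by rewrite !ipowE// ler_expR lerN2 ler_pM2l// ler_ln.
Qed.

(** Convexity of exp and concavity of ln, in the form 1 + x <= exp x and ln (1 +
x) <= x. *)
Lemma ipow_tangent alpha x rho : 0 < alpha -> 0 < x -> 0 < rho ->
  ipow alpha rho * (1 - alpha * (x / rho - 1)) <= ipow alpha x.
Proof.
move=> a0 x0 r0; have xr0 : 0 < x / rho by rewrite divr_gt0.
have -> : ipow alpha x = ipow alpha rho * expR (- (alpha * ln (x / rho))).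
  by rewrite !ipowE// -expRD ln_div ?posrE//; congr expR; ring.
rewrite ler_wpM2l ?ipow_ge0//; apply: le_trans (expR_ge1Dx _).
rewrite lerD2l lerN2 ler_wpM2l ?(ltW a0)//.
have := @le_ln1Dx R (x / rho - 1); rewrite [1 + _]addrC subrK; apply.
by rewrite ltrBrDl subrr.
Qed.

Lemma ipow_lip alpha m x x' : 0 < alpha -> 0 < m -> m <= x -> m <= x' ->
  ipow alpha x <= ipow alpha x' + alpha * ipow alpha m / m * `|x' - x|.
Proof.
move=> a0 m0 mx mx'; have x0 : 0 < x by exact: lt_le_trans mx.
have x'0 : 0 < x' by exact: lt_le_trans mx'.
have := ipow_tangent a0 x'0 x0; rewrite mulrBr mulr1 lerBlDr => /le_trans; apply.
rewrite lerD2l.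
have -> : ipow alpha x * (alpha * (x' / x - 1)) = alpha * (ipow alpha x / x) * (x' - x).
  by field; rewrite gt_eqF.
have h : ipow alpha x / x <= ipow alpha m / m.
  by rewrite ler_pM ?ipow_ge0 ?invr_ge0 ?(ltW x0)// ?ipow_le// lef_pV2 ?posrE.
rewrite (@le_trans _ _ (alpha * (ipow alpha x / x) * `|x' - x|))//.
  rewrite ler_wpM2l ?ler_norm//.
  by rewrite mulr_ge0 ?(ltW a0)// divr_ge0 ?ipow_ge0 ?(ltW x0).
by rewrite ler_wpM2r// -mulrA ler_wpM2l// ltW.
Qed.

Lemma continuous_ipow alpha (d : R -> R) : continuous d -> (forall t, 0 < d t) ->
  continuous (fun t => ipow alpha (d t)).
Proof.
move=> cd d0; rewrite (_ : (fun t => _) = (fun t => expR (- (alpha * ln (d t))))).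
  move=> t; apply: (@continuous_comp _ _ _ (fun t => - (alpha * ln (d t))) expR).
    apply: cvgN; apply: cvgM; first exact: cvg_cst.
    apply: (@continuous_comp _ _ _ d (@ln R)); first exact: cd.
    exact: continuous_ln.
  exact: continuous_expR.
by apply/funext => t; rewrite ipowE.
Qed.

Definition ccontinuous y := continuous (fun t => Re (y t)) /\ continuous (fun t => Im (y t)).

Lemma continuous_cabs y : ccontinuous y -> continuous (fun t => cabs (y t)).
Proof.
move=> [cr ci]; rewrite (_ : (fun t => _) = (fun t => Num.sqrt (Re (y t) ^+ 2 + Im (y t) ^+ 2))).
  move=> t; apply: (@continuous_comp _ _ _ (fun t => Re (y t) ^+ 2 + Im (y t) ^+ 2) Num.sqrt).
    by apply: cvgD; [exact: (continuous_sqr cr)|exact: (continuous_sqr ci)].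
  exact: sqrt_continuous.
by apply/funext => t; exact: cabsE.
Qed.

Lemma ccontinuous_gap y s : ccontinuous y -> ccontinuous (fun t => y t - y (t + s)).
Proof.
move=> [cr ci]; split.
  rewrite (_ : (fun t => _) = (fun t => Re (y t) - Re (y (t + s)))).
    by have cs := continuous_shift s cr; move=> t; apply: cvgB; [exact: cr|exact: cs].
  by apply/funext => t; exact: ReB.
rewrite (_ : (fun t => _) = (fun t => Im (y t) - Im (y (t + s)))).
  by have cs := continuous_shift s ci; move=> t; apply: cvgB; [exact: ci|exact: cs].
by apply/funext => t; exact: ImB.
Qed.

Lemma H1_cderiv_cont y v : H1_cderiv y v -> ccontinuous y.
Proof. by move=> [h1 h2]; split; [exact: H1_continuous h1|exact: H1_continuous h2]. Qed.

(** y is a periodic H^1 curve with a chosen periodic weak derivative v. Carrying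
v along avoids the choice operator in wderiv. *)
Definition loop y v := [/\ forall t, y (t + 2 * pi) = y t,
  forall t, v (t + 2 * pi) = v t & H1_cderiv y v].

Lemma loop_of_interval y (g1 g2 : R -> R) : (forall t, y (t + 2 * pi) = y t) ->
  H1on 0 (2 * pi) (fun t => Re (y t)) g1 -> H1on 0 (2 * pi) (fun t => Im (y t)) g2 ->
  exists2 v, loop y v & forall t, 0 <= t < 2 * pi -> v t = Complex (g1 t) (g2 t).
Proof.
move=> py h1 h2.
have [|G1 [p1 H1 e1]] := periodic_derivative _ h1; first by move=> t; rewrite py.
have [|G2 [p2 H2 e2]] := periodic_derivative _ h2; first by move=> t; rewrite py.
exists (fun t => Complex (G1 t) (G2 t)) => [|t ht]; last by rewrite e1// e2.
by split=> // t; rewrite p1 p2.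
Qed.

Lemma Lambda_loop n y : Lambda n y -> exists v, loop y v.
Proof.
move=> [[py [v [h1 h2]]] _].
have [w lw _] := @loop_of_interval y _ _ py (((H1_derivP _ _).1 h1).2 _ _) (((H1_derivP _ _).1 h2).2 _ _).
by exists w.
Qed.

Definition kin omega y v := I 0 (2 * pi) (fun t =>
  (Re (v t) - omega * Im (y t)) ^+ 2 + (Im (v t) + omega * Re (y t)) ^+ 2).

Definition pot alpha s y := I 0 (2 * pi) (fun t => ipow alpha (cabs (y t - y (t + s)))).

Definition act n alpha omega y v : R :=
  2^-1 * kin omega y v + 2^-1 * \sum_(1 <= h < n) pot alpha (h%:R * tau n) y.

Lemma L2_deriv f g a b : @H1_deriv R f g -> L2 a b g.
Proof. by move=> /H1_derivP[_ /(_ a b)] []. Qed.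

Lemma kin_L2 omega y v a b : H1_cderiv y v ->
  L2 a b (fun t => Re (v t) - omega * Im (y t)) /\
  L2 a b (fun t => Im (v t) + omega * Re (y t)).
Proof.
move=> h; have [c1 c2] := H1_cderiv_cont h; have [h1 h2] := h; split.
  by apply: L2B; [exact: L2_deriv h1|apply: L2Z; exact: L2_continuous].
by apply: L2D; [exact: L2_deriv h2|apply: L2Z; exact: L2_continuous].
Qed.

Lemma kin_L1 omega y v a b : H1_cderiv y v -> L1 a b (fun t =>
  (Re (v t) - omega * Im (y t)) ^+ 2 + (Im (v t) + omega * Re (y t)) ^+ 2).
Proof. by move=> /(@kin_L2 omega _ _ a b)[[_ h1] [_ h2]]; exact: L1D. Qed.

(** Weak derivatives agree almost everywhere, so the kinetic term does not
depend on the one that is chosen. *)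
Lemma kin_unique omega y v (w : R -> R[i]) : H1_cderiv y v -> H1_cderiv y w ->
  kin omega y v = kin omega y w.
Proof.
move=> hv hw; apply: I_ae_eq; [exact: kin_L1|exact: kin_L1|].
have [v1 v2] := hv; have [w1 w2] := hw.
have e1 := H1on_unique (((H1_derivP _ _).1 v1).2 0 (2 * pi)) (((H1_derivP _ _).1 w1).2 0 (2 * pi)).
have e2 := H1on_unique (((H1_derivP _ _).1 v2).2 0 (2 * pi)) (((H1_derivP _ _).1 w2).2 0 (2 * pi)).
by apply: filterS2 e1 e2 => t /= h1 h2 ht; rewrite h1// h2.
Qed.

Lemma wderivP y v : H1_cderiv y v -> H1_cderiv y (wderiv y).
Proof. by move=> h; rewrite /wderiv; apply: (@xgetPex _ _ [set v | H1_cderiv y v]); exists v. Qed.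

Lemma kineticE omega y v : H1_cderiv y v -> kinetic omega y = (kin omega y v)%:E.
Proof.
move=> h; have hw := wderivP h; rewrite (kin_unique _ h hw) -EFin_I; last exact: kin_L1.
apply: eq_integral => t _; congr (_%:E).
rewrite cabs_sqr ReD ImD ReM ImM/= !mul0r sub0r add0r; ring.
Qed.

Lemma pot_L1 alpha s y a b : ccontinuous y -> (forall t, y t != y (t + s)) ->
  L1 a b (fun t => ipow alpha (cabs (y t - y (t + s)))).
Proof.
move=> cy ny; apply: L1_continuous; apply: continuous_ipow.
  exact: (continuous_cabs (ccontinuous_gap s cy)).
by move=> t; rewrite cabs_gt0 subr_eq0.
Qed.

Lemma actionE n alpha omega y v : Lambda n y -> H1_cderiv y v ->
  action n alpha omega y = (act n alpha omega y v)%:E.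
Proof.
move=> [_ ny] h; rewrite /action /act (kineticE _ h) EFinD !EFinM; congr (_ + _ * _)%E.
rewrite /potential -sumEFin; apply: eq_big_nat => i hi.
by rewrite -EFin_I//; apply: pot_L1; [exact: H1_cderiv_cont h|move=> t; exact: ny].
Qed.

Lemma kin_ge0 omega y v : 0 <= kin omega y v.
Proof. by apply: I_ge0 => t _; rewrite addr_ge0 ?sqr_ge0. Qed.

Lemma pot_ge0 alpha s y : 0 <= pot alpha s y.
Proof. by apply: I_ge0 => t _; exact: ipow_ge0. Qed.

End Action.

(** * Perturbation estimates for the action *)

Section Perturbation.
Context {R : realType}.
Implicit Types (y v z w : R -> R[i]) (alpha omega s t x : R).
Notation Re := complex.Re.
Notation Im := complex.Im.

Lemma le_geometric (A C : R) : (forall p, A <= C * 2^-1 ^+ p) -> A <= 0.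
Proof.
move=> h; have : C * 2^-1 ^+ p @[p --> \oo] --> (C * 0 : R).
  apply: cvgM; first exact: cvg_cst.
  by apply: cvg_expr; rewrite ger0_norm ?invr_ge0// invf_lt1// ltr1n.
rewrite mulr0 leNgt => hc; apply/negP => A0.
move/cvgr_lt: hc => /(_ _ A0) [p _ /(_ p (leqnn p))] /= hp.
by have := le_lt_trans (h p) hp; rewrite ltxx.
Qed.

Lemma I_cst_period (k : R) : I 0 (2 * pi) (fun=> k) = k * (2 * pi).
Proof. by rewrite I_cst ?subr0// ltW// pi2_gt0. Qed.

Definition comb (a b : R) y z t := Complex (a * Re (y t) + b * Re (z t)) (a * Im (y t) + b * Im (z t)).

Lemma H1_deriv_comb (a b : R) (f f' g g' : R -> R) : H1_deriv f f' -> H1_deriv g g' ->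
  H1_deriv (fun t => a * f t + b * g t) (fun t => a * f' t + b * g' t).
Proof.
move=> /H1_derivP[mf Hf] /H1_derivP[mg Hg]; apply/H1_derivP; split.
  by apply: measurable_funD; apply: measurable_funM.
by move=> c d; apply: H1onD; exact: H1onZ.
Qed.

Lemma loop_comb (a b : R) y v z w : loop y v -> loop z w ->
  loop (comb a b y z) (comb a b v w).
Proof.
move=> [py pv [h1 h2]] [pz pw [k1 k2]]; split.
- by move=> t; rewrite /comb py pz.
- by move=> t; rewrite /comb pv pw.
- by split; exact: H1_deriv_comb.
Qed.

(** The parallelogram identity for the quadratic form kin. *)
Lemma kin_mid omega y v z w : loop y v -> loop z w ->
  4 * kin omega (comb 2^-1 2^-1 y z) (comb 2^-1 2^-1 v w) +
  kin omega (comb 1 (-1) y z) (comb 1 (-1) v w) =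
  2 * kin omega y v + 2 * kin omega z w.
Proof.
move=> ly lz; have [_ _ hy] := ly; have [_ _ hz] := lz.
have [_ _ hm] := loop_comb 2^-1 2^-1 ly lz; have [_ _ hd] := loop_comb 1 (-1) ly lz.
have Ly := kin_L1 omega 0 (2 * pi) hy; have Lz := kin_L1 omega 0 (2 * pi) hz.
have Lm := kin_L1 omega 0 (2 * pi) hm; have Ld := kin_L1 omega 0 (2 * pi) hd.
rewrite /kin -!IZ// -!ID//; [|exact: L1Z..].
by apply: I_eq => t _; rewrite /comb/=; field.
Qed.

(** (a + b)^2 <= (1 + th) a^2 + (1 + 1/th) b^2; together with L^2 convergence
this replaces lower semicontinuity. *)
Lemma kin_perturb omega (th : R) y v z w : 0 < th -> loop y v -> loop z w ->
  kin omega y v <= (1 + th) * kin omega z w +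
    (1 + th^-1) * kin omega (comb 1 (-1) y z) (comb 1 (-1) v w).
Proof.
move=> th0 ly lz; have [_ _ hy] := ly; have [_ _ hz] := lz.
have [_ _ hd] := loop_comb 1 (-1) ly lz.
have Ly := kin_L1 omega 0 (2 * pi) hy; have Lz := kin_L1 omega 0 (2 * pi) hz.
have Ld := kin_L1 omega 0 (2 * pi) hd.
rewrite /kin -!IZ// -ID; [|exact: L1Z..].
apply: I_le => //; first by apply: L1D; exact: L1Z.
have key (a b : R) : (a + b) ^+ 2 <= (1 + th) * a ^+ 2 + (1 + th^-1) * b ^+ 2.
  rewrite -subr_ge0.
  have -> : (1 + th) * a ^+ 2 + (1 + th^-1) * b ^+ 2 - (a + b) ^+ 2 = th * (a - th^-1 * b) ^+ 2.
    by field; rewrite gt_eqF.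
  by rewrite mulr_ge0 ?sqr_ge0// ltW.
move=> t _; rewrite /comb/=.
have := lerD (key (Re (w t) - omega * Im (z t)) (1 * Re (v t) + -1 * Re (w t) - omega * (1 * Im (y t) + -1 * Im (z t))))
  (key (Im (w t) + omega * Re (z t)) (1 * Im (v t) + -1 * Im (w t) + omega * (1 * Re (y t) + -1 * Re (z t)))).
set L := (X in X <= _ -> _); set U := (X in _ <= X -> _) => h.
apply: le_trans (le_trans h _); rewrite le_eqVlt; apply/orP; left; apply/eqP.
  by rewrite /L; ring.
by rewrite /U; ring.
Qed.

Definition en v := I 0 (2 * pi) (fun t => Re (v t) ^+ 2 + Im (v t) ^+ 2).

Lemma en_L1 y v a b : H1_cderiv y v -> L1 a b (fun t => Re (v t) ^+ 2 + Im (v t) ^+ 2).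
Proof. by move=> [/L2_deriv h1 /L2_deriv h2]; apply: L1D; [case: (h1 a b)|case: (h2 a b)]. Qed.

Lemma en_le_kin omega y v (M : R) : H1_cderiv y v -> (forall t, cabs (y t) <= M) ->
  en v <= 2 * kin omega y v + 2 * omega ^+ 2 * M ^+ 2 * (2 * pi).
Proof.
move=> h hM; have p0 := @pi2_gt0 R.
have Lk := kin_L1 omega 0 (2 * pi) h.
rewrite -(I_cst_period (_ * M ^+ 2)) /kin -IZ// -ID; [|exact: L1Z|exact: L1_cst].
apply: I_le; [exact: en_L1 h|by apply: L1D; [exact: L1Z|exact: L1_cst]|].
move=> t _; have : cabs (y t) ^+ 2 <= M ^+ 2.
  by rewrite ler_pXn2r ?nnegrE ?cabs_ge0// (le_trans (cabs_ge0 _) (hM t)).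
rewrite cabs_sqr => hh.
have h1 := sqr_ge0 (Re (v t) - 2 * omega * Im (y t)).
have h2 := sqr_ge0 (Im (v t) + 2 * omega * Re (y t)).
have h3 : omega ^+ 2 * (Re (y t) ^+ 2 + Im (y t) ^+ 2) <= omega ^+ 2 * M ^+ 2.
  by rewrite ler_wpM2l ?sqr_ge0.
by move: h1 h2 h3; rewrite !expr2; lra.
Qed.

Lemma kin_le_en omega y v (M : R) : H1_cderiv y v -> (forall t, cabs (y t) <= M) ->
  kin omega y v <= 2 * en v + 2 * omega ^+ 2 * M ^+ 2 * (2 * pi).
Proof.
move=> h hM; have p0 := @pi2_gt0 R.
have Lk := en_L1 0 (2 * pi) h.
rewrite -(I_cst_period (_ * M ^+ 2)) /en -IZ// -ID; [|exact: L1Z|exact: L1_cst].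
apply: I_le; [exact: kin_L1|by apply: L1D; [exact: L1Z|exact: L1_cst]|].
move=> t _; have : cabs (y t) ^+ 2 <= M ^+ 2.
  by rewrite ler_pXn2r ?nnegrE ?cabs_ge0// (le_trans (cabs_ge0 _) (hM t)).
rewrite cabs_sqr => hh.
have h1 := sqr_ge0 (Re (v t) + omega * Im (y t)).
have h2 := sqr_ge0 (Im (v t) - omega * Re (y t)).
have h3 : omega ^+ 2 * (Re (y t) ^+ 2 + Im (y t) ^+ 2) <= omega ^+ 2 * M ^+ 2.
  by rewrite ler_wpM2l ?sqr_ge0.
by move: h1 h2 h3; rewrite !expr2; lra.
Qed.

Definition margin s (m : R) y := forall t, m <= cabs (y t - y (t + s)).

Lemma gap_close s (e : R) y z t : (forall t, cabs (y t - z t) <= e) ->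
  `|cabs (y t - y (t + s)) - cabs (z t - z (t + s))| <= 2 * e.
Proof.
move=> h; have h1 := h t; have h2 := h (t + s).
have a1 : cabs (y t - y (t + s)) <= cabs (z t - z (t + s)) + (cabs (y t - z t) + cabs (y (t + s) - z (t + s))).
  rewrite -[cabs (y (t + s) - _)]cabsN.
  have -> : y t - y (t + s) = (z t - z (t + s)) + ((y t - z t) + - (y (t + s) - z (t + s))) by ring.
  by rewrite (le_trans (cabsD _ _))// lerD2l cabsD.
have a2 : cabs (z t - z (t + s)) <= cabs (y t - y (t + s)) + (cabs (y t - z t) + cabs (y (t + s) - z (t + s))).
  rewrite -[cabs (y t - z t)]cabsN.
  have -> : z t - z (t + s) = (y t - y (t + s)) + (- (y t - z t) + (y (t + s) - z (t + s))) by ring.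
  by rewrite (le_trans (cabsD _ _))// lerD2l cabsD.
by rewrite ler_norml; apply/andP; split; lra.
Qed.

Lemma margin_close s (m e : R) y z : (forall t, cabs (y t - z t) <= e) ->
  margin s m y -> margin s (m - 2 * e) z.
Proof.
move=> h my t; have := gap_close s t h; have := my t.
by rewrite ler_norml => h1 /andP[_ h2]; lra.
Qed.

(** Away from collisions x^(-alpha) is Lipschitz, so the potential is continuous
for the uniform norm. *)
Lemma pot_close alpha s (m e : R) y z : 0 < alpha -> 0 < m ->
  ccontinuous y -> ccontinuous z -> margin s m y -> margin s m z ->
  (forall t, cabs (y t - z t) <= e) ->
  pot alpha s y <= pot alpha s z + alpha * ipow alpha m / m * (2 * e) * (2 * pi).
Proof.
move=> a0 m0 cy cz my mz h; have p0 := @pi2_gt0 R.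
have nz (u : R -> R[i]) : margin s m u -> forall t, u t != u (t + s).
  by move=> mu t; rewrite -subr_eq0 -cabs_gt0 (lt_le_trans m0).
have Ly := pot_L1 alpha 0 (2 * pi) cy (nz _ my).
have Lz := pot_L1 alpha 0 (2 * pi) cz (nz _ mz).
rewrite -(I_cst_period (_ * (2 * e))) /pot -ID//; last exact: L1_cst.
apply: I_le => //; first by apply: L1D => //; exact: L1_cst.
move=> t _; apply: le_trans (ipow_lip a0 m0 (my t) (mz t)) _.
rewrite lerD2l ler_wpM2l//; first by rewrite mulr_ge0 ?mulr_ge0 ?ipow_ge0 ?invr_ge0// ltW.
by rewrite distrC gap_close.
Qed.

(** Uniform convergence of the functions and L^2 convergence of their
derivatives preserve the fundamental theorem of calculus. *)
Lemma limit_weak_derivative (L c C : R) (fp gp : nat -> R -> R) (f G : R -> R) : 0 <= L ->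
  (forall p, H1on 0 L (fp p) (gp p)) -> L2 0 L G ->
  (forall p t, 0 <= t <= L -> `|fp p t - f t| <= c * 4^-1 ^+ p) ->
  (forall p, I 0 L (fun t => (G t - gp p t) ^+ 2) <= C * 4^-1 ^+ p) ->
  H1on 0 L f G.
Proof.
move=> L0 Hf LG hf hG; split => // x y x0 xy yL.
have c0 : 0 <= c.
  by have := hf 0%N 0; rewrite lexx L0 expr0 mulr1 => /(_ erefl); exact: le_trans.
have C0 : 0 <= C.
  by have := hG 0%N; rewrite expr0 mulr1; apply: le_trans; apply: I_ge0 => t _; exact: sqr_ge0.
apply/eqP; rewrite -subr_eq0 -normr_le0.
apply: (@le_geometric _ (2 * c + Num.sqrt (L * C))) => p.
have LGp : L2 x y (fun t => G t - gp p t).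
  by apply: L2_sub x0 yL _; apply: L2B => //; case: (Hf p).
have q2 : 4^-1 ^+ p = (2^-1 ^+ p) ^+ 2 :> R.
  by rewrite -exprM mulnC exprM; congr (_ ^+ _); field.
have q0 : 0 <= 2^-1 ^+ p :> R by rewrite exprn_ge0// invr_ge0.
have q1 : 2^-1 ^+ p <= 1 :> R by rewrite exprn_ile1// ?invr_ge0// invf_le1// ler1n.
have h1 : `|I x y (fun t => G t - gp p t)| <= Num.sqrt (L * C) * 2^-1 ^+ p.
  apply: (le_trans (I_norm (L2_L1 LGp))).
  have n0 : 0 <= I x y (fun t => `|G t - gp p t|) by apply: I_ge0.
  rewrite -(ger0_norm n0) -sqrtr_sqr.
  have -> : Num.sqrt (L * C) * 2^-1 ^+ p = Num.sqrt (L * C * 4^-1 ^+ p).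
    by rewrite [RHS]sqrtrM ?mulr_ge0// q2 sqrtr_sqr ger0_norm.
  rewrite ler_wsqrtr// (le_trans (I_sq_le xy LGp))// -mulrA ler_pM ?subr_ge0//.
  - by apply: I_ge0 => t _; exact: sqr_ge0.
  - by lra.
  - apply: le_trans (hG p); apply: I_sub_le => //; last by move=> t; exact: sqr_ge0.
    by have [] : L2 0 L (fun t => G t - gp p t) by apply: L2B => //; case: (Hf p).
have e1 : I x y (fun t => G t - gp p t) = I x y G - (fp p y - fp p x).
  rewrite IB; [|by apply: L2_L1; apply: L2_sub LG..|by apply: L2_L1; apply: L2_sub (Hf p).1].
  by rewrite (Hf p).2.
have hx : `|fp p x - f x| <= c * 4^-1 ^+ p by apply: hf; rewrite x0 (le_trans xy).
have hy : `|fp p y - f y| <= c * 4^-1 ^+ p by apply: hf; rewrite yL (le_trans x0).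
have h4 : c * 4^-1 ^+ p <= c * 2^-1 ^+ p by rewrite q2 ler_wpM2l// expr2 ler_piMr.
move: h1; rewrite e1 !ler_norml => /andP[a1 a2].
move: hx hy; rewrite !ler_norml => /andP[b1 b2] /andP[c1 c2].
by rewrite mulrDl; apply/andP; split; lra.
Qed.

End Perturbation.

(** * Existence of minimisers *)

Section Existence.
Context {R : realType}.
Implicit Types (y v z w : R -> R[i]) (alpha omega s t x : R).
Notation Re := complex.Re.
Notation Im := complex.Im.

Lemma margin_Lambda n (m : R) y v : 0 < m -> loop y v ->
  (forall h, (1 <= h < n)%N -> margin (h%:R * tau n) m y) -> Lambda n y.
Proof.
move=> m0 [py _ hy] hm; split; first by split => //; exists v.
by move=> t h hn; rewrite -subr_eq0 -cabs_gt0 (lt_le_trans m0)//; exact: hm.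
Qed.

Lemma comb_mid_dist y z (e : R) : (forall t, cabs (z t - y t) <= e) ->
  forall t, cabs (y t - comb 2^-1 2^-1 y z t) <= 2^-1 * e.
Proof.
move=> h t.
have -> : y t - comb 2^-1 2^-1 y z t = - ((2^-1)%:C%C * (z t - y t)).
  by apply: complex_ext; rewrite /comb ?ReN ?ImN ?ReB ?ImB ?ReM ?ImM ?ReB ?ImB /=; field.
rewrite cabsN cabsM cabs_real ger0_norm ?invr_ge0//.
by rewrite ler_wpM2l ?invr_ge0.
Qed.

Lemma comb_diff y z t : comb 1 (-1) y z t = y t - z t.
Proof. by apply: complex_ext; rewrite /comb ?ReB ?ImB/= mul1r mulN1r. Qed.

(** Linear bookkeeping of the parallelogram argument: kW, kp, kq and kd are the
kinetic terms of a midpoint, of the two curves and of their difference, and i is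
the infimum of the action. *)
Lemma midpoint_defect (kW kd kq kp VW Vq Vp i c qp qq : R) :
  i <= 2^-1 * kW + 2^-1 * VW -> VW <= Vq + 2 * c -> VW <= Vp + 2 * c ->
  2^-1 * kp + 2^-1 * Vp <= i + qp -> 2^-1 * kq + 2^-1 * Vq <= i + qq -> qq <= qp ->
  4 * kW + kd = 2 * kq + 2 * kp -> kd <= 8 * qp + 8 * c.
Proof. lra. Qed.

(** Linear bookkeeping for the passage to the limit, where r = 2^(-p) is the
rate of convergence. *)
Lemma limit_defect (ky A B kp Vy Vp X i q r C I0 K : R) :
  ky <= A + B -> B <= 2 * C * r -> A <= kp + 2 * I0 * r -> Vy <= Vp + X ->
  X <= K * r -> 2^-1 * kp + 2^-1 * Vp <= i + q -> q <= r -> 0 <= K * r ->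
  2^-1 * ky + 2^-1 * Vy - i <= (1 + I0 + C + K) * r.
Proof. lra. Qed.

Lemma mul_sqr_pi_ge0 (a b : R) : 0 <= 2 * a ^+ 2 * b ^+ 2 * (2 * pi).
Proof.
apply: mulr_ge0; last exact/ltW/pi2_gt0.
apply: mulr_ge0; last exact: sqr_ge0.
by apply: mulr_ge0 => //; exact: sqr_ge0.
Qed.

(** A minimising sequence has bounded energy, hence a uniform cluster point, and
the curves approximating it can be taken at a geometric rate. Midpoints of two
such curves are again free of collisions, so their action is at least the
infimum; as the potential hardly changes, the parallelogram identity forces the
velocities to be Cauchy in L^2. The limit of the velocities is the weak
derivative of the uniform limit, and the action passes to the limit. Convexity
of the kinetic term thus gives strong convergence without weak compactness. *)
Lemma direct_method n alpha omega (I0 m M : R) : 0 < alpha -> 0 < m ->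
  (exists y v, [/\ Lambda n y, loop y v & act n alpha omega y v <= I0]) ->
  (forall y v, Lambda n y -> loop y v -> act n alpha omega y v <= I0 ->
     (forall h, (1 <= h < n)%N -> margin (h%:R * tau n) m y) /\
     forall t, cabs (y t) <= M) ->
  exists y v, [/\ Lambda n y, loop y v, act n alpha omega y v <= I0 &
    forall z w, Lambda n z -> loop z w -> act n alpha omega y v <= act n alpha omega z w].
Proof.
move=> a0 m0 [y0 [v0 [Ly0 ly0 Ay0]]] good; have p0 := @pi2_gt0 R.
pose S : set R := [set a | exists y v, [/\ Lambda n y, loop y v, act n alpha omega y v <= I0 & a = act n alpha omega y v]].
have act_ge0 y v : 0 <= act n alpha omega y v.
  rewrite /act addr_ge0 ?mulr_ge0 ?invr_ge0 ?kin_ge0//.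
  by rewrite sumr_ge0// => i _; exact: pot_ge0.
have S_inf : has_inf S.
  split; first by exists (act n alpha omega y0 v0), y0, v0.
  by exists 0 => _ [y [v [_ _ _ ->]]].
pose mI := inf S.
have mI_le y v : Lambda n y -> loop y v -> mI <= act n alpha omega y v.
  move=> Ly ly; have [h|h] := leP (act n alpha omega y v) I0.
    by apply: ge_inf; [case: S_inf|exists y, v].
  apply: ltW; apply: le_lt_trans h; apply: (le_trans _ Ay0).
  by apply: ge_inf; [case: S_inf|exists y0, v0].
have q4_gt0 p : 0 < 4^-1 ^+ p :> R by rewrite exprn_gt0// invr_gt0.
have q4_le1 p : 4^-1 ^+ p <= 1 :> R by rewrite exprn_ile1// ?invr_ge0// invf_le1// ler1n.
have q4_mono p q : (p <= q)%N -> 4^-1 ^+ q <= 4^-1 ^+ p :> R.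
  by move=> pq; rewrite ler_wiXn2l// ?invr_ge0// invf_le1// ler1n.
have ex p : exists yv : (R -> R[i]) * (R -> R[i]), [/\ Lambda n yv.1, loop yv.1 yv.2,
    act n alpha omega yv.1 yv.2 <= I0 & act n alpha omega yv.1 yv.2 <= mI + 4^-1 ^+ p].
  have [_ [y [v [h1 h2 h3 ->]]] h4] := inf_adherent (q4_gt0 p) S_inf.
  by exists (y, v); split=> //=; exact: ltW.
have [Y hY] := choice ex.
pose E0 := 4 * I0 + 2 * omega ^+ 2 * M ^+ 2 * (2 * pi).
have kin_le y v : act n alpha omega y v <= I0 -> kin omega y v <= 2 * I0.
  rewrite /act => h.
  have : 0 <= \sum_(1 <= h < n) pot alpha (h%:R * tau n) y by rewrite sumr_ge0// => i _; exact: pot_ge0.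
  by move: h; lra.
have YE p : en (Y p).2 <= E0.
  have [h1 h2 h3 _] := hY p; have [_ _ h4] := h2.
  rewrite (le_trans (en_le_kin omega h4 (good _ _ h1 h2 h3).2))// /E0 lerD2r.
  by have := kin_le _ _ h3; lra.
pose F (p : nat) (i : bool * R) := if i.1 then Re ((Y p).1 i.2) else Im ((Y p).1 i.2).
have FM p i : `|F p i| <= M.
  have [h1 h2 h3 _] := hY p; have hM := (good _ _ h1 h2 h3).2.
  by rewrite /F; case: i.1; rewrite (le_trans _ (hM i.2))// ?Re_cabs ?Im_cabs.
have FE p b s t : 0 <= s -> s <= t -> t <= 2 * pi -> (F p (b, t) - F p (b, s)) ^+ 2 <= (t - s) * E0.
  move=> s0 st tp; have [_ [_ _ h4] _ _] := hY p; have [k1 k2] := h4.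
  have Le := en_L1 0 (2 * pi) h4.
  have aux (f g : R -> R) : H1_deriv f g -> (forall t, g t ^+ 2 <= Re ((Y p).2 t) ^+ 2 + Im ((Y p).2 t) ^+ 2) ->
      (f t - f s) ^+ 2 <= (t - s) * E0.
    move=> /H1_derivP[_ /(_ 0 (2 * pi)) Hf] hg.
    rewrite (le_trans (H1on_hoelder Hf s0 st tp))// ler_wpM2l ?subr_ge0//.
    apply: le_trans (YE p); have Lg := Hf.1.2.
    rewrite (le_trans (I_sub_le s0 st tp Lg (fun t => sqr_ge0 _)))//.
    by apply: I_le => //.
  rewrite /F; case: b => /=.
    by apply: (aux _ _ k1) => u; rewrite lerDl sqr_ge0.
  by apply: (aux _ _ k2) => u; rewrite lerDr sqr_ge0.
have [f hf] := uniform_cluster p0 FM FE.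
(* z p is within e p of the cluster point; the factor m / 8 keeps midpoints and
   the limit at a distance m / 2 from collisions *)
pose e (p : nat) : R := m / 8 * 4^-1 ^+ p.
have e_gt0 p : 0 < e p by rewrite /e mulr_gt0// divr_gt0.
have ex2 p : exists q, (p <= q)%N /\ forall b t, 0 <= t <= 2 * pi -> `|F q (b, t) - f (b, t)| <= e p.
  by have [q h1 h2] := hf (e p) p (e_gt0 p); exists q.
have [sg hsg] := choice ex2.
pose z p := (Y (sg p)).1; pose w p := (Y (sg p)).2.
have zL p : Lambda n (z p) by have [] := hY (sg p).
have zl p : loop (z p) (w p) by have [] := hY (sg p).
have zA0 p : act n alpha omega (z p) (w p) <= I0 by have [] := hY (sg p).
have zA p : act n alpha omega (z p) (w p) <= mI + 4^-1 ^+ p.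
  have [_ _ _ h] := hY (sg p); rewrite (le_trans h)// lerD2l q4_mono//.
  by have [] := hsg p.
have zc p : ccontinuous (z p) by have [_ _ h] := zl p; exact: H1_cderiv_cont h.
have zm p h : (1 <= h < n)%N -> margin (h%:R * tau n) m (z p).
  exact: (good _ _ (zL p) (zl p) (zA0 p)).1.
pose y t := Complex (f (true, mod2pi t)) (f (false, mod2pi t)).
have yz_comp p t : `|Re (z p t) - Re (y t)| <= e p /\ `|Im (z p t) - Im (y t)| <= e p.
  have /andP[t0 t1] := mod2pi_itv t; have t01 : 0 <= mod2pi t <= 2 * pi by rewrite t0 ltW.
  have [pz _ _] := zl p; have [_ h] := hsg p.
  have := h true _ t01; have := h false _ t01; rewrite /F/=.
  rewrite (@periodic_mod _ (fun t => Re (z p t))); last by move=> u; rewrite pz.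
  by rewrite (@periodic_mod _ (fun t => Im (z p t)))// => u; rewrite pz.
have zy p t : cabs (z p t - y t) <= 2 * e p.
  have [h1 h2] := yz_comp p t; rewrite (le_trans (cabs_le _))// ReB ImB; lra.
have e_le p q : (p <= q)%N -> e q <= e p.
  by move=> pq; rewrite ler_wpM2l ?q4_mono// divr_ge0// ltW.
have zz p q : (p <= q)%N -> forall t, cabs (z q t - z p t) <= 4 * e p.
  move=> pq t; have -> : z q t - z p t = (z q t - y t) + - (z p t - y t) by ring.
  rewrite (le_trans (cabsD _ _))// cabsN; have := zy p t; have := zy q t.
  by have := e_le _ _ pq; lra.
have e8 p : e p <= m / 8 by rewrite /e ler_piMr// divr_ge0// ltW.
have m2 : 0 < m / 2 by rewrite divr_gt0.
have weaken s u : margin s m u -> margin s (m / 2) u.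
  by move=> h t; apply: le_trans (h t); lra.
pose V u := \sum_(1 <= h < n) pot alpha (h%:R * tau n) u.
pose KV := n%:R * (alpha * ipow alpha (m / 2) / (m / 2) * 2 * (2 * pi)).
have KV0 : 0 <= KV.
  by rewrite /KV !mulr_ge0 ?ipow_ge0 ?invr_ge0 ?pi_ge0 ?(ltW m2) ?(ltW a0).
have V_close u1 u2 d : 0 <= d -> ccontinuous u1 -> ccontinuous u2 ->
    (forall h, (1 <= h < n)%N -> margin (h%:R * tau n) (m / 2) u1) ->
    (forall h, (1 <= h < n)%N -> margin (h%:R * tau n) (m / 2) u2) ->
    (forall t, cabs (u1 t - u2 t) <= d) -> V u1 <= V u2 + KV * d.
  move=> d0 c1 c2 k1 k2 hd.
  have h : V u1 <= \sum_(1 <= h < n) (pot alpha (h%:R * tau n) u2 +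
      alpha * ipow alpha (m / 2) / (m / 2) * (2 * d) * (2 * pi)).
    rewrite /V !big_nat; apply: ler_sum => h hn.
    by apply: pot_close => //; [exact: k1|exact: k2].
  rewrite (le_trans h)// big_split/= lerD2l sumr_const_nat -[_ *+ (n - 1)]mulr_natl.
  have -> : KV * d = n%:R * (alpha * ipow alpha (m / 2) / (m / 2) * (2 * d) * (2 * pi)).
    by rewrite /KV; ring.
  rewrite ler_wpM2r ?ler_nat ?leq_subr//.
  by rewrite !mulr_ge0 ?ipow_ge0 ?invr_ge0 ?pi_ge0 ?(ltW m2) ?(ltW a0).
pose C1 := 8 + KV * m.
(* the velocities are Cauchy for the kinetic form, by the parallelogram identity *)
have kin_diff p q : (p <= q)%N ->
    kin omega (comb 1 (-1) (z q) (z p)) (comb 1 (-1) (w q) (w p)) <= C1 * 4^-1 ^+ p.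
  move=> pq; have lm := loop_comb 2^-1 2^-1 (zl q) (zl p).
  have [_ _ hm] := lm.
  pose W := comb 2^-1 2^-1 (z q) (z p); pose W' := comb 2^-1 2^-1 (w q) (w p).
  have Wq t : cabs (z q t - W t) <= 2 * e p.
    have h := @comb_mid_dist (z q) (z p) (4 * e p) _ t; rewrite (le_trans (h _))//.
      by move=> u; rewrite cabsC; exact: zz.
    by lra.
  have Wp t : cabs (z p t - W t) <= 2 * e p.
    have h := @comb_mid_dist (z p) (z q) (4 * e p) (zz p q pq) t.
    have -> : W t = comb 2^-1 2^-1 (z p) (z q) t by rewrite /W /comb; congr Complex; ring.
    by rewrite (le_trans h)//; lra.
  have Wm h : (1 <= h < n)%N -> margin (h%:R * tau n) (m / 2) W.
    move=> hn; have := margin_close Wp (zm p h hn); move=> hh t; apply: le_trans (hh t).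
    by have := e8 p; lra.
  have WL : Lambda n W by exact: margin_Lambda lm Wm.
  have Wc : ccontinuous W by exact: H1_cderiv_cont hm.
  have := mI_le _ _ WL lm; rewrite /act -/(V W) => hA.
  have e2 : 0 <= 2 * e p by rewrite mulr_ge0// ltW.
  have V1 : V W <= V (z q) + KV * (2 * e p).
    by apply: V_close => //; [move=> h hn; apply: weaken; exact: zm|move=> t; rewrite cabsC].
  have V2 : V W <= V (z p) + KV * (2 * e p).
    by apply: V_close => //; [move=> h hn; apply: weaken; exact: zm|move=> t; rewrite cabsC].
  have := kin_mid omega (zl q) (zl p).
  have A1 := zA p; have A2 := zA q; have A3 := q4_mono _ _ pq.
  rewrite /act -/(V (z p)) in A1; rewrite /act -/(V (z q)) in A2.
  have -> : C1 * 4^-1 ^+ p = 8 * 4^-1 ^+ p + 8 * (KV * e p) by rewrite /C1 /e; field.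
  have E : KV * (2 * e p) = 2 * (KV * e p) by ring.
  rewrite E in V1; rewrite E in V2.
  exact: (midpoint_defect hA V1 V2 A1 A2 A3).
pose C2 := 2 * C1 + 2 * omega ^+ 2 * (m / 2) ^+ 2 * (2 * pi).
have sq_le (x y' q : R) : 0 <= x -> x <= y' * q -> 0 <= q -> q <= 1 -> 0 <= y' -> x ^+ 2 <= y' ^+ 2 * q.
  move=> x0 xq q0 q1 y0'; apply: (@le_trans _ _ ((y' * q) ^+ 2)).
    by rewrite ler_pXn2r ?nnegrE// mulr_ge0.
  by rewrite exprMn ler_wpM2l ?sqr_ge0// expr2 ler_piMr.
have en_diff p q : (p <= q)%N -> en (comb 1 (-1) (w q) (w p)) <= C2 * 4^-1 ^+ p.
  move=> pq; have [_ _ hd] := loop_comb 1 (-1) (zl q) (zl p).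
  have hM t : cabs (comb 1 (-1) (z q) (z p) t) <= 4 * e p by rewrite comb_diff; exact: zz.
  rewrite (le_trans (en_le_kin omega hd hM))//.
  have h1 := kin_diff p q pq.
  have h2 : (4 * e p) ^+ 2 <= (m / 2) ^+ 2 * 4^-1 ^+ p.
    have E4 : 4 * e p = m / 2 * 4^-1 ^+ p by rewrite /e; field.
    apply: (sq_le _ _ _ _ _ (ltW (q4_gt0 p)) (q4_le1 p) (ltW m2)); last by rewrite E4.
    by rewrite mulr_ge0// ltW.
  have h3 : omega ^+ 2 * (2 * pi) * (4 * e p) ^+ 2 <= omega ^+ 2 * (2 * pi) * ((m / 2) ^+ 2 * 4^-1 ^+ p).
    by rewrite ler_wpM2l// mulr_ge0 ?sqr_ge0// ltW.
  by rewrite /C2; move: h1 h3; lra.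
have wL2 p : L2 0 (2 * pi) (fun t => Re (w p t)) /\ L2 0 (2 * pi) (fun t => Im (w p t)).
  by have [_ _ [h1 h2]] := zl p; split; [exact: L2_deriv h1|exact: L2_deriv h2].
have compl (c : R[i] -> R) : (forall u : R[i], c u ^+ 2 <= Re u ^+ 2 + Im u ^+ 2) ->
    (forall u1 u2 : R[i], c (u1 - u2) = c u1 - c u2) -> (forall p, L2 0 (2 * pi) (fun t => c (w p t))) ->
    exists2 G, L2 0 (2 * pi) G & forall p, I 0 (2 * pi) (fun t => (G t - c (w p t)) ^+ 2) <= C2 * 4^-1 ^+ p.
  move=> cle cB cL; apply: L2_complete => //; first exact: ltW.
  move=> p q pq; apply: le_trans (en_diff p q pq).
  have [_ _ hd] := loop_comb 1 (-1) (zl q) (zl p).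
  apply: I_le; [|exact: en_L1 hd|].
    by have [] : L2 0 (2 * pi) (fun t => c (w q t) - c (w p t)) by exact: L2B.
  by move=> t _; rewrite comb_diff -cB.
have [G1 LG1 hG1] : exists2 G, L2 0 (2 * pi) G & forall p, I 0 (2 * pi) (fun t => (G t - Re (w p t)) ^+ 2) <= C2 * 4^-1 ^+ p.
  by apply: compl => [u|u1 u2|p]; [rewrite lerDl sqr_ge0|rewrite ReB|case: (wL2 p)].
have [G2 LG2 hG2] : exists2 G, L2 0 (2 * pi) G & forall p, I 0 (2 * pi) (fun t => (G t - Im (w p t)) ^+ 2) <= C2 * 4^-1 ^+ p.
  by apply: compl => [u|u1 u2|p]; [rewrite lerDr sqr_ge0|rewrite ImB|case: (wL2 p)].
have H1 : H1on 0 (2 * pi) (fun t => Re (y t)) G1.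
  apply: (@limit_weak_derivative _ _ (m / 8) C2 (fun p t => Re (z p t)) (fun p t => Re (w p t))) => //.
  - exact: ltW.
  - by move=> p; have [_ _ [h _]] := zl p; apply: ((H1_derivP _ _).1 h).2.
  - by move=> p t _; case: (yz_comp p t).
have H2 : H1on 0 (2 * pi) (fun t => Im (y t)) G2.
  apply: (@limit_weak_derivative _ _ (m / 8) C2 (fun p t => Im (z p t)) (fun p t => Im (w p t))) => //.
  - exact: ltW.
  - by move=> p; have [_ _ [_ h]] := zl p; apply: ((H1_derivP _ _).1 h).2.
  - by move=> p t _; case: (yz_comp p t).
have py t : y (t + 2 * pi) = y t by rewrite /y mod2piD.
have [v ly vG] := loop_of_interval py H1 H2.
have [_ _ hy] := ly; have yc := H1_cderiv_cont hy.
have ym h : (1 <= h < n)%N -> margin (h%:R * tau n) (m / 2) y.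
  move=> hn; have := margin_close (zy 0%N) (zm 0%N h hn); move=> hh t; apply: le_trans (hh t).
  by have := e8 0%N; lra.
have yL : Lambda n y by exact: margin_Lambda ly ym.
pose C3 := 4 * C2 * 2 + 2 * omega ^+ 2 * (m / 4) ^+ 2 * (2 * pi).
have C1_0 : 0 <= C1 by rewrite /C1 addr_ge0// mulr_ge0// ltW.
have C2_0 : 0 <= C2 by exact: addr_ge0 (mulr_ge0 (ler0n _ 2) C1_0) (mul_sqr_pi_ge0 _ _).
have C3_0 : 0 <= C3 by exact: addr_ge0 (mulr_ge0 (mulr_ge0 (ler0n _ 4) C2_0) (ler0n _ 2)) (mul_sqr_pi_ge0 _ _).
have en_y p : en (comb 1 (-1) v (w p)) <= 2 * C2 * 4^-1 ^+ p.
  have l1 : L1 0 (2 * pi) (fun t => (G1 t - Re (w p t)) ^+ 2) by case: (L2B LG1 (wL2 p).1).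
  have l2 : L1 0 (2 * pi) (fun t => (G2 t - Im (w p t)) ^+ 2) by case: (L2B LG2 (wL2 p).2).
  have [_ _ hd] := loop_comb 1 (-1) ly (zl p).
  have -> : en (comb 1 (-1) v (w p)) =
     I 0 (2 * pi) (fun t => (G1 t - Re (w p t)) ^+ 2 + (G2 t - Im (w p t)) ^+ 2).
    apply: I_eq_co; [|exact: en_L1 hd|exact: L1D].
    by move=> t ht; rewrite /comb/= vG//=; ring.
  by rewrite ID//; have := hG1 p; have := hG2 p; lra.
have kin_y p : kin omega (comb 1 (-1) y (z p)) (comb 1 (-1) v (w p)) <= C3 * 4^-1 ^+ p.
  have [_ _ hd] := loop_comb 1 (-1) ly (zl p).
  have hM t : cabs (comb 1 (-1) y (z p) t) <= 2 * e p by rewrite comb_diff cabsC; exact: zy.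
  rewrite (le_trans (kin_le_en omega hd hM))//.
  have h1 := en_y p.
  have h2 : (2 * e p) ^+ 2 <= (m / 4) ^+ 2 * 4^-1 ^+ p.
    have E2 : 2 * e p = m / 4 * 4^-1 ^+ p by rewrite /e; field.
    have m4 : 0 <= m / 4 by rewrite divr_ge0// ltW.
    apply: (sq_le _ _ _ _ _ (ltW (q4_gt0 p)) (q4_le1 p) m4); last by rewrite E2.
    by rewrite mulr_ge0// ltW.
  have h3 : omega ^+ 2 * (2 * pi) * (2 * e p) ^+ 2 <= omega ^+ 2 * (2 * pi) * ((m / 4) ^+ 2 * 4^-1 ^+ p).
    by rewrite ler_wpM2l// mulr_ge0 ?sqr_ge0// ltW.
  have h4 : 0 <= C2 * 4^-1 ^+ p by rewrite mulr_ge0// ltW.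
  by rewrite /C3; move: h1 h3 h4; lra.
(* the limit attains the infimum: kin_perturb is used with th = 2^(-p), which is
   large compared with the error 4^(-p) in the velocities *)
have Ay : act n alpha omega y v <= mI.
  rewrite -subr_le0; apply: (@le_geometric _ _ (1 + I0 + C3 + KV * m)) => p.
  set r := 2^-1 ^+ p; have r0 : 0 < r by rewrite exprn_gt0// invr_gt0.
  have r1 : r <= 1 by rewrite exprn_ile1// ?invr_ge0// invf_le1// ler1n.
  have q2 : 4^-1 ^+ p = r ^+ 2.
    by rewrite /r -exprM mulnC exprM; congr (_ ^+ _); field.
  have K1 := kin_perturb omega r0 ly (zl p).
  have K2 := kin_y p; have K3 := kin_le _ _ (zA0 p).
  have V1 : V y <= V (z p) + KV * (2 * e p).
    apply: V_close => //; first by rewrite mulr_ge0// ltW.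
      by move=> h hn; apply: weaken; exact: zm.
    by move=> t; rewrite cabsC.
  have A1 := zA p; rewrite /act -/(V (z p)) in A1; rewrite /act -/(V y).
  have K4 : (1 + r^-1) * kin omega (comb 1 (-1) y (z p)) (comb 1 (-1) v (w p)) <= 2 * C3 * r.
    rewrite (@le_trans _ _ ((1 + r^-1) * (C3 * 4^-1 ^+ p)))//.
      by rewrite ler_wpM2l// addr_ge0// invr_ge0 ltW.
    have -> : (1 + r^-1) * (C3 * 4^-1 ^+ p) = C3 * r * (r + 1).
      by rewrite q2; field; rewrite gt_eqF.
    have : 0 <= C3 * r by rewrite mulr_ge0// ltW.
    by nra.
  have K5 : (1 + r) * kin omega (z p) (w p) <= kin omega (z p) (w p) + 2 * I0 * r.
    by rewrite mulrDl mul1r lerD2l mulrC ler_wpM2r// ltW.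
  have q3 : 4^-1 ^+ p <= r by rewrite q2 expr2 ler_piMl// ltW.
  have V2 : KV * (2 * e p) <= KV * m * r.
    rewrite -mulrA ler_wpM2l// /e.
    have : m * 4^-1 ^+ p <= m * r by rewrite ler_wpM2l// ltW.
    have : 0 <= m * 4^-1 ^+ p by rewrite mulr_ge0// ltW.
    by lra.
  have Kr : 0 <= KV * m * r by exact: mulr_ge0 (mulr_ge0 KV0 (ltW m0)) (ltW r0).
  exact: (limit_defect K1 K4 K5 V1 V2 A1 q3 Kr).
have AyI0 : act n alpha omega y v <= I0.
  exact: (le_trans Ay (le_trans (mI_le _ _ Ly0 ly0) Ay0)).
exists y, v; split; [exact: yL|exact: ly|exact: AyI0|].
move=> z' w' Lz lz; exact: (le_trans Ay (mI_le _ _ Lz lz)).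
Qed.
End Existence.

(** * Rotating frames *)

Section Rotation.
Context {R : realType}.
Implicit Types (y v z w : R -> R[i]) (alpha omega s t x : R) (m : int).
Notation Re := complex.Re.
Notation Im := complex.Im.

Lemma expiD (a b : R) : expi (a + b) = expi a * expi b.
Proof.
apply: complex_ext; rewrite ?ReM ?ImM /expi/= ?cosD ?sinD//.
by rewrite addrC.
Qed.

Lemma expi0 : expi 0 = 1 :> R[i].
Proof. by rewrite /expi cos0 sin0. Qed.

Lemma cabs_expi (a : R) : cabs (expi a) = 1.
Proof. by rewrite cabsE /expi/= cos2Dsin2 sqrtr1. Qed.

Lemma expiNr (a : R) : expi (- a) * expi a = 1.
Proof. by rewrite -expiD addNr expi0. Qed.

Lemma cos_2pi_int m (x : R) : cos (x + 2 * pi * m%:~R) = cos x.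
Proof.
by apply: periodic_int => t; rewrite mulr_natl cosD2pi.
Qed.

Lemma sin_2pi_int m (x : R) : sin (x + 2 * pi * m%:~R) = sin x.
Proof.
by apply: periodic_int => t; rewrite mulr_natl sinD2pi.
Qed.

Lemma expi_2pi_int m (x : R) : expi (x + 2 * pi * m%:~R) = expi x.
Proof. by rewrite /expi cos_2pi_int sin_2pi_int. Qed.

Lemma expi_neq1 (x : R) : 0 < x < 2 * pi -> expi x != 1.
Proof.
move=> /andP[x0 x2]; apply/eqP => /(congr1 (@complex.Re R))/=.
have -> : x = (x / 2) *+ 2 by rewrite mulr2n; field.
rewrite cos_mulr2n cos2sin2 => h.
have : 0 < sin (x / 2) by apply: sin_gt0_pi; apply/andP; split; lra.
move=> s0; have : 0 < sin (x / 2) ^+ 2 by rewrite exprn_gt0.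
by move: h; rewrite -mulr_natl; lra.
Qed.

(** The curve seen from a frame rotating with angular velocity - m; drot is its
velocity. *)
Definition rot m y t := expi (m%:~R * t) * y t.
Definition drot m y v t := expi (m%:~R * t) * (v t + Complex 0 m%:~R * y t).

Lemma H1on_cosk (k a b : R) : H1on a b (fun t => cos (k * t)) (fun t => - k * sin (k * t)).
Proof.
apply: H1on_C1.
  apply: continuous_subspaceT => t; apply: cvgM; first exact: cvg_cst.
  apply: (@continuous_comp _ _ _ (fun t => k * t) sin); last exact: continuous_sin.
  by apply: cvgM; [exact: cvg_cst|exact: cvg_id].
move=> t _; have := @is_derive_affine R cos (- sin (k * t + 0)) k 0 t (is_derive_cos _).
under eq_fun do rewrite addr0.
by move=> h; apply: is_derive_eq h _; rewrite addr0; ring.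
Qed.

Lemma H1on_sink (k a b : R) : H1on a b (fun t => sin (k * t)) (fun t => k * cos (k * t)).
Proof.
apply: H1on_C1.
  apply: continuous_subspaceT => t; apply: cvgM; first exact: cvg_cst.
  apply: (@continuous_comp _ _ _ (fun t => k * t) cos); last exact: continuous_cos.
  by apply: cvgM; [exact: cvg_cst|exact: cvg_id].
move=> t _; have := @is_derive_affine R sin (cos (k * t + 0)) k 0 t (is_derive_sin _).
under eq_fun do rewrite addr0.
by move=> h; apply: is_derive_eq h _; rewrite addr0.
Qed.

Lemma L2_measurable (g : R -> R) : (forall a b, L2 a b g) -> measurable_fun setT g.
Proof.
move=> h; rewrite (_ : setT = \bigcup_(i : nat) [set` `[- i%:R, i%:R]] :> set R).
  apply/measurable_fun_bigcup => [i|i]; first exact: measurable_cc.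
  by case: (h (- i%:R) i%:R).
apply/seteqP; split=> // x _; exists (Num.truncn `|x|).+1 => //=.
by rewrite in_itv/= -ler_norml ltW// truncnS_gt.
Qed.

Lemma H1_deriv_on (f g : R -> R) : (forall a b, H1on a b f g) -> H1_deriv f g.
Proof. by move=> h; apply/H1_derivP; split=> //; apply: L2_measurable => a b; case: (h a b). Qed.

Lemma loop_rot m y v : loop y v -> loop (rot m y) (drot m y v).
Proof.
move=> [py pv [h1 h2]].
have pe t : expi (m%:~R * (t + 2 * pi)) = expi (m%:~R * t) :> R[i].
  by rewrite mulrDr [m%:~R * (2 * pi)]mulrC expi_2pi_int.
split; [by move=> t; rewrite /rot pe py|by move=> t; rewrite /drot pe py pv|].
have [_ k1] := (H1_derivP _ _).1 h1; have [_ k2] := (H1_derivP _ _).1 h2.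
split; apply: H1_deriv_on => a b.
  have c1 := H1onM (H1on_cosk m%:~R a b) (k1 a b).
  have s2 := H1onM (H1on_sink m%:~R a b) (k2 a b).
  apply: eq_H1on (H1onB c1 s2) => t _; rewrite /rot /drot !ReM ?ReD ?ImD ?ReM ?ImM/=; ring.
have c1 := H1onM (H1on_cosk m%:~R a b) (k2 a b).
have s2 := H1onM (H1on_sink m%:~R a b) (k1 a b).
apply: eq_H1on (H1onD c1 s2) => t _; rewrite /rot /drot !ImM ?ReD ?ImD ?ReM ?ImM/=; ring.
Qed.

(** A uniform rotation of the frame shifts the angular velocity in the Coriolis
form of the kinetic term. As m is an integer, periodicity is preserved. *)
Lemma kin_rot m omega y v : kin omega y v = kin (omega - m%:~R) (rot m y) (drot m y v).
Proof.
apply: I_eq => t _; rewrite /rot /drot !ReM !ImM !ReD !ImD !ReM !ImM/=.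
set c := cos _; set s := sin _; set a := Re (v t); set b := Im (v t).
set y1 := Re (y t); set y2 := Im (y t); set q : R := m%:~R.
have cs : c ^+ 2 + s ^+ 2 = 1 by exact: cos2Dsin2.
transitivity ((c ^+ 2 + s ^+ 2) * ((a - omega * y2) ^+ 2 + (b + omega * y1) ^+ 2)).
  by rewrite cs mul1r.
by ring.
Qed.

Lemma gap_rot m y t s : cabs (y t - y (t + s)) =
  cabs (rot m y t - expi (- (m%:~R * s)) * rot m y (t + s)).
Proof.
rewrite /rot mulrA -expiD (_ : - (m%:~R * s) + m%:~R * (t + s) = m%:~R * t); last by ring.
by rewrite -mulrBr cabsM cabs_expi mul1r.
Qed.

Lemma rotK m y t : rot m (rot (- m) y) t = y t.
Proof.
rewrite /rot mulrA -expiD (_ : _ + _ = 0); last by rewrite mulrNz; ring.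
by rewrite expi0 mul1r.
Qed.

Lemma cabs_rot m y t : cabs (rot m y t) = cabs (y t).
Proof. by rewrite /rot cabsM cabs_expi mul1r. Qed.

(** Bodies whose labels differ by such an h are in the same cluster: k h tau is
a multiple of 2 pi. *)
Lemma expi_tau n k h : (0 < n)%N -> (n %| k * h)%N ->
  expi (- (k%:Z%:~R * (h%:R * tau n))) = 1 :> R[i].
Proof.
move=> n0 /dvdnP[q kh].
have -> : - (k%:Z%:~R * (h%:R * tau n)) = 0 + 2 * pi * (- q%:Z)%:~R :> R.
  rewrite add0r mulrNz mulrN -!pmulrn /tau.
  have -> : k%:R * (h%:R * (2 * pi / n%:R)) = (k * h)%N%:R * (2 * pi) / n%:R :> R.
    by rewrite natrM; ring.
  by rewrite kh natrM; congr (- _); field; rewrite pnatr_eq0 -lt0n.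
by rewrite expi_2pi_int expi0.
Qed.

Lemma expi_tau_neq1 n k h : (0 < n)%N -> ~~ (n %| k * h)%N ->
  expi (- (k%:Z%:~R * (h%:R * tau n))) != 1 :> R[i].
Proof.
move=> n0 nd; apply/eqP => h1.
have : expi ((k * h %% n)%N%:R * tau n) = 1 :> R[i].
  have -> : (k * h %% n)%N%:R * tau n =
     k%:Z%:~R * (h%:R * tau n) + 2 * pi * (- (k * h %/ n)%N%:Z)%:~R :> R.
    rewrite mulrNz mulrN -!pmulrn /tau.
    have e : k%:R * h%:R = (k * h %/ n)%N%:R * n%:R + (k * h %% n)%N%:R :> R.
      by rewrite -!natrM -natrD -divn_eq.
    have -> : k%:R * (h%:R * (2 * pi / n%:R)) = (k%:R * h%:R) * (2 * pi / n%:R) :> R by ring.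
    by rewrite e; field; rewrite pnatr_eq0 -lt0n.
  by rewrite expi_2pi_int -[LHS]mul1r -h1 expiNr.
apply/eqP; apply: expi_neq1; have p0 := @pi2_gt0 R.
have nR : 0 < n%:R :> R by rewrite ltr0n.
apply/andP; split; first by rewrite mulr_gt0 ?divr_gt0// ltr0n lt0n.
by rewrite /tau mulrA ltr_pdivrMr// mulrC ltr_pM2l// ltr_nat ltn_mod.
Qed.

End Rotation.

(** * Lower bounds for the kinetic and potential terms *)

Section Lower_bound.
Context {R : realType}.
Implicit Types (y v u p : R -> R[i]) (alpha omega s t x rho r : R).
Notation Re := complex.Re.
Notation Im := complex.Im.

Lemma ipowM alpha x x' : 0 < x -> 0 < x' -> ipow alpha (x * x') = ipow alpha x * ipow alpha x'.
Proof. by move=> x0 x'0; rewrite /ipow powRM ?(ltW x0) ?(ltW x'0)// invfM. Qed.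

(** The equation amounts to r^(alpha + 2) = alpha S / 2: the radius at which
attraction and centrifugal force balance. *)
Lemma exists_radius alpha (S : R) : 0 < alpha -> 0 < S ->
  exists2 r, 0 < r & alpha / 2 * ipow alpha r * S = r ^+ 2.
Proof.
move=> a0 S0; pose A := alpha / 2 * S.
have A0 : 0 < A by rewrite mulr_gt0// divr_gt0.
pose r := A `^ (alpha + 2)^-1; have r0 : 0 < r by rewrite powR_gt0.
exists r => //.
have rA : r `^ alpha * r ^+ 2 = A.
  rewrite -powR_mulrn ?(ltW r0)// -powRD; last by rewrite (gt_eqF r0) implybT.
  by rewrite /r -powRrM mulVf ?powRr1 ?(ltW A0)// gt_eqF// addr_gt0.
rewrite /ipow mulrAC -/A -rA mulrAC mulfV ?mul1r// gt_eqF// powR_gt0//.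
Qed.

Lemma loop_components u p : loop u p ->
  [/\ periodic2pi (fun t => Re (u t)), periodic2pi (fun t => Im (u t)),
      periodic2pi (fun t => Re (p t)), periodic2pi (fun t => Im (p t)) &
      forall a b, H1on a b (fun t => Re (u t)) (fun t => Re (p t)) /\
                  H1on a b (fun t => Im (u t)) (fun t => Im (p t))].
Proof.
move=> [pu pp [h1 h2]]; split; try by move=> t; rewrite ?pu ?pp.
by move=> a b; split; [exact: ((H1_derivP _ _).1 h1).2|exact: ((H1_derivP _ _).1 h2).2].
Qed.

(** The range [0, 4 pi] covers t and t + s for t and s within one period; the
energy over two periods accounts for the factor 2. *)
Lemma loop_hoelder u p a b : loop u p -> 0 <= a -> a <= b -> b <= 4 * pi ->
  cabs (u b - u a) ^+ 2 <= (b - a) * (2 * en p).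
Proof.
move=> lu a0 ab b4; have p0 := @pi2_gt0 R.
have [_ pp2 hu] := lu.
have [P1 P2 P3 P4 Hon] := loop_components lu; have [H1 H2] := Hon 0 (4 * pi).
rewrite cabs_sqr ReB ImB (le_trans (lerD (H1on_hoelder H1 a0 ab b4) (H1on_hoelder H2 a0 ab b4)))//.
rewrite -mulrDr ler_wpM2l ?subr_ge0//.
pose F t := Re (p t) ^+ 2 + Im (p t) ^+ 2.
have LF c d : L1 c d F by exact: en_L1 hu.
rewrite -ID; [|apply: L1_sub a0 b4 H1.1.2|apply: L1_sub a0 b4 H2.1.2].
rewrite (le_trans (I_sub_le a0 ab b4 (LF _ _) _))//; first by move=> t; rewrite addr_ge0 ?sqr_ge0.
have p4 : 2 * pi <= 4 * pi :> R by have := @pi_ge0 R; lra.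
rewrite (I_split (ltW p0) p4 (LF _ _)).
have -> : 4 * pi = 2 * pi + 2 * pi :> R by ring.
rewrite (@I_periodic _ (2 * pi) F)//; [|by move=> t; rewrite /F pp2|by rewrite (ltW p0) lexx].
by rewrite -[I 0 (2 * pi) F]/(en p); lra.
Qed.

Lemma loop_osc u p t : loop u p -> cabs (u t - u 0) ^+ 2 <= 2 * pi * en p.
Proof.
move=> lu; have p0 := @pi2_gt0 R; have [pu _ hu] := lu.
have [P1 P2 _ _ Hon] := loop_components lu; have [H1 H2] := Hon 0 (2 * pi).
have um : u t = u (mod2pi t).
  apply: complex_ext; first by rewrite -(periodic_mod t P1).
  by rewrite -(periodic_mod t P2).
have /andP[m0 m1] := mod2pi_itv t; rewrite um cabs_sqr ReB ImB.
have h0 : 0 <= 0 :> R by [].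
rewrite (le_trans (lerD (H1on_hoelder H1 h0 m0 (ltW m1)) (H1on_hoelder H2 h0 m0 (ltW m1))))//.
have L1a := H1.1.2; have L1b := H2.1.2.
rewrite subr0 -mulrDr ler_pM//.
- by rewrite addr_ge0// I_ge0// => x _; exact: sqr_ge0.
- exact: ltW.
rewrite -ID; [|exact: (L1_sub h0 (ltW m1) L1a)|exact: (L1_sub h0 (ltW m1) L1b)].
apply: I_sub_le => //; [exact: ltW|exact: en_L1 hu|].
by move=> x; rewrite addr_ge0 ?sqr_ge0.
Qed.

Definition mass u := I 0 (2 * pi) (fun t => cabs (u t) ^+ 2).

Lemma en_ge0 p : 0 <= en p.
Proof. by apply: I_ge0 => t _; rewrite addr_ge0 ?sqr_ge0. Qed.

Lemma mass_ge0 u : 0 <= mass u.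
Proof. by apply: I_ge0 => t _; exact: sqr_ge0. Qed.

Lemma L1_mass u a b : ccontinuous u -> L1 a b (fun t => cabs (u t) ^+ 2).
Proof. by move=> cu; apply: L1_continuous; apply: continuous_sqr; exact: continuous_cabs. Qed.

(** In the cross term 2 delta (Im p Re u - Re p Im u) of |p + i delta u|^2 one
may replace u by u - u(0), because p has mean 0; and the oscillation of u is
controlled by its energy. *)
Lemma rotating_kinetic (delta : R) u p : loop u p ->
  (1 - `|delta| * (1 + (2 * pi) ^+ 2)) * en p + delta ^+ 2 * mass u <= kin delta u p.
Proof.
move=> lu; have p0 := @pi2_gt0 R; have [pu _ hu] := lu.
have [P1 P2 _ _ Hon] := loop_components lu; have [H1 H2] := Hon 0 (2 * pi).
have cu := H1_cderiv_cont hu.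
pose d : R := `|delta|; rewrite -/d; pose c1 := Re (u 0); pose c2 := Im (u 0).
have Ip1 : I 0 (2 * pi) (fun t => Re (p t)) = 0.
  by rewrite -(H1.2 0 (2 * pi) (lexx _) (ltW p0) (lexx _)); have := P1 0; rewrite add0r => ->; rewrite subrr.
have Ip2 : I 0 (2 * pi) (fun t => Im (p t)) = 0.
  by rewrite -(H2.2 0 (2 * pi) (lexx _) (ltW p0) (lexx _)); have := P2 0; rewrite add0r => ->; rewrite subrr.
have L1a := L1Z (1 - d) (en_L1 0 (2 * pi) hu).
have L1b := L1_cst 0 (2 * pi) (- (d * (2 * pi * en p))).
have L1c := L1Z (2 * delta * c1) (L2_L1 H2.1).
have L1d := L1Z (- (2 * delta * c2)) (L2_L1 H1.1).
have L1e := L1Z (delta ^+ 2) (L1_mass 0 (2 * pi) cu).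
have -> : (1 - d * (1 + (2 * pi) ^+ 2)) * en p + delta ^+ 2 * mass u =
  I 0 (2 * pi) (fun t => (1 - d) * (Re (p t) ^+ 2 + Im (p t) ^+ 2) + - (d * (2 * pi * en p))
   + 2 * delta * c1 * Im (p t) + - (2 * delta * c2) * Re (p t) + delta ^+ 2 * cabs (u t) ^+ 2).
  rewrite ID; [|by do !apply: L1D|exact: L1e].
  rewrite ID; [|by do !apply: L1D|exact: L1d].
  rewrite ID; [|by do !apply: L1D|exact: L1c].
  rewrite ID; [|exact: L1a|exact: L1b].
  rewrite I_cst_period (IZ _ (en_L1 0 (2 * pi) hu)) (IZ _ (L2_L1 H2.1)) (IZ _ (L2_L1 H1.1)) (IZ _ (L1_mass 0 (2 * pi) cu)).
  by rewrite Ip1 Ip2 -/(en p) -/(mass u); ring.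
apply: I_le; [by do !apply: L1D|exact: kin_L1|].
move=> t _; have osc := loop_osc t lu; rewrite cabs_sqr ReB ImB -/c1 -/c2 in osc.
rewrite cabs_sqr; move: osc; set a := Re (p t); set b := Im (p t).
set u1 := Re (u t); set u2 := Im (u t); set E := 2 * pi * en p => osc.
have d0 : 0 <= d by exact: normr_ge0.
have key : 0 <= d * (a ^+ 2 + b ^+ 2 + (u1 - c1) ^+ 2 + (u2 - c2) ^+ 2)
    + 2 * delta * (b * (u1 - c1) - a * (u2 - c2)).
  rewrite /d; have [dp|dn] := ler0P delta.
    have -> : - delta * (a ^+ 2 + b ^+ 2 + (u1 - c1) ^+ 2 + (u2 - c2) ^+ 2)
    + 2 * delta * (b * (u1 - c1) - a * (u2 - c2)) =
    - delta * ((b - (u1 - c1)) ^+ 2 + (a + (u2 - c2)) ^+ 2) by ring.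
    by rewrite mulr_ge0 ?oppr_ge0// addr_ge0 ?sqr_ge0.
  have -> : delta * (a ^+ 2 + b ^+ 2 + (u1 - c1) ^+ 2 + (u2 - c2) ^+ 2)
    + 2 * delta * (b * (u1 - c1) - a * (u2 - c2)) =
    delta * ((b + (u1 - c1)) ^+ 2 + (a - (u2 - c2)) ^+ 2) by ring.
  by rewrite mulr_ge0 ?(ltW dn)// addr_ge0 ?sqr_ge0.
have h : d * ((u1 - c1) ^+ 2 + (u2 - c2) ^+ 2) <= d * E by rewrite ler_wpM2l.
rewrite -subr_ge0 -/E.
have -> : (a - delta * u2) ^+ 2 + (b + delta * u1) ^+ 2 - ((1 - d) * (a ^+ 2 + b ^+ 2) +
    - (d * E) + 2 * delta * c1 * b + - (2 * delta * c2) * a + delta ^+ 2 * (u1 ^+ 2 + u2 ^+ 2)) =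
   (d * (a ^+ 2 + b ^+ 2 + (u1 - c1) ^+ 2 + (u2 - c2) ^+ 2) +
    2 * delta * (b * (u1 - c1) - a * (u2 - c2))) +
   (d * E - d * ((u1 - c1) ^+ 2 + (u2 - c2) ^+ 2)) by ring.
by rewrite addr_ge0// subr_ge0.
Qed.

Lemma gap_energy u p s : loop u p -> 0 <= s <= 2 * pi ->
  I 0 (2 * pi) (fun t => cabs (u t - u (t + s)) ^+ 2) <= (2 * sin (s / 2)) ^+ 2 * en p.
Proof.
move=> lu hs; have [P1 P2 P3 P4 _] := loop_components lu; have [_ _ hu] := lu; have [h1 h2] := hu.
have [c1 c2] := H1_cderiv_cont hu.
have := lerD (shift_gap_le P1 P3 h1 hs) (shift_gap_le P2 P4 h2 hs).
rewrite -mulrDr /shift_gap -ID; last 2 first.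
- by apply: L1_continuous; apply: continuous_sqr; exact: (continuous_gap s c1).
- by apply: L1_continuous; apply: continuous_sqr; exact: (continuous_gap s c2).
rewrite -ID; [|by case: (L2_deriv 0 (2 * pi) h1)|by case: (L2_deriv 0 (2 * pi) h2)].
rewrite -/(en p) (_ : 4 * sin (s / 2) ^+ 2 = (2 * sin (s / 2)) ^+ 2); last by ring.
apply: le_trans; rewrite le_eqVlt; apply/orP; left; apply/eqP.
by apply: I_eq => t _; rewrite cabs_sqr ReB ImB; ring.
Qed.

(** The mean square deviation from rho of the distance between u and its
translate, relative to rho. *)
Definition defect s rho u := I 0 (2 * pi) (fun t => (1 - cabs (u t - u (t + s)) / rho) ^+ 2).

Lemma defect_ge0 s rho u : 0 <= defect s rho u.
Proof. by apply: I_ge0 => t _; exact: sqr_ge0. Qed.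

(** The tangent line of x^(-alpha) at rho, where x / rho - 1 is written as half
of (x / rho)^2 - 1 minus half of (1 - x / rho)^2: the first square is controlled
by the energy, and the second is a gain. *)
Lemma pot_lower alpha s rho u : 0 < alpha -> 0 < rho -> ccontinuous u ->
  (forall t, u t != u (t + s)) ->
  ipow alpha rho * ((1 + alpha / 2) * (2 * pi) -
     alpha / 2 / rho ^+ 2 * I 0 (2 * pi) (fun t => cabs (u t - u (t + s)) ^+ 2) +
     alpha / 2 * defect s rho u) <= pot alpha s u.
Proof.
move=> a0 r0 cu nu; have p0 := @pi2_gt0 R.
have cd := continuous_cabs (ccontinuous_gap s cu).
have L1a := L1_continuous 0 (2 * pi) (continuous_sqr cd).
have c2 : continuous (fun t => 1 - cabs (u t - u (t + s)) / rho).
  by move=> t; apply: cvgB; [exact: cvg_cst|apply: cvgM; [exact: cd|exact: cvg_cst]].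
have L1b := L1_continuous 0 (2 * pi) (continuous_sqr c2).
have L1c := L1_cst 0 (2 * pi) (1 + alpha / 2).
rewrite -(I_cst_period (1 + alpha / 2)) /defect -!IZ//.
rewrite -IB//; last exact: L1Z.
rewrite -ID; [|by apply: L1B => //; exact: L1Z|exact: L1Z].
rewrite -IZ; last by apply: L1D; [apply: L1B => //; exact: L1Z|exact: L1Z].
apply: I_le; [|exact: pot_L1|].
  by apply: L1Z; apply: L1D; [apply: L1B => //; exact: L1Z|exact: L1Z].
move=> t _; have d0 : 0 < cabs (u t - u (t + s)) by rewrite cabs_gt0 subr_eq0.
apply: le_trans (ipow_tangent a0 d0 r0).
rewrite le_eqVlt; apply/orP; left; apply/eqP; congr (_ * _); field; rewrite gt_eqF//.
Qed.

End Lower_bound.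

(** * The limit problem *)

Section Limit_problem.
Context {R : realType}.
Implicit Types (y v u p : R -> R[i]) (alpha omega s t x rho r : R).

(** The distance between points of the unit circle at angle h tau. *)
Definition chord (n h : nat) : R := 2 * sin (h%:R * tau n / 2).

Lemma tau_gt0 n : (0 < n)%N -> 0 < (tau n : R).
Proof. by move=> n0; rewrite divr_gt0 ?pi2_gt0// ltr0n. Qed.

Lemma tau_lt n h : (1 <= h < n)%N -> 0 < h%:R * (tau n : R) < 2 * pi.
Proof.
move=> /andP[h0 hn]; have n0 : (0 < n)%N by exact: leq_trans hn.
have p0 := @pi2_gt0 R.
rewrite mulr_gt0 ?tau_gt0 ?ltr0n//= /tau mulrA ltr_pdivrMr ?ltr0n//.
by rewrite mulrC ltr_pM2l// ltr_nat.
Qed.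

Lemma chord_gt0 n h : (1 <= h < n)%N -> 0 < chord n h.
Proof.
move=> /tau_lt/andP[h0 h1]; rewrite mulr_gt0// sin_gt0_pi//.
by apply/andP; split; lra.
Qed.

Lemma fin_min n (c : nat -> R) : (forall h, (1 <= h < n)%N -> 0 < c h) ->
  exists2 m, 0 < m & forall h, (1 <= h < n)%N -> m <= c h.
Proof.
elim: n => [|n IHn] hc; first by exists 1 => // h /andP[].
have [h hh|m m0 hm] := IHn.
  by apply: hc; case/andP: hh => -> /ltnW.
have [n0|n0] := posnP n.
  by exists 1 => // h; rewrite n0; case: h => [|[]].
have cn : 0 < c n by apply: hc; rewrite n0 ltnSn.
exists (Num.min m (c n)); first by rewrite lt_min m0.
move=> h /andP[h0]; rewrite ltnS leq_eqVlt => /predU1P[->|hn].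
  by rewrite ge_min lexx orbT.
by rewrite ge_min hm// h0.
Qed.

(** Two bodies in different clusters are at least ka times the size of u apart,
up to the oscillation of u. *)
Lemma phase_gap n k : (0 < n)%N -> exists2 ka : R, 0 < ka & forall h, (1 <= h < n)%N ->
  ~~ (n %| k * h)%N -> ka <= cabs (1 - expi (- (k%:Z%:~R * (h%:R * tau n)))).
Proof.
move=> n0; pose d h := cabs (1 - expi (- (k%:Z%:~R * (h%:R * tau n)))) : R.
have [h hn|ka ka0 hka] := @fin_min n (fun h => if (n %| k * h)%N then 1 else d h).
  by case: ifPn => // kh; rewrite /d cabs_gt0 subr_eq0 eq_sym expi_tau_neq1.
by exists ka => // h hn kh; have := hka h hn; rewrite (negbTE kh).
Qed.

(** The indices h with n | k h are the differences of labels of bodies in one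
cluster. *)
Definition cluster_sum n k alpha : R := \sum_(1 <= h < n | (n %| k * h)%N) ipow alpha (chord n h).

(** The value, for the circular motion of radius r, of half the energy plus half
the potentials of the shifts h with n | k h. *)
Definition limit_action n k alpha r := pi * (ipow alpha r * cluster_sum n k alpha + r ^+ 2).

(** The constant of the loss of kinetic energy in rotating_kinetic, per unit of
|delta|. *)
Definition kin_loss : R := 1 + (2 * pi) ^+ 2.

Lemma cluster_gap n k h y t : (0 < n)%N -> (n %| k * h)%N ->
  cabs (y t - y (t + h%:R * tau n)) =
  cabs (rot k%:Z y t - rot k%:Z y (t + h%:R * tau n)).
Proof. by move=> n0 kh; rewrite (gap_rot k%:Z) expi_tau// mul1r. Qed.

(** Sum the tangent line estimates over the shifts h with n | k h, and bound the
mean square distances by the energy. The equation satisfied by r says that the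
coefficient of the energy is the same as in the kinetic term with the opposite
sign, so up to the loss for omega <> k the energy cancels and limit_action is
left. Of the other shifts only h = 1 is retained. *)
Lemma act_lower n k alpha omega r y v : (2 <= n)%N -> ~~ (n %| k)%N -> 0 < alpha -> 0 < r ->
  alpha / 2 * ipow alpha r * cluster_sum n k alpha = r ^+ 2 ->
  Lambda n y -> loop y v ->
  limit_action n k alpha r
  - 2^-1 * (`|omega - k%:R| * kin_loss * en (drot k%:Z y v))
  + 2^-1 * ((omega - k%:R) ^+ 2 * mass (rot k%:Z y))
  + 2^-1 * \sum_(1 <= h < n | (n %| k * h)%N) (ipow alpha (r * chord n h) * (alpha / 2) *
       defect (h%:R * tau n) (r * chord n h) (rot k%:Z y))
  + 2^-1 * pot alpha (1%:R * tau n) y <= act n alpha omega y v.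
Proof.
move=> n2 nk a0 r0 rad Ly ly; have n0 : (0 < n)%N by exact: leq_trans n2.
have lu := loop_rot k%:Z ly; set u := rot _ _ in lu *; set p := drot _ _ _ in lu *.
have [_ _ hu] := lu; have cu := H1_cderiv_cont hu.
have := rotating_kinetic (omega - k%:R) lu.
have -> : kin (omega - k%:R) u p = kin omega y v by rewrite [RHS](kin_rot k%:Z).
rewrite -/kin_loss => K1.
set J := \sum_(1 <= h < n | _) (_ * _ * _).
have part : 2 * limit_action n k alpha r - en p + J <=
    \sum_(1 <= h < n | (n %| k * h)%N) pot alpha (h%:R * tau n) y.
  have -> : 2 * limit_action n k alpha r - en p + J =
    \sum_(1 <= h < n | (n %| k * h)%N) (ipow alpha (r * chord n h) * ((1 + alpha / 2) * (2 * pi) -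
     alpha / 2 / r ^+ 2 * en p +
     alpha / 2 * defect (h%:R * tau n) (r * chord n h) u)).
    transitivity (\sum_(1 <= h < n | (n %| k * h)%N) (ipow alpha (chord n h) * (ipow alpha r * ((1 + alpha / 2) * (2 * pi) -
     alpha / 2 / r ^+ 2 * en p)) + ipow alpha (r * chord n h) * (alpha / 2) * defect (h%:R * tau n) (r * chord n h) u)).
      rewrite big_split/= -/J -big_distrl/= -/(cluster_sum n k alpha); congr (_ + _).
      rewrite /limit_action.
      have e1 : cluster_sum n k alpha * (ipow alpha r * ((1 + alpha / 2) * (2 * pi) - alpha / 2 / r ^+ 2 * en p)) =
        ipow alpha r * cluster_sum n k alpha * (2 * pi) +
        (alpha / 2 * ipow alpha r * cluster_sum n k alpha) * (2 * pi) -
        (alpha / 2 * ipow alpha r * cluster_sum n k alpha) / r ^+ 2 * en p by ring.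
      by rewrite e1 rad divff ?expf_neq0 ?gt_eqF//; ring.
    rewrite big_seq_cond [RHS]big_seq_cond; apply: eq_bigr => h.
    rewrite mem_index_iota => /andP[hn _].
    by rewrite ipowM ?chord_gt0//; ring.
  rewrite big_seq_cond [X in _ <= X]big_seq_cond; apply: ler_sum => h.
  rewrite mem_index_iota => /andP[hn kh].
  have c0 := chord_gt0 hn.
  have -> : pot alpha (h%:R * tau n) y = pot alpha (h%:R * tau n) u.
    by apply: I_eq => t _; rewrite (cluster_gap y t n0 kh).
  have nu t : u t != u (t + h%:R * tau n).
    rewrite -subr_eq0 -cabs_gt0 -(cluster_gap y t n0 kh) cabs_gt0 subr_eq0.
    by case: Ly => _; apply.
  apply: le_trans (pot_lower a0 (mulr_gt0 r0 c0) cu nu).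
  rewrite ler_wpM2l ?ipow_ge0// lerD2r lerD2l lerN2.
  have /andP[s0 s1] := tau_lt hn.
  have ge := @gap_energy _ u p (h%:R * tau n) lu; rewrite (ltW s0) (ltW s1) in ge.
  have {}ge := ge erefl; rewrite -/(chord n h) in ge.
  have -> : alpha / 2 / r ^+ 2 * en p = alpha / 2 / (r * chord n h) ^+ 2 * (chord n h ^+ 2 * en p).
    by field; rewrite !gt_eqF.
  rewrite ler_wpM2l//; first by rewrite !divr_ge0 ?sqr_ge0// ltW.
have rest : pot alpha (1%:R * tau n) y <= \sum_(1 <= h < n | ~~ (n %| k * h)%N) pot alpha (h%:R * tau n) y.
  rewrite big_mkcond big_ltn//= muln1 nk lerDl sumr_ge0// => h _.
  by case: ifP => // _; exact: pot_ge0.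
rewrite /act (bigID (fun h => n %| k * h)%N)/=.
move: K1 part rest; set A := \sum_(1 <= h < n | _) _; set A' := \sum_(1 <= h < n | _) _.
set K := kin _ _ _; set P := pot _ _ _; set Em := en p; set Mm := _ * mass u.
set L := limit_action _ _ _ _; set d := `|_| * _.
by lra.
Qed.

Lemma act_ge_energy n k alpha omega y v : loop y v ->
  (1 - `|omega - k%:R| * kin_loss) * en (drot k%:Z y v) <= 2 * act n alpha omega y v.
Proof.
move=> ly; have lu := loop_rot k%:Z ly.
have := rotating_kinetic (omega - k%:R) lu.
have -> : kin (omega - k%:R) (rot k%:Z y) (drot k%:Z y v) = kin omega y v by rewrite [RHS](kin_rot k%:Z).
rewrite -/kin_loss /act.
have : 0 <= \sum_(1 <= h < n) pot alpha (h%:R * tau n) y by rewrite sumr_ge0// => i _; exact: pot_ge0.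
have : 0 <= (omega - k%:R) ^+ 2 * mass (rot k%:Z y) by rewrite mulr_ge0 ?sqr_ge0 ?mass_ge0.
by lra.
Qed.

(** If the distance is below rho / 4 at one time then, by the Hoelder estimate,
it stays below rho / 2 on an interval of length l, where the integrand of the
defect is at least 1/4. *)
Lemma defect_lower (Em l rho s t1 : R) u p : loop u p -> en p <= Em -> 0 < rho ->
  0 < l -> l <= pi -> 128 * l * Em <= rho ^+ 2 -> 0 <= s <= 2 * pi ->
  cabs (u t1 - u (t1 + s)) < rho / 4 -> l / 4 <= defect s rho u.
Proof.
move=> lu EE r0 l0 lpi lE /andP[s0 s1].
have pi0 := @pi_gt0 R; have p0 := @pi2_gt0 R; have [pu _ hu] := lu; have cu := H1_cderiv_cont hu.
have pd : periodic2pi (fun t => cabs (u t - u (t + s))).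
  by move=> t; rewrite pu addrAC pu.
rewrite -(periodic_mod t1 pd); have /andP[] := mod2pi_itv t1.
move: (mod2pi t1) => t0 t00 t01 dt0.
have close a b : 0 <= a -> a <= b -> b <= 4 * pi -> b - a <= l -> cabs (u b - u a) <= rho / 8.
  move=> a0 ab b4 bal; have := loop_hoelder lu a0 ab b4 => h.
  have r8 : 0 <= rho / 8 by rewrite divr_ge0// ltW.
  rewrite -[X in X <= _]ger0_norm ?cabs_ge0// -[X in _ <= X]ger0_norm//.
  rewrite -ler_sqr ?nnegrE// !real_normK ?num_real//.
  apply: (le_trans h); apply: (@le_trans _ _ (l * (2 * Em))).
    by rewrite ler_pM ?subr_ge0 ?mulr_ge0 ?en_ge0// ler_pM2l.
  by rewrite expr_div_n ler_pdivlMr//; lra.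
pose a := if t0 <= pi then t0 else t0 - l.
have a0 : 0 <= a by rewrite /a; case: (leP t0 pi) => h //; lra.
have al : a + l <= 2 * pi by rewrite /a; case: (leP t0 pi) => h; lra.
have at_ t : a <= t <= a + l -> [/\ 0 <= t, t <= 2 * pi & `|t - t0| <= l].
  move=> /andP[h1 h2]; split; [lra|lra|].
  by move: h1 h2; rewrite /a ler_norml; case: (leP t0 pi) => h h1 h2; apply/andP; split; lra.
have dle t : a <= t <= a + l -> cabs (u t - u (t + s)) <= rho / 2.
  move=> /at_[h1 h2]; rewrite ler_norml => /andP[h3 h4].
  have -> : u t - u (t + s) = (u t0 - u (t0 + s)) + ((u t - u t0) + - (u (t + s) - u (t0 + s))) by ring.
  rewrite (le_trans (cabsD _ _))//.
  have c1 : cabs (u t - u t0) <= rho / 8.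
    by have [tt|tt] := leP t0 t; [|rewrite cabsC]; apply: close => //; lra.
  have c2 : cabs (u (t + s) - u (t0 + s)) <= rho / 8.
    by have [tt|tt] := leP t0 t; [|rewrite cabsC]; apply: close => //; lra.
  have := cabsD (u t - u t0) (- (u (t + s) - u (t0 + s))); rewrite cabsN.
  by move: dt0 c1 c2; lra.
have cdef : continuous (fun t => 1 - cabs (u t - u (t + s)) / rho).
  move=> t; apply: cvgB; first exact: cvg_cst.
  by apply: cvgM; [exact: (continuous_cabs (ccontinuous_gap s cu))|exact: cvg_cst].
have Ld c d : L1 c d (fun t => (1 - cabs (u t - u (t + s)) / rho) ^+ 2).
  by apply: L1_continuous; exact: continuous_sqr.
have aal : a <= a + l by rewrite lerDl ltW.
rewrite /defect (le_trans _ (I_sub_le a0 aal al (Ld _ _) (fun t => sqr_ge0 _)))//.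
have -> : l / 4 = I a (a + l) (fun=> 4^-1) by rewrite I_cst// addrC addKr mulrC.
apply: I_le; [exact: L1_cst|exact: Ld|].
move=> t /dle dt; have h : 2^-1 <= 1 - cabs (u t - u (t + s)) / rho.
  have : cabs (u t - u (t + s)) / rho <= 2^-1 by rewrite ler_pdivrMr// mulrC.
  by lra.
have -> : 4^-1 = 2^-1 ^+ 2 :> R by field.
by rewrite ler_sqr ?nnegrE// (le_trans _ h).
Qed.

(** The curve stays within B of u(0), so u(0) is controlled by the mean square.
*)
Lemma mass_center u p (B : R) : loop u p -> (forall t, cabs (u t - u 0) <= B) ->
  cabs (u 0) ^+ 2 <= mass u / pi + 2 * B ^+ 2.
Proof.
move=> lu hB; have p0 := @pi2_gt0 R; have pi0 := @pi_gt0 R; have [_ _ hu] := lu.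
have cu := H1_cderiv_cont hu.
have L1m := L1_mass 0 (2 * pi) cu.
have : I 0 (2 * pi) (fun=> cabs (u 0) ^+ 2) <= I 0 (2 * pi) (fun t => 2 * cabs (u t) ^+ 2 + 2 * B ^+ 2).
  apply: I_le; [exact: L1_cst|by apply: L1D; [exact: L1Z|exact: L1_cst]|].
  move=> t _; have h1 : cabs (u 0) <= cabs (u t) + B.
    rewrite -[u 0](subrK (u t)) addrC (le_trans (cabsD _ _))// lerD2l cabsC; exact: hB.
  have B0 : 0 <= B by exact: le_trans (cabs_ge0 _) (hB 0).
  have h2 : cabs (u 0) ^+ 2 <= (cabs (u t) + B) ^+ 2.
    by rewrite ler_sqr ?nnegrE ?cabs_ge0// addr_ge0 ?cabs_ge0.
  by have := sqr_ge0 (cabs (u t) - B); move: h2; lra.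
rewrite ID; [|exact: L1Z|exact: L1_cst].
rewrite IZ// !I_cst_period -/(mass u) => h.
rewrite -(ler_pM2r p0) (le_trans h)// le_eqVlt; apply/orP; left; apply/eqP.
have e : mass u / pi * pi = mass u by rewrite divfK// gt_eqF.
by rewrite -{1}e; ring.
Qed.

End Limit_problem.

(** * Geometry of low sublevels *)

Section Sublevel_geometry.
Context {R : realType}.
Implicit Types (y v u p : R -> R[i]) (alpha omega s t x rho r : R).

(** Near omega = k the coefficient of the energy in act_ge_energy is at least
1/2, which bounds the energy; then the loss term of act_lower is at most eta,
and each of the nonnegative remainders is at most 4 eta. *)
Lemma sublevel_terms n k alpha omega r y v (Em eta : R) : (2 <= n)%N -> ~~ (n %| k)%N ->
  0 < alpha -> 0 < r ->
  alpha / 2 * ipow alpha r * cluster_sum n k alpha = r ^+ 2 ->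
  Lambda n y -> loop y v ->
  Em = 4 * (limit_action n k alpha r + 1) -> 0 <= eta -> eta <= 1 ->
  `|omega - k%:R| * kin_loss <= 2^-1 -> 2^-1 * (`|omega - k%:R| * kin_loss * Em) <= eta ->
  act n alpha omega y v <= limit_action n k alpha r + eta ->
  [/\ en (drot k%:Z y v) <= Em,
      (omega - k%:R) ^+ 2 * mass (rot k%:Z y) <= 4 * eta,
      pot alpha (1%:R * tau n) y <= 4 * eta &
      forall h, (1 <= h < n)%N -> (n %| k * h)%N ->
        ipow alpha (r * chord n h) * (alpha / 2) *
          defect (h%:R * tau n) (r * chord n h) (rot k%:Z y) <= 4 * eta].
Proof.
move=> n2 nk a0 r0 rad Ly ly EmE eta0 eta1 d1 d2 Ay.
have K := @act_ge_energy R n k alpha omega y v ly.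
have low := @act_lower R n k alpha omega r y v n2 nk a0 r0 rad Ly ly.
set E := en _ in K low *; have E0 : 0 <= E by exact: en_ge0.
set d := `|_| * _ in d1 d2 K low; set L := limit_action _ _ _ _ in EmE Ay low.
set A := act _ _ _ _ _ in Ay K low.
have EEm : E <= Em.
  have : 2^-1 * E <= (1 - d) * E by rewrite ler_wpM2r//; lra.
  by move: K; rewrite EmE; lra.
have d0 : 0 <= d by rewrite mulr_ge0// /kin_loss addr_ge0// sqr_ge0.
have dE : d * E <= d * Em by rewrite ler_wpM2l.
set M := _ * mass _ in low *; set P := pot _ _ _ in low *.
set J := \sum_(1 <= h < n | _) _ in low.
have M0 : 0 <= M by rewrite mulr_ge0 ?sqr_ge0 ?mass_ge0.
have P0 : 0 <= P by exact: pot_ge0.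
have term0 h : 0 <= ipow alpha (r * chord n h) * (alpha / 2) *
    defect (h%:R * tau n) (r * chord n h) (rot k%:Z y).
  by rewrite mulr_ge0 ?defect_ge0// mulr_ge0 ?ipow_ge0// divr_ge0// ltW.
have J0 : 0 <= J by apply: sumr_ge0 => h _; exact: term0.
split=> //; try by move: low Ay dE d2 M0 P0 J0; lra.
move=> h hn kh.
apply: (@le_trans _ _ J); last by move: low Ay dE d2 M0 P0 J0; lra.
rewrite /J big_mkcond (bigD1_seq h) ?iota_uniq//=; last by rewrite mem_index_iota.
rewrite kh lerDl sumr_ge0// => i _; by case: ifP => // _; exact: term0.
Qed.

(** The bound Em on the energy fixes the oscillation B. If |u(0)| were below X,
all bodies would remain within bounded distance of each other and the potential
of h = 1 would be at least P0; this excludes it, and X is large enough to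
separate the clusters. Collisions inside a cluster are excluded by defect_lower
with l as large as the energy bound allows. *)
Lemma sublevel_bounds n k alpha r : (2 <= n)%N -> ~~ (n %| k)%N -> 0 < alpha -> 0 < r ->
  alpha / 2 * ipow alpha r * cluster_sum n k alpha = r ^+ 2 ->
  exists eps eta m B : R, [/\ 0 < eps, 0 < eta, 0 < m &
    forall omega y v, `|omega - k%:R| < eps -> Lambda n y -> loop y v ->
      act n alpha omega y v <= limit_action n k alpha r + eta ->
      [/\ forall h, (1 <= h < n)%N -> margin (h%:R * tau n) m y,
          forall t, cabs (rot k%:Z y t - rot k%:Z y 0) <= B,
          2 * B < cabs (rot k%:Z y 0) &
          (omega - k%:R) ^+ 2 * mass (rot k%:Z y) <= 4 * eta]].
Proof.
move=> n2 nk a0 r0 rad; have n0 : (0 < n)%N by exact: leq_trans n2.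
have pi0 := @pi_gt0 R; have p0 := @pi2_gt0 R.
have S0 : 0 <= cluster_sum n k alpha by apply: sumr_ge0 => h _; exact: ipow_ge0.
pose L := limit_action n k alpha r.
have L0 : 0 <= L.
  by rewrite /L /limit_action mulr_ge0 ?pi_ge0// addr_ge0 ?sqr_ge0// mulr_ge0 ?ipow_ge0.
pose Em := 4 * (L + 1); have Em0 : 0 < Em by rewrite /Em; lra.
pose B := Num.sqrt (2 * pi * Em).
have B0 : 0 <= B by exact: sqrtr_ge0.
have B2 : B ^+ 2 = 2 * pi * Em by rewrite sqr_sqrtr// mulr_ge0// ltW.
pose zeta h := expi (- (k%:Z%:~R * (h%:R * tau n))) : R[i].
have [ka ka0 hka] := @phase_gap R n k n0.
have B1 : 0 < 2 * B + 1 by lra.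
have Bk : 0 < (2 * B + 1) / ka by rewrite divr_gt0.
pose X := (2 * B + 1) / ka + (2 * B + 1).
have X0 : 0 < X by rewrite addr_gt0.
pose P0 := ipow alpha (2 * X + 2 * B) * (2 * pi).
have XB : 0 < 2 * X + 2 * B by lra.
have P00 : 0 < P0 by rewrite mulr_gt0// ipow_gt0.
pose rho h := r * chord n h.
have rho0 h : (1 <= h < n)%N -> 0 < rho h by move=> hn; rewrite mulr_gt0// chord_gt0.
pose l h := Num.min pi (rho h ^+ 2 / (128 * Em)).
have l0 h : (1 <= h < n)%N -> 0 < l h.
  move=> hn; rewrite lt_min pi0/=; apply: divr_gt0; last by rewrite mulr_gt0.
  by apply: exprn_gt0; exact: rho0.
pose c h := ipow alpha (rho h) * (alpha / 2) * (l h / 4).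
have [cm cm0 hcm] : exists2 cm : R, 0 < cm & forall h, (1 <= h < n)%N -> cm <= c h.
  apply: fin_min => h hn; apply: mulr_gt0; last by rewrite divr_gt0// l0.
  by apply: mulr_gt0; [apply: ipow_gt0; exact: rho0|rewrite divr_gt0].
have [m m0 hm] : exists2 m : R, 0 < m & forall h, (1 <= h < n)%N ->
    m <= if (n %| k * h)%N then rho h / 4 else 1.
  by apply: fin_min => h hn; case: ifP => // _; rewrite divr_gt0// rho0.
(* eta makes 4 eta smaller than the potential P0 of bounded configurations and
   than the defect c h that a near collision in a cluster would cause *)
pose eta := Num.min 1 (Num.min (P0 / 8) (cm / 8)).
have eta0 : 0 < eta by rewrite !lt_min ltr01/= !divr_gt0.
have eta1 : eta <= 1 by rewrite ge_min lexx.
have etaP : eta <= P0 / 8 by rewrite !ge_min lexx ?orbT.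
have etac : eta <= cm / 8 by rewrite !ge_min lexx ?orbT.
have kl0 : 0 < kin_loss :> R by rewrite ltr_wpDr ?sqr_ge0.
pose eps := Num.min (2^-1 / kin_loss) (2 * eta / (kin_loss * Em)).
have kE : 0 < kin_loss * Em by rewrite mulr_gt0.
have eps0 : 0 < eps.
  rewrite lt_min (divr_gt0 _ kl0) ?invr_gt0//=.
  by apply: (divr_gt0 _ kE); rewrite mulr_gt0.
exists eps, eta, m, B; split=> // omega y v deps Ly ly Ay.
have d1 : `|omega - k%:R| * kin_loss <= 2^-1.
  by rewrite -ler_pdivlMr// (le_trans (ltW deps))// ge_min lexx.
have d2 : 2^-1 * (`|omega - k%:R| * kin_loss * Em) <= eta.
  have : `|omega - k%:R| <= 2 * eta / (kin_loss * Em) by rewrite (le_trans (ltW deps))// ge_min lexx orbT.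
  by rewrite ler_pdivlMr// mulrA; lra.
have [EE hmass hpot hdef] := sublevel_terms n2 nk a0 r0 rad Ly ly erefl (ltW eta0) eta1 d1 d2 Ay.
have lu := loop_rot k%:Z ly; set u := rot _ _ in lu hmass hdef *; set p := drot _ _ _ in lu EE.
have osc t : cabs (u t - u 0) <= B.
  rewrite -ler_sqr ?nnegrE ?cabs_ge0// B2 (le_trans (loop_osc t lu))//.
  by rewrite ler_wpM2l// ltW.
have u0X : X <= cabs (u 0).
  rewrite leNgt; apply/negP => uX.
  have cu t : cabs (u t) <= X + B.
    rewrite -[u t](subrK (u 0)) addrC (le_trans (cabsD _ _))// lerD ?osc// ltW//.
  have : P0 <= pot alpha (1%:R * tau n) y.
    have [_ _ hy] := ly; have ny t : y t != y (t + 1%:R * tau n) by case: Ly => _; apply.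
    rewrite /P0 -I_cst_period; apply: I_le; [exact: L1_cst|exact: pot_L1 (H1_cderiv_cont hy) ny|].
    move=> t _; apply: ipow_le => //; first by rewrite cabs_gt0 subr_eq0.
    have hc := cabsD (y t) (- y (t + 1%:R * tau n)); rewrite cabsN in hc.
    apply: (le_trans hc); have c1 := cu t; have c2 := cu (t + 1%:R * tau n).
    by rewrite /u !cabs_rot in c1 c2; lra.
  by move: hpot etaP P00; lra.
have BX : 2 * B + 1 <= ka * X.
  rewrite /X mulrDr [X in _ <= X + _]mulrC divfK ?gt_eqF//.
  by rewrite lerDl mulr_ge0 ?(ltW ka0) ?(ltW B1).
have BX' : 2 * B + 1 <= X by rewrite /X lerDr ltW.
split=> //; last by lra.
move=> h hn t; apply: le_trans (hm h hn) _; case: ifPn => kh.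
  rewrite (cluster_gap y t n0 kh) -/u leNgt; apply/negP => dlt.
  have /andP[s0 s1] := @tau_lt R n h hn.
  have hs : 0 <= h%:R * (tau n : R) <= 2 * pi by rewrite !ltW.
  have lpi : l h <= pi by rewrite ge_min lexx.
  have lE : 128 * l h * Em <= rho h ^+ 2.
    have : l h <= rho h ^+ 2 / (128 * Em) by rewrite ge_min lexx orbT.
    by rewrite ler_pdivlMr; [lra|rewrite mulr_gt0].
  have dl := defect_lower lu EE (rho0 h hn) (l0 h hn) lpi lE hs dlt.
  have h1 := hdef h hn kh; have h2 := hcm h hn.
  have h3 : c h <= ipow alpha (rho h) * (alpha / 2) * defect (h%:R * tau n) (rho h) u.
    by rewrite ler_wpM2l// mulr_ge0 ?ipow_ge0// divr_ge0// ltW.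
  by move: h1 h2 h3 etac cm0; rewrite -/(rho h); lra.
rewrite (gap_rot k%:Z) -/u -/(zeta h).
have -> : u t - zeta h * u (t + h%:R * tau n) =
  (1 - zeta h) * u 0 + ((u t - u 0) + - (zeta h * (u (t + h%:R * tau n) - u 0))) by ring.
apply: le_trans (cabsB_ge _ _); rewrite cabsM.
have h1 := cabsD (u t - u 0) (- (zeta h * (u (t + h%:R * tau n) - u 0))).
rewrite cabsN cabsM cabs_expi mul1r in h1.
have h2 := osc t; have h3 := osc (t + h%:R * tau n).
have h4 : ka * X <= cabs (1 - zeta h) * cabs (u 0).
  by rewrite ler_pM ?(ltW ka0) ?(ltW X0)// hka.
by move: h1 h2 h3 h4 BX; lra.
Qed.
End Sublevel_geometry.

(** * A test orbit *)

Section Test_orbit.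
Context {R : realType}.
Implicit Types (y v u p : R -> R[i]) (alpha omega s t x r : R).

Lemma ipow_small alpha (e : R) : 0 < alpha -> 0 < e ->
  exists2 X : R, 0 < X & forall x, X <= x -> ipow alpha x <= e.
Proof.
move=> a0 e0; have X0 : 0 < e `^ (- alpha^-1) by rewrite powR_gt0.
exists (e `^ (- alpha^-1)) => // x Xx.
apply: (le_trans (ipow_le a0 X0 Xx)).
by rewrite /ipow -powRrM mulNr mulVf ?gt_eqF// powRN invrK powRr1// ltW.
Qed.

Definition offset_circle (a r : R) t : R[i] := Complex (a + r * cos t) (r * sin t).
Definition offset_circle' r t : R[i] := Complex (- (r * sin t)) (r * cos t).

Lemma offset_circleE (a r t : R) : offset_circle a r t = a%:C%C + r%:C%C * expi t.
Proof. by apply: complex_ext; rewrite ?ReD ?ReM ?ImD ?ImM /expi /offset_circle/=; ring. Qed.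

Lemma loop_offset_circle (a r : R) : loop (offset_circle a r) (offset_circle' r).
Proof.
have pc t : cos (t + 2 * pi) = cos t by have := cos_2pi_int 1 t; rewrite mulr1.
have ps t : sin (t + 2 * pi) = sin t by have := sin_2pi_int 1 t; rewrite mulr1.
split; [by move=> t; rewrite /offset_circle pc ps|by move=> t; rewrite /offset_circle' pc ps|].
split; apply: H1_deriv_on => c d.
  have := H1onD (H1on_cst c d a) (H1onZ r (H1on_cosk 1 c d)).
  by apply: eq_H1on => t _ /=; rewrite !mul1r//; ring.
have := H1onZ r (H1on_sink 1 c d).
by apply: eq_H1on => t _ /=; rewrite !mul1r.
Qed.

(** With a = 1/q and |delta| = q^2 the drift velocity delta a has size q, so it
disappears as delta tends to 0 although a tends to infinity. *)
Lemma kin_offset_circle (q r delta : R) : 0 < q <= 1 -> 0 < r -> `|delta| = q ^+ 2 ->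
  kin delta (offset_circle q^-1 r) (offset_circle' r) <=
  2 * pi * (r ^+ 2 + q * (3 * r ^+ 2 + 4 * r + 1)).
Proof.
move=> /andP[q0 q1] r0 dq; have p0 := @pi2_gt0 R; have [_ _ h] := loop_offset_circle q^-1 r.
rewrite mulrC -I_cst_period; apply: I_le; [exact: kin_L1|exact: L1_cst|].
move=> t _ /=; set c := cos t; set s := sin t.
have cs : s ^+ 2 = 1 - c ^+ 2 by have := cos2Dsin2 t; rewrite -/c -/s; lra.
have -> : (- (r * s) - delta * (r * s)) ^+ 2 + (r * c + delta * (q^-1 + r * c)) ^+ 2 =
  ((1 + delta) * r) ^+ 2 + (delta / q) ^+ 2 + 2 * ((1 + delta) * r) * (delta / q * c).
  have -> : (- (r * s) - delta * (r * s)) ^+ 2 = ((1 + delta) * r) ^+ 2 * s ^+ 2 by ring.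
  by rewrite cs; ring.
have [dl dr] : delta <= q ^+ 2 /\ - q ^+ 2 <= delta.
  by rewrite -dq ler_norm; split => //; have := lerNnormlW (lexx `|delta|).
have dqq : `|delta / q| = q by rewrite normrM normfV dq (gtr0_norm q0) expr2 mulfK// gt_eqF.
have e1 : (delta / q) ^+ 2 = q ^+ 2 by rewrite -real_normK ?num_real// dqq.
have e2 : delta / q * c <= q.
  apply: (le_trans (ler_norm _)); rewrite normrM dqq -[X in _ <= X]mulr1 ler_pM2l//.
  by rewrite ler_norml cos_geN1 cos_le1.
have q2 : q ^+ 2 <= q by rewrite expr2 ler_piMr// ltW.
have d1 : 0 <= 1 + delta by move: q2 dr; lra.
have d2 : 1 + delta <= 1 + q by move: q2 dl; lra.
have e3 : 2 * ((1 + delta) * r) * (delta / q * c) <= 4 * r * q.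
  apply: (@le_trans _ _ (2 * ((1 + delta) * r) * q)); first by rewrite ler_wpM2l// mulr_ge0 ?mulr_ge0 ?(ltW r0).
  by rewrite ler_pM2r// mulrA ler_pM2r//; lra.
have e4 : ((1 + delta) * r) ^+ 2 <= (1 + 3 * q) * r ^+ 2.
  rewrite exprMn ler_wpM2r ?sqr_ge0//.
  apply: (@le_trans _ _ ((1 + q) ^+ 2)); first by rewrite ler_sqr ?nnegrE//; lra.
  by rewrite sqrrD expr1n mul1r mulr2n; move: q2; lra.
have e5 : (1 + 3 * q) * r ^+ 2 = r ^+ 2 + 3 * (q * r ^+ 2) by ring.
have e6 : q * (3 * r ^+ 2 + 4 * r + 1) = 3 * (q * r ^+ 2) + 4 * r * q + q by ring.
rewrite e5 in e4; rewrite e1 e6; move: e3 e4 q2.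
by move: (_ ^+ 2) (q * r ^+ 2) (4 * r * q) (2 * _ * _) (r ^+ 2) (q ^+ 2) => A B C D E F; lra.
Qed.

Lemma chord_expi t s : 0 <= s <= 2 * pi -> cabs (expi t - expi (t + s)) = 2 * sin (s / 2).
Proof.
move=> /andP[s0 s1]; have h0 : 0 <= sin (s / 2) by apply: sin_ge0_pi; apply/andP; split; lra.
have -> : expi t - expi (t + s) = expi t * (1 - expi s) :> R[i] by rewrite expiD; ring.
rewrite cabsM cabs_expi mul1r.
apply/eqP; rewrite -(@eqrXn2 _ 2) ?cabs_ge0 ?mulr_ge0//; apply/eqP.
rewrite cabs_sqr ReB ImB /expi/=; have -> : s = s / 2 + s / 2 by field.
rewrite cosD sinD -mulr2n -[(s / 2) *+ 2]mulr_natr divfK//.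
move: (cos (s / 2)) (sin (s / 2)) (cos2Dsin2 (s / 2)) => c d e1.
transitivity ((1 - (c ^+ 2 - d ^+ 2)) ^+ 2 + 4 * (c ^+ 2 * d ^+ 2)); first by ring.
have c2 : c ^+ 2 = 1 - d ^+ 2 by rewrite -e1 addrK.
by rewrite c2; ring.
Qed.

(** Take u on a circle of radius r centred at distance |delta|^(-1/2) from the
origin. Inside a cluster the distances are exactly r times the chords; between
clusters they tend to infinity with the distance of the centre from the origin.
*)
Lemma test_orbit n k alpha r (eta : R) : (2 <= n)%N -> 0 < alpha -> 0 < r -> 0 < eta ->
  exists2 eps, 0 < eps & forall omega, omega != k%:R -> `|omega - k%:R| < eps ->
    exists y v, [/\ Lambda n y, loop y v &
      act n alpha omega y v <= limit_action n k alpha r + eta].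
Proof.
move=> n2 a0 r0 eta0; have n0 : (0 < n)%N by exact: leq_trans n2.
have pi0 := @pi_gt0 R; have p0 := @pi2_gt0 R.
have nR : 0 < n%:R :> R by rewrite ltr0n.
pose zeta h := expi (- (k%:Z%:~R * (h%:R * tau n))) : R[i].
have [ka ka0 hka] := @phase_gap R n k n0.
pose e := eta / (2 * pi * n%:R); have e0 : 0 < e by rewrite divr_gt0// mulr_gt0.
have [X X0 hX] := ipow_small a0 e0.
pose K := 3 * r ^+ 2 + 4 * r + 1.
have K0 : 0 < K by rewrite addr_gt0 ?addr_gt0 ?mulr_gt0 ?exprn_gt0.
have Xr : 0 < X + 2 * r by rewrite addr_gt0 ?mulr_gt0.
pose q0 := Num.min 1 (Num.min (eta / (2 * pi * K)) (ka / (X + 2 * r))).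
have q00 : 0 < q0 by rewrite !lt_min ltr01/= (divr_gt0 ka0 Xr) andbT divr_gt0// mulr_gt0.
exists (q0 ^+ 2); first by rewrite exprn_gt0.
move=> omega ok od; pose delta := omega - k%:R; rewrite -/delta in od.
pose q := Num.sqrt `|delta|.
have q_gt0 : 0 < q by rewrite sqrtr_gt0 normr_gt0 subr_eq0.
have dq : `|delta| = q ^+ 2 by rewrite sqr_sqrtr.
have qq0 : q < q0 by move: od; rewrite dq ltr_sqr ?nnegrE ?ltW.
have q1 : q <= 1 by rewrite (le_trans (ltW qq0))// ge_min lexx.
have qK : q * K <= eta / (2 * pi).
  have : q <= eta / (2 * pi * K) by rewrite (le_trans (ltW qq0))// !ge_min lexx orbT.
  rewrite ler_pdivlMr; last by rewrite mulr_gt0.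
  by rewrite [_ * K]mulrC mulrA -ler_pdivlMr.
have qX : X + 2 * r <= ka * q^-1.
  have : q <= ka / (X + 2 * r) by rewrite (le_trans (ltW qq0))// !ge_min lexx !orbT.
  by rewrite ler_pdivlMr// mulrC -ler_pdivlMr.
pose u := offset_circle q^-1 r; pose p := offset_circle' r.
have lu : loop u p := loop_offset_circle q^-1 r.
pose y := rot (- k%:Z) u; pose v := drot (- k%:Z) u p.
have ly : loop y v by exact: loop_rot.
have ru t : rot k%:Z y t = u t by rewrite /y rotK.
have near h t : (1 <= h < n)%N -> (n %| k * h)%N ->
    cabs (y t - y (t + h%:R * tau n)) = r * chord n h.
  move=> hn kh; rewrite (cluster_gap y t n0 kh) !ru /u !offset_circleE.
  have -> : q^-1%:C%C + r%:C%C * expi t - (q^-1%:C%C + r%:C%C * expi (t + h%:R * tau n)) =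
    r%:C%C * (expi t - expi (t + h%:R * tau n)) by ring.
  have /andP[s0 s1] := @tau_lt R n h hn.
  by rewrite cabsM cabs_real chord_expi ?ltW// gtr0_norm.
have far h t : (1 <= h < n)%N -> ~~ (n %| k * h)%N ->
    X <= cabs (y t - y (t + h%:R * tau n)).
  move=> hn kh; rewrite (gap_rot k%:Z) !ru -/(zeta h) /u !offset_circleE.
  have -> : q^-1%:C%C + r%:C%C * expi t - zeta h * (q^-1%:C%C + r%:C%C * expi (t + h%:R * tau n)) =
    (1 - zeta h) * q^-1%:C%C + r%:C%C * (expi t + - (zeta h * expi (t + h%:R * tau n))) by ring.
  apply: le_trans (cabsB_ge _ _); rewrite !cabsM !cabs_real (gtr0_norm r0) (ger0_norm (_ : 0 <= q^-1)) ?invr_ge0 ?(ltW q_gt0)//.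
  have h1 : cabs (expi t + - (zeta h * expi (t + h%:R * tau n))) <= 2.
    by rewrite (le_trans (cabsD _ _))// cabsN cabsM !cabs_expi mul1r; lra.
  have h2 : r * cabs (expi t + - (zeta h * expi (t + h%:R * tau n))) <= 2 * r.
    by rewrite mulrC ler_pM2r.
  have h3 : ka * q^-1 <= cabs (1 - zeta h) * q^-1 by rewrite ler_pM2r ?invr_gt0// hka.
  by rewrite lerBrDr (le_trans _ h3)// (le_trans _ qX)// lerD2l.
have Ly : Lambda n y.
  have [py _ hy] := ly; split; first by split => //; exists v.
  move=> t h hn; rewrite -subr_eq0 -cabs_gt0.
  have [kh|kh] := boolP (n %| k * h)%N; first by rewrite near// mulr_gt0// chord_gt0.
  exact: lt_le_trans (far _ _ hn kh).
exists y, v; split => //; rewrite /act.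
have kinE : kin omega y v = kin delta u p.
  have -> : omega = delta - (- k%:Z)%:~R by rewrite mulrNz opprK /delta subrK.
  exact: esym (kin_rot (- k%:Z) delta u p).
have qr : 0 < q <= 1 by rewrite q_gt0.
have kin1 := kin_offset_circle qr r0 dq; rewrite -/u -/p -kinE -/K in kin1.
have hy : ccontinuous y by case: ly => _ _; exact: H1_cderiv_cont.
have potn h : (1 <= h < n)%N -> (n %| k * h)%N ->
    pot alpha (h%:R * tau n) y = ipow alpha (chord n h) * (2 * pi * ipow alpha r).
  move=> hn kh; transitivity (I 0 (2 * pi) (fun=> ipow alpha (r * chord n h))).
    by apply: I_eq => t _; rewrite near.
  by rewrite I_cst_period ipowM ?chord_gt0//; ring.
have potf h : (1 <= h < n)%N -> ~~ (n %| k * h)%N -> pot alpha (h%:R * tau n) y <= e * (2 * pi).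
  move=> hn kh; rewrite -I_cst_period; apply: I_le; [|exact: L1_cst|].
    by apply: pot_L1 => // t; case: Ly => _; apply.
  by move=> t _; apply: hX; exact: far.
rewrite (bigID (fun h => n %| k * h)%N)/=.
have near_sum : \sum_(1 <= h < n | (n %| k * h)%N) pot alpha (h%:R * tau n) y =
    cluster_sum n k alpha * (2 * pi * ipow alpha r).
  rewrite /cluster_sum big_distrl/= big_seq_cond [RHS]big_seq_cond; apply: eq_bigr => h.
  by rewrite mem_index_iota => /andP[hn kh]; exact: potn.
have far_sum : \sum_(1 <= h < n | ~~ (n %| k * h)%N) pot alpha (h%:R * tau n) y <= eta.
  apply: (@le_trans _ _ (\sum_(1 <= h < n | ~~ (n %| k * h)%N) e * (2 * pi))).
    rewrite big_seq_cond [X in _ <= X]big_seq_cond; apply: ler_sum => h.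
    by rewrite mem_index_iota => /andP[hn kh]; exact: potf.
  have ep : 0 <= e * (2 * pi) by rewrite mulr_ge0 ?ltW.
  rewrite big_mkcond; apply: (@le_trans _ _ (\sum_(1 <= h < n) e * (2 * pi))).
    by apply: ler_sum => h _; case: ifP.
  rewrite big_const_nat iter_addr_0 -[X in X <= _]mulr_natr.
  have etaE : e * (2 * pi) * n%:R = eta by rewrite -mulrA /e divfK// gt_eqF// mulr_gt0.
  by rewrite -[X in _ <= X]etaE ler_wpM2l// ler_nat leq_subr.
rewrite near_sum; move: kin1 far_sum qK; rewrite ler_pdivlMr// /limit_action.
set S := cluster_sum _ _ _; set P := ipow _ _.
have -> : 2 * pi * (r ^+ 2 + q * K) = 2 * (pi * r ^+ 2) + q * K * (2 * pi) by ring.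
have -> : S * (2 * pi * P) = 2 * (pi * (P * S)) by ring.
rewrite [pi * (_ + _)]mulrDr; move: (kin _ _ _) (\sum_(_ <= i < _ | _) _) (pi * _) (pi * _) (q * K * _).
by move=> A B C D E; lra.
Qed.

End Test_orbit.

(** * Winding number and relative equilibria *)

Section Winding.
Context {R : realType}.
Implicit Types (y v u p : R -> R[i]) (alpha omega s t x r : R) (z c : R[i]).
Notation Re := complex.Re.
Notation Im := complex.Im.

Lemma polar_right_half z : 0 < Re z -> z = (cabs z)%:C%C * expi (atan (Im z / Re z)).
Proof.
move=> z0; have cz : cabs z = Re z * Num.sqrt (1 + (Im z / Re z) ^+ 2).
  rewrite -[X in X * _](gtr0_norm z0) -sqrtr_sqr -sqrtrM ?sqr_ge0// cabsE; congr Num.sqrt.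
  by field; rewrite gt_eqF.
have s0 : Num.sqrt (1 + (Im z / Re z) ^+ 2) != 0 :> R.
  by rewrite gt_eqF// sqrtr_gt0 ltr_pwDl// sqr_ge0.
have sin_atan (x : R) : sin (atan x) = x * cos (atan x).
  have c0 : cos (atan x) != 0 by rewrite gt_eqF// cos_gt0_pihalf// atan_gtNpi2 atan_ltpi2.
  by rewrite -{2}[x]atanK /tan divfK.
apply: complex_ext; rewrite ?ReM ?ImM /expi/= ?sin_atan cos_atan mul0r cz ?subr0 ?addr0.
  by rewrite mulfK.
by rewrite [RHS]mulrC mulrA [_ / _ / _]mulrAC -!mulrA; field; rewrite s0 gt_eqF.
Qed.

Lemma polar z : exists a : R, z = (cabs z)%:C%C * expi a.
Proof.
have ii : Complex 0 1 = expi (pi / 2) :> R[i] by rewrite /expi cos_pihalf sin_pihalf.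
have [z0|z0|z0] := ltgtP (Re z) 0.
- exists (atan (Im (- z) / Re (- z)) + pi).
  rewrite expiD /expi cospi sinpi -[z in LHS]opprK {1}(@polar_right_half (- z)); last by rewrite ReN oppr_gt0.
  rewrite cabsN mulrA (_ : Complex (-1) 0 = -1 :> R[i]); last by apply: complex_ext => /=; rewrite ?oppr0.
  by rewrite mulrN1.
- by exists (atan (Im z / Re z)); exact: polar_right_half.
have zE : z = (Im z)%:C%C * expi (pi / 2).
  by rewrite -ii; apply: complex_ext; rewrite ?ReM ?ImM/= ?z0; ring.
have cz : cabs z = `|Im z| by rewrite cabsE z0 expr0n/= add0r sqrtr_sqr.
have [i0|i0] := leP 0 (Im z); first by exists (pi / 2); rewrite cz ger0_norm.
exists (pi / 2 + pi); rewrite cz ltr0_norm// expiD {1}zE [expi pi]/expi cospi sinpi.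
rewrite (_ : Complex (-1) 0 = -1 :> R[i]); last by apply: complex_ext => /=; rewrite ?oppr0.
by rewrite mulrN1 mulrN (_ : (- Im z)%:C%C = - (Im z)%:C%C) ?mulNr ?opprK// -rmorphN.
Qed.

Lemma ccontinuousD y v : ccontinuous y -> ccontinuous v -> ccontinuous (fun t => y t + v t).
Proof.
move=> [y1 y2] [v1 v2]; split.
  under eq_fun do rewrite ReD; by move=> t; apply: cvgD; [exact: y1|exact: v1].
by under eq_fun do rewrite ImD; move=> t; apply: cvgD; [exact: y2|exact: v2].
Qed.

Lemma ccontinuousZ c y : ccontinuous y -> ccontinuous (fun t => c * y t).
Proof.
move=> [y1 y2]; split.
  by under eq_fun do rewrite ReM; move=> t; apply: cvgB; apply: cvgM; (exact: cvg_cst || exact: y1 || exact: y2).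
by under eq_fun do rewrite ImM; move=> t; apply: cvgD; apply: cvgM; (exact: cvg_cst || exact: y1 || exact: y2).
Qed.

Lemma ccontinuous_shift s y : ccontinuous y -> ccontinuous (fun t => y (t + s)).
Proof. by move=> [y1 y2]; split; [exact: continuous_shift s y1|exact: continuous_shift s y2]. Qed.

Lemma ccontinuous_sum (J : Type) (r : seq J) (F : J -> R -> R[i]) :
  (forall j, ccontinuous (F j)) -> ccontinuous (fun t => \sum_(j <- r) F j t).
Proof.
move=> cF; elim: r => [|j r IH].
  by rewrite (_ : (fun t => _) = fun=> 0) ?funeqE//; [split=> t; exact: cvg_cst|move=> t; rewrite big_nil].
rewrite (_ : (fun t => _) = fun t => F j t + \sum_(j <- r) F j t); first exact: ccontinuousD.
by apply/funext => t; rewrite big_cons.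
Qed.

(** The curve U stays in a disc around c that avoids the origin, so U / c has
positive real part and its argument is an arctangent, which is continuous and
returns to its initial value; the factor e^(-ikt) contributes - k turns. *)
Lemma winding_rotating_perturbation (k : nat) (g U : R -> R[i]) c :
  (forall t, g t = expi (- (k%:R * t)) * U t) -> ccontinuous U -> U (2 * pi) = U 0 ->
  (forall t, cabs (U t - c) < cabs c) -> winding_number g (- k%:Z).
Proof.
move=> gE cU pU near; have c0 : 0 < cabs c by exact: le_lt_trans (cabs_ge0 _) (near 0).
have [a ca] := polar c.
pose z t := expi (- a) * U t.
have cz : ccontinuous z by exact: ccontinuousZ.
have z0 t : 0 < Re (z t).
  have e : z t = (cabs c)%:C%C + expi (- a) * (U t - c).
    rewrite {2}ca [in RHS]mulrBr [_ * (_ * expi a)]mulrCA expiNr mulr1 /z; ring.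
  have := Re_cabs (expi (- a) * (U t - c)); rewrite cabsM cabs_expi mul1r ler_norml => /andP[h _].
  by rewrite e ReD/=; have := near t; move: h; lra.
exists (fun t => a + atan (Im (z t) / Re (z t)) - k%:R * t); split.
- apply: continuous_subspaceT => t; apply: cvgB; last by apply: cvgM; [exact: cvg_cst|exact: cvg_id].
  apply: cvgD; first exact: cvg_cst.
  apply: (@continuous_comp _ _ _ (fun t => Im (z t) / Re (z t)) atan); last exact: continuous_atan.
  case: cz => c1 c2; apply: cvgM; [exact: c2|apply: cvgV; [by rewrite gt_eqF|exact: c1]].
- move=> t _; have U0 : 0 < cabs (U t).
    have : Re (z t) <= cabs (z t) by apply: le_trans (Re_cabs _); exact: ler_norm.
    by rewrite cabsM cabs_expi mul1r; exact: lt_le_trans.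
  have cg : cabs (g t) = cabs (U t) by rewrite gE cabsM cabs_expi mul1r.
  split; first by rewrite -cabs_gt0 cg.
  have -> : cabs (g t) = cabs (z t) by rewrite cg cabsM cabs_expi mul1r.
  rewrite !expiD mulrA [(cabs (z t))%:C%C * _]mulrCA -(polar_right_half (z0 t)) mulrA.
  by rewrite -expiD subrr expi0 mul1r gE mulrC.
rewrite /z pU mulr0 mulrNz -pmulrn; ring.
Qed.

Lemma sum_expi_tau n k : (2 <= n)%N -> ~~ (n %| k)%N ->
  \sum_(i < n) expi (- (k%:Z%:~R * (i%:R * tau n))) = 0 :> R[i].
Proof.
move=> n2 nk; have n0 : (0 < n)%N by exact: leq_trans n2.
pose z : R[i] := expi (- (k%:Z%:~R * (1%:R * tau n))).
have zE i : expi (- (k%:Z%:~R * (i%:R * tau n))) = z ^+ i.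
  elim: i => [|i IH]; first by rewrite mul0r mulr0 oppr0 expi0.
  by rewrite exprSr -IH -expiD -[i.+1%:R]natr1; congr expi; ring.
have z1 : z != 1 by apply: expi_tau_neq1 => //; rewrite muln1.
have := subrX1 z n; rewrite -zE expi_tau ?dvdn_mull// subrr.
under eq_bigr do rewrite -zE.
by move=> /esym/eqP; rewrite mulf_eq0 subr_eq0 (negbTE z1) => /eqP.
Qed.

(** As n does not divide k, the phases zeta_i sum to 0 and the centre of mass is
e^(-ikt) times the average of zeta_i (u(t + i tau) - u(0)), which is at most B
in modulus. *)
Lemma winding_loop n k y v (B : R) : (2 <= n)%N -> ~~ (n %| k)%N -> loop y v ->
  (forall t, cabs (rot k%:Z y t - rot k%:Z y 0) <= B) -> 2 * B < cabs (rot k%:Z y 0) ->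
  winding_number (fun t => y t - center_of_mass (fun i : 'I_n => bodies y i t)) (- k%:Z).
Proof.
move=> n2 nk ly; have lu := loop_rot k%:Z ly.
have yE t : y t = expi (- (k%:R * t)) * rot k%:Z y t by rewrite /rot mulrA expiNr mul1r.
move: (rot _ _) (drot _ _ _) lu yE => u p lu yE hB uB.
have [pu _ hu] := lu; have cu := H1_cderiv_cont hu.
have n0 : n%:R != 0 :> R[i] by rewrite pnatr_eq0; case: (n) n2.
pose zeta (i : 'I_n) : R[i] := expi (- (k%:Z%:~R * (i%:R * tau n))).
pose U t := u t + - n%:R^-1 * \sum_i zeta i * u (t + i%:R * tau n).
apply: (@winding_rotating_perturbation _ _ U (u 0)).
- move=> t; rewrite /U mulrDr -yE; congr (_ + _).
  rewrite mulNr mulrN /center_of_mass mulrCA; congr (- (_ * _)); rewrite big_distrr/=.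
  apply: eq_bigr => i _; rewrite /bodies yE /zeta [RHS]mulrA -expiD; congr (expi _ * _).
  by rewrite -pmulrn; ring.
- apply: ccontinuousD => //; apply: ccontinuousZ; apply: ccontinuous_sum => i.
  by apply: ccontinuousZ; exact: ccontinuous_shift.
- rewrite /U -[in u (2 * pi)](add0r (2 * pi)) pu; congr (_ + _ * _).
  by apply: eq_bigr => i _; rewrite addrC pu add0r.
move=> t; apply: le_lt_trans uB.
have -> : U t - u 0 = (u t - u 0) + - (n%:R^-1 * \sum_i zeta i * (u (t + i%:R * tau n) - u 0)).
  under [in RHS]eq_bigr do rewrite mulrBr.
  rewrite big_split/= sumrN -big_distrl/= sum_expi_tau// mul0r subr0 /U; ring.
rewrite (le_trans (cabsD _ _))// cabsN mulr_natl mulr2n lerD// cabsM.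
have sumB : cabs (\sum_i zeta i * (u (t + i%:R * tau n) - u 0)) <= n%:R * B.
  have -> : n%:R * B = \sum_(i < n) B by rewrite sumr_const card_ord mulr_natl.
  elim/big_ind2: _ => [|x1 x2 z1 z2 h1 h2|i _]; first by rewrite cabs0.
    by rewrite (le_trans (cabsD _ _))// lerD.
  by rewrite cabsM cabs_expi mul1r.
have nR : 0 < n%:R :> R by rewrite ltr0n; case: (n) n2.
have cn : cabs (n%:R^-1 : R[i]) = n%:R^-1.
  apply: (mulIf (lt0r_neq0 nR)); rewrite mulVf ?gt_eqF//.
  have <- : cabs (n%:R : R[i]) = n%:R.
    have -> : n%:R = n%:R%:C%C :> R[i] by rewrite rmorph_nat.
    by rewrite cabs_real ger0_norm.
  by rewrite -cabsM mulVf// (_ : 1 = 1%:C%C :> R[i])// cabs_real normr1.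
by rewrite cn mulrC ler_pdivrMr// mulrC.
Qed.

(** In a relative equilibrium u(t) = e^(i lam t) u(0). If lam <> 0 then u(pi /
lam) = - u(0), at distance 2 |u(0)| > B from u(0); if lam = 0 then u is constant
and the bodies 0 and h0 coincide. *)
Lemma not_relative_equilibrium n k alpha omega y (B : R) h0 :
  (1 <= h0 < n)%N -> (n %| k * h0)%N -> Lambda n y ->
  (forall t, cabs (rot k%:Z y t - rot k%:Z y 0) <= B) -> 2 * B < cabs (rot k%:Z y 0) ->
  ~ relative_equilibrium alpha (fun i : 'I_n => inertial omega y i).
Proof.
move=> hn kh [_ ny] hB uB [q [theta [_ hq]]].
have n0 : (0 < n)%N by case/andP: hn => _; exact: leq_ltn_trans.
pose lam := k%:R + theta - omega.
have uE t : rot k%:Z y t = expi (lam * t) * rot k%:Z y 0.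
  have yE x : y x = expi ((theta - omega) * x) * q (Ordinal n0).
    have := hq (Ordinal n0) x; rewrite /inertial /bodies /= mul0r addr0 => h.
    rewrite (_ : (theta - omega) * x = - (omega * x) + theta * x); last by ring.
    by rewrite expiD -[RHS]mulrA -h [RHS]mulrA expiNr mul1r.
  have q0 : q (Ordinal n0) = y 0 by rewrite yE mulr0 expi0 mul1r.
  rewrite /rot mulr0 expi0 mul1r yE q0 mulrA -expiD; congr (expi _ * _).
  by rewrite /lam -pmulrn; ring.
have B0 : 0 <= B by exact: le_trans (cabs_ge0 _) (hB 0).
have [l0|l0] := eqVneq lam 0.
  have /eqP := ny 0 h0 hn; apply; apply/eqP; rewrite -subr_eq0; apply/eqP.
  by apply: cabs_eq0; rewrite (cluster_gap y 0 n0 kh) !(uE (_ + _)) l0 mul0r expi0 mul1r subrr cabs0.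
have := hB (pi / lam); rewrite uE [lam * _]mulrC divfK// /expi cospi sinpi.
have -> : Complex (-1) 0 * rot k%:Z y 0 - rot k%:Z y 0 = - (rot k%:Z y 0 + rot k%:Z y 0).
  by apply: complex_ext; rewrite ?ReB ?ImB ?ReN ?ImN ?ReD ?ImD ?ReM ?ImM/=; ring.
have -> : rot k%:Z y 0 + rot k%:Z y 0 = 2%:C%C * rot k%:Z y 0.
  by apply: complex_ext; rewrite ?ReD ?ImD ?ReM ?ImM/=; ring.
rewrite cabsN cabsM cabs_real ger0_norm//.
by move: uB B0; lra.
Qed.
End Winding.

(** * Clusters and the minimiser *)

Lemma cluster_exists n k : (2 <= n)%N -> (1 < gcdn k n)%N ->
  exists2 h, (1 <= h < n)%N & (n %| k * h)%N.
Proof.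
move=> n2 g1; have n0 : (0 < n)%N by exact: leq_trans n2.
have gn := dvdn_gcdr k n; have gk := dvdn_gcdl k n.
exists (n %/ gcdn k n)%N; first by rewrite divn_gt0 ?(ltnW g1)// dvdn_leq//= ltn_Pdiv.
by rewrite -{1}(divnK gk) -mulnA [(gcdn k n * _)%N]mulnC divnK// dvdn_mull.
Qed.

Lemma cluster_sum_gt0 (R : realType) n k h (alpha : R) : (1 <= h < n)%N -> (n %| k * h)%N ->
  0 < cluster_sum n k alpha.
Proof.
move=> hn kh; rewrite /cluster_sum big_mkcond (bigD1_seq h) ?iota_uniq ?mem_index_iota//= kh.
rewrite ltr_pwDl ?ipow_gt0 ?chord_gt0// sumr_ge0// => i _.
by case: ifP => // _; exact: ipow_ge0.
Qed.

Theorem theorem4 (R : realType) (n k : nat) (alpha : R)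
  (hn : (2 <= n)%N) (halpha : 0 < alpha) (hk : (0 < k)%N)
  (hgcd1 : (1 < gcdn k n)%N) (hgcdn : gcdn k n <> n) :
  exists2 epsilon : R, 0 < epsilon &
    forall omega : R, k%:R - epsilon < omega < k%:R + epsilon ->
      omega <> k%:R ->
      exists y : R -> R[i],
        [/\ Lambda n y,
            forall z : R -> R[i], Lambda n z ->
              (action n alpha omega y <= action n alpha omega z)%E,
            exists2 w : int,
              winding_number
                (fun t => y t - center_of_mass (fun i : 'I_n => bodies y i t)) w &
              absz w = k &
            ~ relative_equilibrium alpha
                (fun i : 'I_n => inertial omega y i)].
Proof.
have nk : ~~ (n %| k)%N by apply/negP => /gcdn_idPr.
have [h0 h0n kh0] := cluster_exists hn hgcd1.
have [r r0 rad] := exists_radius halpha (cluster_sum_gt0 alpha h0n kh0).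
have [eps1 [eta [m [B [eps10 eta0 m0 sub]]]]] := sublevel_bounds hn nk halpha r0 rad.
have [eps2 eps20 test] := test_orbit k hn halpha r0 eta0.
exists (Num.min eps1 eps2); first by rewrite lt_min eps10.
move=> omega; rewrite -ltr_distl lt_min => /andP[om1 om2] /eqP ok.
have d0 : 0 < (omega - k%:R) ^+ 2 by rewrite exprn_even_gt0//= subr_eq0.
pose C := 4 * eta / (omega - k%:R) ^+ 2 / pi + 2 * B ^+ 2.
have [y [v [Ly ly Ay ymin]]] : exists y v, [/\ Lambda n y, loop y v,
    act n alpha omega y v <= limit_action n k alpha r + eta &
    forall z w, Lambda n z -> loop z w -> act n alpha omega y v <= act n alpha omega z w].
  apply: (direct_method (M := Num.sqrt C + B) halpha m0 (test omega ok om2)) => y v Ly ly Ay.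
  have [hm osc _ hmass] := sub omega y v om1 Ly ly Ay; split=> // t.
  have lu := loop_rot k%:Z ly.
  have u0 : cabs (rot k%:Z y 0) <= Num.sqrt C.
    rewrite -[X in X <= _]ger0_norm ?cabs_ge0// -sqrtr_sqr ler_wsqrtr//.
    apply: (le_trans (mass_center lu osc)); rewrite lerD2r ler_pM2r ?invr_gt0 ?pi_gt0//.
    by rewrite ler_pdivlMr// mulrC.
  rewrite -(cabs_rot k%:Z) -[rot k%:Z y t](subrK (rot k%:Z y 0)) addrC.
  by rewrite (le_trans (cabsD _ _))// lerD.
have [_ osc uB _] := sub omega y v om1 Ly ly Ay.
exists y; split; first exact: Ly.
- move=> z Lz; have [w lw] := Lambda_loop Lz.
  have [_ _ hy] := ly; have [_ _ hw] := lw.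
  by rewrite (actionE _ _ Ly hy) (actionE _ _ Lz hw) lee_fin; exact: ymin.
- exists (- k%:Z); first exact: (winding_loop hn nk ly osc uB).
  by rewrite abszN.
exact: (not_relative_equilibrium h0n kh0 Ly osc uB).
Qed.
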